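(* Let $0<\nu<1$, $T>0$, let $k,f$ be sufficiently smooth functions on $[0,1]\times[0,T]$ with $0<c_1\le k(x,t)\le c_2$ and $k(x,t)=k(1-x,t)$, let $\mu\in C[0,T]$, and let $\alpha,\beta,\gamma$ be real numbers such that either 1) $|\alpha|<1$, $|\beta|<1$ and $\gamma\le0$; or 2) $|\alpha|>1$, $|\beta|>1$ and $\alpha\beta\gamma\le0$. Suppose that there exists a sufficiently smooth solution $u(x,t)$ of the problem $$\partial_{0t}^{\nu}u=\frac{\partial}{\partial x}\left(k(x,t)\frac{\partial u}{\partial x}\right)+f(x,t),\quad 0<x<1,\ 0<t\le T,$$ $$u(0,t)=\alpha u(1,t),\qquad k(1,t)u_x(1,t)=\beta k(0,t)u_x(0,t)+\gamma u(1,t)+\mu(t),\quad 0\le t\le T,$$ $$u(x,0)=u_0(x),\quad 0\le x\le1.$$ For integers $N\ge2$, $N_T\ge1$, put $h=1/N$, $\tau=T/N_T$, and let $(y_i^n)_{0\le i\le N,\,0\le n\le N_T}$ be a solution of the difference scheme $$\Delta_{0t_{n+\sigma}}^{\nu}y_i-(a y_{\bar x}^{(\sigma)})_{x,i}=\varphi_i^n,\quad i=1,\dots,N-1,\ 0\le n\le N_T-1,$$ $$y_0^{n+1}-\alpha y_N^{n+1}=0,\quad 0\le n\le N_T-1,$$ $$\beta\Delta_{0t_{n+\sigma}}^{\nu}y_0+\Delta_{0t_{n+\sigma}}^{\nu}y_N+\frac2h\left(a_N^ny_{\bar x,N}^{(\sigma)}-\beta a_1^ny_{x,0}^{(\sigma)}-\gamma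 y_N^{(\sigma)}\right)=\frac2h\mu(t_{n+\sigma})+\varphi_N^n+\beta\varphi_0^n,\quad 0\le n\le N_T-1,$$ $$y_i^0=u_0(x_i),\quad 0\le i\le N.$$ Then the solution of the difference problem converges to the solution of the differential problem in the (discrete) $L_2$-norm with rate equal to the order $O(\tau^2+h^2)$ of the approximation error of the scheme: there is a constant $C>0$ independent of $h$ and $\tau$ such that, for all $N\ge 2$, $N_T\ge 1$, $$\max_{0\le n\le N_T}|[y^n-u^n]|_0\le C(\tau^2+h^2),\qquad u_i^n=u(x_i,t_n).$$
   Context: Notation: $\partial_{0t}^{\nu}u(x,t)=\frac{1}{\Gamma(1-\nu)}\int_0^t\frac{u_s(x,s)}{(t-s)^{\nu}}\,ds$ is the Caputo fractional derivative. $\sigma=1-\nu/2$; $x_i=ih$, $t_n=n\tau$, $t_{n+\sigma}=t_n+\sigma\tau$; $a_i^n=k(x_i-0.5h,t_{n+\sigma})$ for $1\le i\le N$; $\varphi_i^n=f(x_i,t_{n+\sigma})$; $y_{\bar x,i}=(y_i-y_{i-1})/h$, $y_{x,i}=(y_{i+1}-y_i)/h$, $(ay_{\bar x})_{x,i}=(a_{i+1}y_{i+1}-(a_{i+1}+a_i)y_i+a_iy_{i-1})/h^2$ with $a=a^n$ at time level $n$; $y_i^{(\sigma)}=\sigma y_i^{n+1}+(1-\sigma)y_i^n$; $y_{t,i}^s=(y_i^{s+1}-y_i^s)/\tau$. The discrete Caputo derivative (L2-$1_\sigma$ formula) is $$\Delta_{0t_{n+\sigma}}^{\nu}y_i=\frac{\tau^{1-\nu}}{\Gamma(2-\nu)}\sum_{s=0}^nc_{n-s}^{(\nu,\sigma)}y_{t,i}^s,$$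 where $a_0^{(\nu,\sigma)}=\sigma^{1-\nu}$ and, for $l\ge1$, $$a_l^{(\nu,\sigma)}=(l+\sigma)^{1-\nu}-(l-1+\sigma)^{1-\nu},$$ $$b_l^{(\nu,\sigma)}=\frac1{2-\nu}\left[(l+\sigma)^{2-\nu}-(l-1+\sigma)^{2-\nu}\right]-\frac12\left[(l+\sigma)^{1-\nu}+(l-1+\sigma)^{1-\nu}\right];$$ for $n=0$, $c_0^{(\nu,\sigma)}=a_0^{(\nu,\sigma)}$; for $n\ge1$, $c_0^{(\nu,\sigma)}=a_0^{(\nu,\sigma)}+b_1^{(\nu,\sigma)}$, $c_s^{(\nu,\sigma)}=a_s^{(\nu,\sigma)}+b_{s+1}^{(\nu,\sigma)}-b_s^{(\nu,\sigma)}$ for $1\le s\le n-1$, and $c_n^{(\nu,\sigma)}=a_n^{(\nu,\sigma)}-b_n^{(\nu,\sigma)}$. Norm: $|[y]|_0^2=\sum_{i=0}^{N}y_i^2h$. ''Sufficiently smooth'' may be taken to mean: all partial derivatives $\partial_x^i\partial_t^ju$ with $i\le4$, $j\le3$ exist and are continuous on $[0,1]\times[0,T]$; $k$ has continuous $x$-derivatives up to order $3$ on $[0,1]\times[0,T]$; $f$ is continuous on $[0,1]\times[0,T]$. *)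

(* Defs.v *)
From Stdlib Require Export Reals.
From Coquelicot Require Export Coquelicot.
Open Scope R_scope.

(* Same as [is_derive], but increments are restricted to [a, b]: the usual
   derivative for a < x < b, the one-sided derivative at x = a and x = b. *)
Definition is_derive_on (a b : R) (g : R -> R) (x l : R) : Prop :=
  filterdiff g (within (fun y => a <= y <= b) (locally x)) (fun y => scal y l).

Definition ex_derive_on (a b : R) (g : R -> R) (x : R) : Prop :=
  exists l, is_derive_on a b g x l.

(* Meaningful when [ex_derive_on a b g x] and a <= x <= b, a < b. *)
Definition Derive_on (a b : R) (g : R -> R) (x : R) : R :=
  iota (is_derive_on a b g x).

Definition rect (T x t : R) : Prop := 0 <= x <= 1 /\ 0 <= t <= T.

Definition dx (v : R -> R -> R) : R -> R -> R :=
  fun x t => Derive_on 0 1 (fun z => v z t) x.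

Definition dt (T : R) (v : R -> R -> R) : R -> R -> R :=
  fun x t => Derive_on 0 T (v x) t.

Definition partial (T : R) (i j : nat) (v : R -> R -> R) : R -> R -> R :=
  Nat.iter i dx (Nat.iter j (dt T) v).

(* All d_x^i d_t^j v with i <= p, j <= q exist and are (jointly) continuous on
   [0,1] x [0,T]. *)
Definition smooth (p q : nat) (T : R) (v : R -> R -> R) : Prop :=
  (forall j x t, (j < q)%nat -> rect T x t ->
     ex_derive_on 0 T (partial T 0 j v x) t) /\
  (forall i j x t, (i < p)%nat -> (j <= q)%nat -> rect T x t ->
     ex_derive_on 0 1 (fun z => partial T i j v z t) x) /\
  (forall i j, (i <= p)%nat -> (j <= q)%nat ->
     continuous_on (fun P : R * R => rect T (fst P) (snd P))
                   (fun P : R * R => partial T i j v (fst P) (snd P))).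

(* Euler's integral; converges for z > 0, the only case used. *)
Definition Gamma (z : R) : R :=
  RInt_gen (fun s => Rpower s (z - 1) * exp (- s))
           (at_right 0) (Rbar_locally p_infty).

(* Improper at the upper end, where the kernel is singular.  The value of the
   two-sided [Derive g] at s = 0 is irrelevant to the integral. *)
Definition caputo (nu : R) (g : R -> R) (t : R) : R :=
  / Gamma (1 - nu) *
  RInt_gen (fun s => Derive g s / Rpower (t - s) nu) (at_point 0) (at_left t).

Record solves_problem (nu T alpha beta gamma : R) (k f : R -> R -> R)
    (mu u0 : R -> R) (u : R -> R -> R) : Prop := {
  problem_eq : forall x t, 0 < x < 1 -> 0 < t <= T ->
    caputo nu (u x) t = dx (fun z s => k z s * dx u z s) x t + f x t;
  problem_bc_value : forall t, 0 <= t <= T -> u 0 t = alpha * u 1 t;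
  problem_bc_flux : forall t, 0 <= t <= T ->
    k 1 t * dx u 1 t = beta * (k 0 t * dx u 0 t) + gamma * u 1 t + mu t;
  problem_init : forall x, 0 <= x <= 1 -> u x 0 = u0 x
}.

(* All bases of [Rpower] below are positive since sigma = 1 - nu/2 > 0. *)
Definition acoef (nu sigma : R) (l : nat) : R :=
  match l with
  | O => Rpower sigma (1 - nu)
  | S _ => Rpower (INR l + sigma) (1 - nu) - Rpower (INR l - 1 + sigma) (1 - nu)
  end.

(* Used for l >= 1 only. *)
Definition bcoef (nu sigma : R) (l : nat) : R :=
  / (2 - nu) *
    (Rpower (INR l + sigma) (2 - nu) - Rpower (INR l - 1 + sigma) (2 - nu))
  - / 2 *
    (Rpower (INR l + sigma) (1 - nu) + Rpower (INR l - 1 + sigma) (1 - nu)).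

(* c_s depends on the time level n through its first and last entries;
   used for s <= n only. *)
Definition ccoef (nu sigma : R) (n s : nat) : R :=
  match n, s with
  | O, _ => acoef nu sigma 0
  | S _, O => acoef nu sigma 0 + bcoef nu sigma 1
  | S _, S _ =>
      if Nat.ltb s n
      then acoef nu sigma s + bcoef nu sigma (S s) - bcoef nu sigma s
      else acoef nu sigma n - bcoef nu sigma n
  end.

(* [w n] is the value at time t_n; the result approximates the Caputo
   derivative at t_(n+sigma). *)
Definition caputo_h (nu sigma tau : R) (w : nat -> R) (n : nat) : R :=
  Rpower tau (1 - nu) / Gamma (2 - nu) *
  sum_f_R0 (fun s => ccoef nu sigma n (n - s) * ((w (S s) - w s) / tau)) n.

(* A grid function is y : nat -> nat -> R, with [y n i] standing for y_i^n. *)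

Definition xgrid (h : R) (i : nat) : R := INR i * h.
Definition tgrid (tau : R) (n : nat) : R := INR n * tau.
Definition tsig (sigma tau : R) (n : nat) : R := tgrid tau n + sigma * tau.

Definition level (sigma : R) (y : nat -> nat -> R) (n i : nat) : R :=
  sigma * y (S n) i + (1 - sigma) * y n i.

Definition diff_back (h : R) (v : nat -> R) (i : nat) : R :=
  (v i - v (i - 1)%nat) / h.

Definition diff_fwd (h : R) (v : nat -> R) (i : nat) : R :=
  (v (S i) - v i) / h.

Record solves_scheme (nu T alpha beta gamma : R) (k f : R -> R -> R)
    (mu u0 : R -> R) (N NT : nat) (y : nat -> nat -> R) : Prop := {
  scheme_eq :
    let sigma := 1 - nu / 2 in
    let h := 1 / INR N in
    let tau := T / INR NT in
    let a n i := k (xgrid h i - / 2 * h) (tsig sigma tau n) in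
    let phi n i := f (xgrid h i) (tsig sigma tau n) in
    forall n i, (n < NT)%nat -> (1 <= i <= N - 1)%nat ->
      caputo_h nu sigma tau (fun s => y s i) n
      - diff_fwd h (fun j => a n j * diff_back h (level sigma y n) j) i
      = phi n i;
  scheme_bc_value : forall n, (n < NT)%nat ->
    y (S n) O - alpha * y (S n) N = 0;
  scheme_bc_flux :
    let sigma := 1 - nu / 2 in
    let h := 1 / INR N in
    let tau := T / INR NT in
    let a n i := k (xgrid h i - / 2 * h) (tsig sigma tau n) in
    let phi n i := f (xgrid h i) (tsig sigma tau n) in
    forall n, (n < NT)%nat ->
      beta * caputo_h nu sigma tau (fun s => y s O) n
      + caputo_h nu sigma tau (fun s => y s N) n
      + 2 / h * (a n N * diff_back h (level sigma y n) N
                 - beta * (a n 1%nat * diff_fwd h (level sigma y n) 0)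
                 - gamma * level sigma y n N)
      = 2 / h * mu (tsig sigma tau n) + phi n N + beta * phi n O;
  scheme_init : forall i, (i <= N)%nat -> y O i = u0 (xgrid (1 / INR N) i)
}.

(* |[v]|_0 : the end points carry the full weight h. *)
Definition norm0 (N : nat) (v : nat -> R) : R :=
  sqrt (sum_f_R0 (fun i => v i ^ 2 * (1 / INR N)) N).

(* Main.v *)
(* Everything rests on one test function. Write [U] for a grid function with
   [U_0 = alpha U_N] and put
   [theta_i = (1 - alpha beta) U_i + (beta - alpha) U_(N-i)]. Then
   [theta_N = (1 - alpha^2) U_N] and [theta_0 = beta theta_N], so in the summed
   scheme the unknown fluxes at the two ends enter only as (flux at 1) - beta
   (flux at 0), which the flux condition prescribes. Splitting [U] into its even and odd parts
   about x = 1/2, the quadratic form sum U_i theta_i becomes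
   A |even|^2 + B |odd|^2 with A = (1-alpha)(1+beta), B = (1+alpha)(1-beta),
   which have a common sign s in both cases; the symmetry of k makes the
   gradient term coercive as well, and s (1 - alpha^2) gamma <= 0. Since
   alpha <> 1, the gradient controls the sup norm, so the residual is absorbed
   and the discrete Caputo derivative of the energy is O(residual^2).
   Monotonicity of the coefficients c_s, together with
   (2 sigma - 1) c_0 >= sigma c_1 and the lower bound for c_n, turns this into a
   bound of the energy itself, without any Gronwall argument.

   For consistency, the discrete Caputo derivative integrates a piecewise linear
   approximation of u_t against the kernel; the approximation is O(tau^2)
   except for a linear term on the last cell, whose integral vanishes by the
   choice of sigma. The boundary residual is only O(h + tau^2/h) pointwise but
   carries the weight h/2. *)

(* Testing with [U] itself fails: the boundary terms collect as [U_N] times (flux at 1) - alpha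
   (flux at 0), while the scheme prescribes (flux at 1) - beta (flux at 0). Among the combinations
   of [U_i] and [U_(N-i)], the requirement [theta_0 = beta theta_N] leaves only [theta], up to a
   factor. The two constants satisfy A B = (1 - alpha^2)(1 - beta^2), so a common sign means that
   |alpha| and |beta| lie on the same side of 1. The mirrored half of [theta] multiplies the flux
   through a cell by the increment over the mirror cell; the two cells must carry the same
   coefficient, hence the symmetry of k.

   The lower bound for c_n decays like n^(-nu), yet the final constant must not depend on tau. The
   factor tau^(-nu) of the discrete derivative compensates: the product is at least a multiple of
   T^(-nu) on all levels, which is where T^nu enters the stability constant.

   The differential equation is given for 0 < x < 1 only, but the boundary equation of the scheme
   imitates it at both ends. The consistency bound is therefore proved inside and carried to the
   ends by continuity in x. *)
Require Import Defs.
From Stdlib Require Import Reals.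
From Coquelicot Require Import Coquelicot.
From Stdlib Require Import Lra Lia Psatz.
Open Scope R_scope.

(** * One-sided calculus and Taylor estimates *)

Definition seg (a b x : R) : Prop := a <= x <= b.

(** Exactly what the mean value theorem asks for. Derivatives at the end points never have to be
    discussed, so one-sided ones cause no case distinctions. *)
Definition deriv_inside (a b : R) (g g' : R -> R) : Prop :=
  (forall z, a < z < b -> is_derive g z (g' z)) /\ continuous_on (seg a b) g.

Lemma clamp_seg (a b z : R) : a <= b -> seg a b (Rmax a (Rmin b z)).
Proof. unfold seg, Rmax, Rmin; repeat destruct Rle_dec; lra. Qed.

Lemma clamp_id (a b z : R) : seg a b z -> Rmax a (Rmin b z) = z.
Proof. unfold seg, Rmax, Rmin; repeat destruct Rle_dec; lra. Qed.

Lemma clamp_contract (a b y z : R) :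
  Rabs (Rmax a (Rmin b y) - Rmax a (Rmin b z)) <= Rabs (y - z).
Proof.
  unfold Rmax, Rmin, Rabs; repeat destruct Rle_dec; repeat destruct Rcase_abs; lra.
Qed.

(** Composition with the nonexpansive projection onto [a, b] extends [g] to the line, so that
    theorems stated with two-sided continuity apply up to the end points. *)
Lemma continuous_on_clamp (a b : R) (g : R -> R) :
  a <= b -> continuous_on (seg a b) g ->
  forall z, continuous (fun y => g (Rmax a (Rmin b y))) z.
Proof.
  intros Hab Hg z P HP.
  destruct (Hg _ (clamp_seg a b z Hab) P HP) as [d Hd].
  exists d. intros y Hy. apply Hd; [ | now apply clamp_seg].
  apply Rle_lt_trans with (2 := Hy). apply clamp_contract.
Qed.

Lemma mean_value_bound (a b M : R) (g g' : R -> R) :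
  deriv_inside a b g g' -> (forall z, seg a b z -> Rabs (g' z) <= M) ->
  forall x y, seg a b x -> seg a b y -> Rabs (g y - g x) <= M * Rabs (y - x).
Proof.
  intros [Hd Hc] HM x y Hx Hy.
  assert (Hab : a <= b) by (unfold seg in *; lra).
  set (G := fun z => g (Rmax a (Rmin b z))).
  assert (HG : forall z, seg a b z -> G z = g z).
  { intros z Hz; unfold G; now rewrite clamp_id. }
  assert (Hin : forall z, Rmin x y <= z <= Rmax x y -> seg a b z).
  { unfold seg, Rmin, Rmax in *; destruct Rle_dec; intros; lra. }
  destruct (MVT_gen G x y g') as [c [Hc1 Hc2]].
  - intros z Hz.
    assert (Hz' : a < z < b).
    { unfold seg, Rmin, Rmax in *; destruct Rle_dec; lra. }
    apply is_derive_ext_loc with g; [ | now apply Hd].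
    assert (He : 0 < Rmin (z - a) (b - z)) by (apply Rmin_pos; lra).
    exists (mkposreal _ He). intros w Hw.
    symmetry; apply HG. apply Rabs_def2 in Hw. simpl in Hw.
    generalize (Rmin_l (z - a) (b - z)) (Rmin_r (z - a) (b - z)).
    unfold minus, plus, opp in Hw; simpl in Hw. unfold seg; lra.
  - intros z _. apply continuity_pt_filterlim.
    now apply (continuous_on_clamp a b g).
  - rewrite <- (HG y Hy), <- (HG x Hx), Hc2, Rabs_mult.
    apply Rmult_le_compat_r; [apply Rabs_pos | ]. now apply HM, Hin.
Qed.

Lemma deriv_inside_subset (a b a' b' : R) (g g' : R -> R) :
  a <= a' -> b' <= b -> deriv_inside a b g g' -> deriv_inside a' b' g g'.
Proof.
  intros Ha Hb [Hd Hc]; split.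
  - intros z Hz; apply Hd; lra.
  - apply continuous_on_subset with (2 := Hc). unfold seg; intros; lra.
Qed.

Lemma deriv_inside_of_derive (a b : R) (g g' : R -> R) :
  (forall z, is_derive g z (g' z)) -> deriv_inside a b g g'.
Proof.
  intros H; split; [now intros z _ | ].
  apply continuous_on_forall; intros z _.
  apply (ex_derive_continuous g). now exists (g' z).
Qed.

Lemma continuous_on_add (D : R -> Prop) (g f : R -> R) :
  continuous_on D g -> continuous_on D f -> continuous_on D (fun z => g z + f z).
Proof.
  intros Hg Hf x Hx.
  apply (filterlim_comp_2 (F := within D (locally x)) g f Rplus (Hg x Hx) (Hf x Hx)).
  apply (filterlim_plus (K := R_AbsRing) (V := R_NormedModule)).
Qed.

Lemma continuous_on_mul (D : R -> Prop) (g f : R -> R) :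
  continuous_on D g -> continuous_on D f -> continuous_on D (fun z => g z * f z).
Proof.
  intros Hg Hf x Hx.
  apply (filterlim_comp_2 (F := within D (locally x)) g f Rmult (Hg x Hx) (Hf x Hx)).
  apply (filterlim_mult (K := R_AbsRing)).
Qed.

Lemma continuous_on_scal_l (D : R -> Prop) (c : R) (g : R -> R) :
  continuous_on D g -> continuous_on D (fun z => c * g z).
Proof.
  intros Hg; apply continuous_on_mul with (2 := Hg).
  apply continuous_on_forall; intros; apply continuous_const.
Qed.

Lemma deriv_inside_plus (a b : R) (g g' f f' : R -> R) :
  deriv_inside a b g g' -> deriv_inside a b f f' ->
  deriv_inside a b (fun z => g z + f z) (fun z => g' z + f' z).
Proof.
  intros [Hg Cg] [Hf Cf]; split; [ | now apply continuous_on_add].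
  intros z Hz. apply (is_derive_plus g f); auto.
Qed.

Lemma deriv_inside_mult (a b : R) (g g' f f' : R -> R) :
  deriv_inside a b g g' -> deriv_inside a b f f' ->
  deriv_inside a b (fun z => g z * f z) (fun z => g' z * f z + g z * f' z).
Proof.
  intros [Hg Cg] [Hf Cf]; split; [ | now apply continuous_on_mul].
  intros z Hz. apply (is_derive_mult g f); auto. exact Rmult_comm.
Qed.

Lemma deriv_inside_scal (a b c : R) (g g' : R -> R) :
  deriv_inside a b g g' -> deriv_inside a b (fun z => c * g z) (fun z => c * g' z).
Proof.
  intros [Hg Cg]; split; [ | now apply continuous_on_scal_l].
  intros z Hz. apply (is_derive_scal g z c (g' z)); auto.
Qed.

(** One Taylor order, by the mean value bound on the segment between [x] and [y], where |z - x| <=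
    |y - x|. Nothing is integrated, so the remainders below carry [M] instead of [M] over a
    factorial. *)
Lemma taylor_step (a b M x : R) (k : nat) (g g' : R -> R) :
  deriv_inside a b g g' -> seg a b x -> g x = 0 -> 0 <= M ->
  (forall z, seg a b z -> Rabs (g' z) <= M * Rabs (z - x) ^ k) ->
  forall y, seg a b y -> Rabs (g y) <= M * Rabs (y - x) ^ S k.
Proof.
  intros Hg Hx Hgx HM Hb y Hy.
  assert (Hin : forall z, seg (Rmin x y) (Rmax x y) z -> seg a b z /\ Rabs (z - x) <= Rabs (y - x)).
  { intros z; unfold seg, Rmin, Rmax, Rabs in *; destruct Rle_dec; repeat destruct Rcase_abs; lra. }
  assert (Hx' : seg (Rmin x y) (Rmax x y) x).
  { unfold seg; generalize (Rmin_l x y) (Rmax_l x y); lra. }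
  assert (Hy' : seg (Rmin x y) (Rmax x y) y).
  { unfold seg; generalize (Rmin_r x y) (Rmax_r x y); lra. }
  assert (Hg' : deriv_inside (Rmin x y) (Rmax x y) g g').
  { apply deriv_inside_subset with (3 := Hg); unfold seg, Rmin, Rmax in *; destruct Rle_dec; lra. }
  replace (g y) with (g y - g x) by lra.
  replace (M * Rabs (y - x) ^ S k) with (M * Rabs (y - x) ^ k * Rabs (y - x)) by (simpl; ring).
  apply (mean_value_bound _ _ _ g g' Hg'); auto.
  intros z Hz. destruct (Hin z Hz) as [H1 H2].
  apply Rle_trans with (1 := Hb z H1). apply Rmult_le_compat_l; auto.
  apply pow_incr; split; auto; apply Rabs_pos.
Qed.

Lemma deriv_inside_minus_poly (a b : R) (g g' p p' : R -> R) :
  deriv_inside a b g g' -> (forall z, is_derive p z (p' z)) ->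
  deriv_inside a b (fun z => g z - p z) (fun z => g' z - p' z).
Proof.
  intros Hg Hp. apply (deriv_inside_plus a b g g' (fun z => - p z) (fun z => - p' z) Hg).
  apply deriv_inside_of_derive. intros z. apply (is_derive_opp p), Hp.
Qed.

Lemma sup_bound_nonneg (a b M x : R) (g : R -> R) :
  seg a b x -> (forall z, seg a b z -> Rabs (g z) <= M) -> 0 <= M.
Proof. intros Hx H. apply Rle_trans with (2 := H x Hx). apply Rabs_pos. Qed.

Lemma taylor2 (a b M : R) (g0 g1 g2 : R -> R) :
  deriv_inside a b g0 g1 -> deriv_inside a b g1 g2 ->
  (forall z, seg a b z -> Rabs (g2 z) <= M) ->
  forall x y, seg a b x -> seg a b y ->
  Rabs (g0 y - g0 x - g1 x * (y - x)) <= M * Rabs (y - x) ^ 2.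
Proof.
  intros D0 D1 HM x y Hx Hy.
  assert (M0 := sup_bound_nonneg a b M x g2 Hx HM).
  replace (g0 y - g0 x - g1 x * (y - x)) with (g0 y - (g0 x + g1 x * (y - x))) by ring.
  apply (taylor_step a b M x 1 (fun y => g0 y - (g0 x + g1 x * (y - x))) (fun y => g1 y - g1 x)); auto.
  - apply deriv_inside_minus_poly with (1 := D0). intros z; auto_derive; auto; ring.
  - ring.
  - intros z Hz. simpl pow. rewrite Rmult_1_r. now apply (mean_value_bound a b M g1 g2).
Qed.

Lemma taylor3 (a b M : R) (g0 g1 g2 g3 : R -> R) :
  deriv_inside a b g0 g1 -> deriv_inside a b g1 g2 -> deriv_inside a b g2 g3 ->
  (forall z, seg a b z -> Rabs (g3 z) <= M) ->
  forall x y, seg a b x -> seg a b y ->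
  Rabs (g0 y - g0 x - g1 x * (y - x) - g2 x * (y - x) ^ 2 / 2) <= M * Rabs (y - x) ^ 3.
Proof.
  intros D0 D1 D2 HM x y Hx Hy.
  assert (M0 := sup_bound_nonneg a b M x g3 Hx HM).
  replace (g0 y - g0 x - g1 x * (y - x) - g2 x * (y - x) ^ 2 / 2)
    with (g0 y - (g0 x + g1 x * (y - x) + g2 x * (y - x) ^ 2 / 2)) by ring.
  apply (taylor_step a b M x 2 (fun y => g0 y - (g0 x + g1 x * (y - x) + g2 x * (y - x) ^ 2 / 2))
    (fun y => g1 y - (g1 x + g2 x * (y - x)))); auto.
  - apply deriv_inside_minus_poly with (1 := D0). intros z; auto_derive; auto; field.
  - field.
  - intros z Hz. replace (g1 z - (g1 x + g2 x * (z - x))) with (g1 z - g1 x - g2 x * (z - x)) by ring.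
    now apply (taylor2 a b M g1 g2 g3).
Qed.

Lemma taylor4 (a b M : R) (g0 g1 g2 g3 g4 : R -> R) :
  deriv_inside a b g0 g1 -> deriv_inside a b g1 g2 -> deriv_inside a b g2 g3 -> deriv_inside a b g3 g4 ->
  (forall z, seg a b z -> Rabs (g4 z) <= M) ->
  forall x y, seg a b x -> seg a b y ->
  Rabs (g0 y - g0 x - g1 x * (y - x) - g2 x * (y - x) ^ 2 / 2 - g3 x * (y - x) ^ 3 / 6)
  <= M * Rabs (y - x) ^ 4.
Proof.
  intros D0 D1 D2 D3 HM x y Hx Hy.
  assert (M0 := sup_bound_nonneg a b M x g4 Hx HM).
  replace (g0 y - g0 x - g1 x * (y - x) - g2 x * (y - x) ^ 2 / 2 - g3 x * (y - x) ^ 3 / 6)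
    with (g0 y - (g0 x + g1 x * (y - x) + g2 x * (y - x) ^ 2 / 2 + g3 x * (y - x) ^ 3 / 6)) by ring.
  apply (taylor_step a b M x 3
    (fun y => g0 y - (g0 x + g1 x * (y - x) + g2 x * (y - x) ^ 2 / 2 + g3 x * (y - x) ^ 3 / 6))
    (fun y => g1 y - (g1 x + g2 x * (y - x) + g3 x * (y - x) ^ 2 / 2))); auto.
  - apply deriv_inside_minus_poly with (1 := D0). intros z; auto_derive; auto; field.
  - field.
  - intros z Hz.
    replace (g1 z - (g1 x + g2 x * (z - x) + g3 x * (z - x) ^ 2 / 2))
      with (g1 z - g1 x - g2 x * (z - x) - g3 x * (z - x) ^ 2 / 2) by ring.
    now apply (taylor3 a b M g1 g2 g3 g4).
Qed.

(** * The L2-1_sigma coefficients *)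

Lemma is_derive_Rpower (p x : R) :
  0 < x -> is_derive (fun y => Rpower y p) x (p * Rpower x (p - 1)).
Proof. intros Hx. apply is_derive_Reals. now apply derivable_pt_lim_power. Qed.

Lemma is_derive_Rpower_succ (p x : R) :
  0 < x + 1 -> is_derive (fun y => Rpower (y + 1) p) x (p * Rpower (x + 1) (p - 1)).
Proof.
  intros Hx. replace (p * Rpower (x + 1) (p - 1)) with (1 * (p * Rpower (x + 1) (p - 1))) by ring.
  apply (is_derive_comp (fun y => Rpower y p) (fun y => y + 1)).
  - now apply is_derive_Rpower.
  - auto_derive; auto; ring.
Qed.

Lemma Rpower_pos (x p : R) : 0 < Rpower x p.
Proof. apply exp_pos. Qed.

Lemma Rpower_decr (q x y : R) : q <= 0 -> 0 < x <= y -> Rpower y q <= Rpower x q.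
Proof.
  intros Hq Hxy. unfold Rpower.
  destruct (Req_dec (q * ln y) (q * ln x)) as [E|E]; [rewrite E; lra | ].
  left. apply exp_increasing.
  assert (ln x <= ln y) by (apply ln_le; lra). nra.
Qed.

Lemma Rpower_succ (x p : R) : 0 < x -> Rpower x (p + 1) = x * Rpower x p.
Proof. intros Hx. rewrite Rpower_plus, Rpower_1 by auto. ring. Qed.

Lemma Rpower_small (p eps : R) : 0 < p -> 0 < eps ->
  exists d, 0 < d /\ forall x, 0 < x < d -> Rpower x p < eps.
Proof.
  intros Hp He. exists (Rpower eps (/ p)). split; [apply Rpower_pos | ]. intros x Hx.
  replace eps with (Rpower (Rpower eps (/ p)) p).
  - unfold Rpower at 1 2. apply exp_increasing, Rmult_lt_compat_l; [lra | ].
    apply ln_increasing; lra.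
  - rewrite Rpower_mult, Rinv_l, Rpower_1; lra.
Qed.

Lemma mean_value (f df : R -> R) (a b : R) :
  a < b -> (forall z, a <= z <= b -> is_derive f z (df z)) ->
  exists c, a < c < b /\ f b - f a = df c * (b - a).
Proof.
  intros Hab Hd. destruct (MVT_cor2 f df a b Hab) as [c [H1 H2]].
  - intros z Hz. apply is_derive_Reals. now apply Hd.
  - now exists c.
Qed.

(* With x = l - 1 + sigma, [incr p x] is a_l and [trap p x] is b_l. *)
Definition incr (p x : R) : R := Rpower (x + 1) p - Rpower x p.
Definition trap (p x : R) : R :=
  / (p + 1) * (Rpower (x + 1) (p + 1) - Rpower x (p + 1))
  - / 2 * (Rpower (x + 1) p + Rpower x p).
(** The entry c_s for 1 <= s <= n - 1 at x = s - 1 + sigma, taken as a function of a real variable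
    so that monotonicity in s follows from the sign of a derivative. *)
Definition interior_coef (p x : R) : R := incr p x + trap p (x + 1) - trap p x.

Section PowerCoefficients.
Variable p : R.
Hypothesis Hp : 0 < p < 1.

Let dincr (x : R) : R := p * Rpower (x + 1) (p - 1) - p * Rpower x (p - 1).
Let dtrap (x : R) : R := incr p x - / 2 * (p * Rpower (x + 1) (p - 1) + p * Rpower x (p - 1)).

Lemma is_derive_incr x : 0 < x -> is_derive (incr p) x (dincr x).
Proof.
  intros Hx. apply (is_derive_minus (fun x => Rpower (x + 1) p) (fun x => Rpower x p)).
  - apply is_derive_Rpower_succ; lra.
  - now apply is_derive_Rpower.
Qed.

Lemma is_derive_trap x : 0 < x -> is_derive (trap p) x (dtrap x).
Proof.
  intros Hx.
  replace (dtrap x) with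
    (/ (p + 1) * ((p + 1) * Rpower (x + 1) (p + 1 - 1) - (p + 1) * Rpower x (p + 1 - 1))
     - / 2 * (p * Rpower (x + 1) (p - 1) + p * Rpower x (p - 1))).
  - apply (is_derive_minus (fun x => / (p + 1) * (Rpower (x + 1) (p + 1) - Rpower x (p + 1)))
      (fun x => / 2 * (Rpower (x + 1) p + Rpower x p))).
    + apply is_derive_scal.
      apply (is_derive_minus (fun x => Rpower (x + 1) (p + 1)) (fun x => Rpower x (p + 1)));
        [apply is_derive_Rpower_succ | apply is_derive_Rpower]; lra.
    + apply is_derive_scal.
      apply (is_derive_plus (fun x => Rpower (x + 1) p) (fun x => Rpower x p));
        [apply is_derive_Rpower_succ | apply is_derive_Rpower]; lra.
  - unfold dtrap, incr. replace (p + 1 - 1) with p by ring. field. lra.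
Qed.

Lemma dincr_nonpos x : 0 < x -> dincr x <= 0.
Proof.
  intros Hx. unfold dincr.
  assert (Rpower (x + 1) (p - 1) <= Rpower x (p - 1)) by (apply Rpower_decr; lra). nra.
Qed.

Lemma dincr_incr x y : 0 < x <= y -> dincr x <= dincr y.
Proof.
  intros [Hx [Hxy| ->]]; [ | lra].
  destruct (mean_value dincr
    (fun z => p * ((p - 1) * Rpower (z + 1) (p - 1 - 1)) - p * ((p - 1) * Rpower z (p - 1 - 1)))
    x y Hxy) as [c [Hc H]].
  - intros z Hz.
    apply (is_derive_minus (fun z => p * Rpower (z + 1) (p - 1)) (fun z => p * Rpower z (p - 1)));
      apply is_derive_scal; [apply is_derive_Rpower_succ | apply is_derive_Rpower]; lra.
  - assert (Rpower (c + 1) (p - 1 - 1) <= Rpower c (p - 1 - 1)) by (apply Rpower_decr; lra).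
    assert (0 <= p * (1 - p) * (Rpower c (p - 1 - 1) - Rpower (c + 1) (p - 1 - 1))).
    { apply Rmult_le_pos; nra. }
    assert (0 <= dincr y - dincr x); [ | lra]. rewrite H. apply Rmult_le_pos; lra.
Qed.

(* The derivative at [x] is at most [(dincr x + dincr (x + 1)) / 2], since
   [incr] is convex. *)
Lemma interior_coef_decr x y : 0 < x <= y -> interior_coef p y <= interior_coef p x.
Proof.
  intros [Hx [Hxy| ->]]; [ | lra].
  destruct (mean_value (interior_coef p)
    (fun z => dincr z + dtrap (z + 1) - dtrap z) x y Hxy) as [c [Hc H]].
  - intros z Hz.
    apply (is_derive_minus (fun z => incr p z + trap p (z + 1)) (trap p)).
    + apply (is_derive_plus (incr p) (fun z => trap p (z + 1))).
      * apply is_derive_incr; lra.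
      * replace (dtrap (z + 1)) with (1 * dtrap (z + 1)) by ring.
        apply (is_derive_comp (trap p) (fun z => z + 1)).
        -- apply is_derive_trap; lra.
        -- auto_derive; auto; ring.
    + apply is_derive_trap; lra.
  - destruct (mean_value (incr p) dincr c (c + 1)) as [d [Hd Hi]]; [lra | | ].
    { intros z Hz; apply is_derive_incr; lra. }
    assert (dincr d <= dincr (c + 1)) by (apply dincr_incr; lra).
    assert (dincr c <= 0) by (apply dincr_nonpos; lra).
    assert (dincr (c + 1) <= 0) by (apply dincr_nonpos; lra).
    assert (dtrap (c + 1) - dtrap c = incr p (c + 1) - incr p c - / 2 * (dincr c + dincr (c + 1)))
      by (unfold dtrap, dincr; field).
    replace (c + 1 - c) with 1 in Hi by ring.
    assert (interior_coef p y - interior_coef p x <= 0); [ | lra].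
    rewrite H. assert (0 <= y - x) by lra. assert (dincr c + dtrap (c + 1) - dtrap c <= 0) by lra. nra.
Qed.

(** [trap p x] is the integral of y^p over [x, x + 1] minus its trapezoidal rule, and y^p is
    concave. [G] is the same defect with a free right end; its derivative is nonnegative because the
    slope of the chord from [x] to [y] is at least the slope at [y]. *)
Lemma trap_nonneg x : 0 < x -> 0 <= trap p x.
Proof.
  intros Hx.
  set (G := fun y => / (p + 1) * (Rpower y (p + 1) - Rpower x (p + 1))
                     - / 2 * ((y - x) * (Rpower y p + Rpower x p))).
  assert (HG : forall y, x <= y ->
    is_derive G y (/ 2 * (Rpower y p - Rpower x p - (y - x) * (p * Rpower y (p - 1))))).
  { intros y Hy.
    replace (/ 2 * (Rpower y p - Rpower x p - (y - x) * (p * Rpower y (p - 1)))) with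
      (/ (p + 1) * ((p + 1) * Rpower y (p + 1 - 1) - 0)
       - / 2 * (1 * (Rpower y p + Rpower x p) + (y - x) * (p * Rpower y (p - 1) + 0)))
      by (replace (p + 1 - 1) with p by ring; field; lra).
    apply (is_derive_minus (fun y => / (p + 1) * (Rpower y (p + 1) - Rpower x (p + 1)))
       (fun y => / 2 * ((y - x) * (Rpower y p + Rpower x p)))).
    - apply is_derive_scal.
      apply (is_derive_minus (fun y => Rpower y (p + 1)) (fun _ => Rpower x (p + 1))).
      + apply is_derive_Rpower; lra.
      + now auto_derive.
    - apply is_derive_scal.
      apply (is_derive_mult (fun y => y - x) (fun y => Rpower y p + Rpower x p)).
      + auto_derive; auto; ring.
      + apply (is_derive_plus (fun y => Rpower y p) (fun _ => Rpower x p)).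
        * apply is_derive_Rpower; lra.
        * now auto_derive.
      + exact Rmult_comm. }
  destruct (mean_value G (fun y => / 2 * (Rpower y p - Rpower x p - (y - x) * (p * Rpower y (p - 1))))
    x (x + 1)) as [c [Hc H]]; [lra | now intros z Hz; apply HG | ].
  destruct (mean_value (fun y => Rpower y p) (fun y => p * Rpower y (p - 1)) x c) as [d [Hd Hi]];
    [lra | intros z Hz; apply is_derive_Rpower; lra | ].
  assert (H1 : Rpower c (p - 1) <= Rpower d (p - 1)) by (apply Rpower_decr; lra).
  replace (trap p x) with (G (x + 1) - G x) by (unfold G, trap; ring).
  rewrite H, Hi.
  assert (0 <= p * (c - x) * (Rpower d (p - 1) - Rpower c (p - 1))) by (apply Rmult_le_pos; nra).
  lra.
Qed.

Lemma Rpower_incr_lower x : 0 < x -> p * Rpower (x + 1) (p - 1) <= incr p x.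
Proof.
  intros Hx.
  destruct (mean_value (fun y => Rpower y p) (fun y => p * Rpower y (p - 1)) x (x + 1)) as [d [Hd Hi]];
    [lra | intros z Hz; apply is_derive_Rpower; lra | ].
  assert (H1 : Rpower (x + 1) (p - 1) <= Rpower d (p - 1)) by (apply Rpower_decr; lra).
  unfold incr; rewrite Hi. replace (x + 1 - x) with 1 by ring. nra.
Qed.

Lemma Rpower_incr_upper x : 0 < x -> incr p x <= p * Rpower x (p - 1).
Proof.
  intros Hx.
  destruct (mean_value (fun y => Rpower y p) (fun y => p * Rpower y (p - 1)) x (x + 1)) as [d [Hd Hi]];
    [lra | intros z Hz; apply is_derive_Rpower; lra | ].
  assert (H1 : Rpower d (p - 1) <= Rpower x (p - 1)) by (apply Rpower_decr; lra).
  unfold incr; rewrite Hi. replace (x + 1 - x) with 1 by ring. nra.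
Qed.

(** Bounding the integral inside [trap] by (x + 1)^p leaves one half of [incr p x]. *)
Lemma incr_minus_trap_lower x : 0 < x -> p / 2 * Rpower (x + 1) (p - 1) <= incr p x - trap p x.
Proof.
  intros Hx.
  destruct (mean_value (fun y => / (p + 1) * Rpower y (p + 1)) (fun y => Rpower y p) x (x + 1))
    as [d [Hd Hi]]; [lra | | ].
  { intros z Hz.
    replace (Rpower z p) with (/ (p + 1) * ((p + 1) * Rpower z (p + 1 - 1)))
      by (replace (p + 1 - 1) with p by ring; field; lra).
    apply is_derive_scal, is_derive_Rpower; lra. }
  assert (H1 : Rpower d p <= Rpower (x + 1) p) by (apply Rle_Rpower_l; lra).
  assert (H2 := Rpower_incr_lower x Hx).
  replace (x + 1 - x) with 1 in Hi by ring.
  unfold trap, incr in *. rewrite Rmult_minus_distr_l, Hi. lra.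
Qed.
End PowerCoefficients.

Section CaputoCoefficients.
Variable nu : R.
Hypothesis Hnu : 0 < nu < 1.
Let p := 1 - nu.
Let sg := 1 - nu / 2.

Lemma acoef_incr l : acoef nu sg (S l) = incr p (INR l + sg).
Proof.
  unfold acoef, incr, p. rewrite S_INR.
  replace (INR l + 1 + sg) with (INR l + sg + 1) by ring.
  replace (INR l + 1 - 1 + sg) with (INR l + sg) by ring. reflexivity.
Qed.

Lemma bcoef_trap l : bcoef nu sg (S l) = trap p (INR l + sg).
Proof.
  unfold bcoef, trap, p. rewrite S_INR.
  replace (INR l + 1 + sg) with (INR l + sg + 1) by ring.
  replace (INR l + 1 - 1 + sg) with (INR l + sg) by ring.
  now replace (1 - nu + 1) with (2 - nu) by ring.
Qed.

Lemma INR_plus_sigma_pos l : 0 < INR l + sg.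
Proof. unfold sg. generalize (pos_INR l). lra. Qed.

Lemma ccoef_interior n s : (S s < n)%nat -> ccoef nu sg n (S s) = interior_coef p (INR s + sg).
Proof.
  intros H. destruct n as [|n]; [lia | ]. unfold ccoef.
  rewrite (proj2 (Nat.ltb_lt (S s) (S n)) H).
  rewrite acoef_incr, !bcoef_trap, S_INR. unfold interior_coef.
  now replace (INR s + 1 + sg) with (INR s + sg + 1) by ring.
Qed.

Lemma ccoef_last n : ccoef nu sg (S n) (S n) = incr p (INR n + sg) - trap p (INR n + sg).
Proof. unfold ccoef. now rewrite Nat.ltb_irrefl, acoef_incr, bcoef_trap. Qed.

(** The last entry c_n differs from the interior formula by the missing b_(n+1), which is
    nonnegative. This lets the monotonicity proofs treat c_n like an interior entry on the small
    side. *)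
Lemma ccoef_le_interior n s : (S s <= n)%nat -> ccoef nu sg n (S s) <= interior_coef p (INR s + sg).
Proof.
  intros H. destruct (Nat.eq_dec (S s) n) as [<-|Hne].
  - rewrite ccoef_last. unfold interior_coef.
    assert (0 <= trap p (INR s + sg + 1)); [ | lra].
    apply trap_nonneg; [unfold p; lra | ]. generalize (INR_plus_sigma_pos s); lra.
  - rewrite ccoef_interior by lia. lra.
Qed.

(** The choice of sigma gives p + 1 = 2 sigma, and then all terms in sigma^p cancel. The same
    happens for c_1 below. *)
Lemma ccoef_zero n : ccoef nu sg (S n) 0 = Rpower (1 + sg) p / (2 * sg).
Proof.
  unfold ccoef. rewrite bcoef_trap. simpl INR. unfold acoef, trap. fold p.
  rewrite Rplus_0_l. assert (0 < sg) by (unfold sg; lra).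
  rewrite !Rpower_succ by lra.
  replace (p + 1) with (2 * sg) by (unfold p, sg; field).
  replace (sg + 1) with (1 + sg) by ring. field. lra.
Qed.

Lemma interior_coef_first : interior_coef p sg = (Rpower (2 + sg) p - Rpower (1 + sg) p) / sg.
Proof.
  unfold interior_coef, incr, trap. assert (0 < sg) by (unfold sg; lra).
  rewrite !Rpower_succ by lra.
  replace (p + 1) with (2 * sg) by (unfold p, sg; field).
  replace (sg + 1 + 1) with (2 + sg) by ring.
  replace (sg + 1) with (1 + sg) by ring. field. lra.
Qed.

(** With the closed forms and 2 sigma - 1 = p, the left side is at most (2 + sigma)^p - (1 +
    sigma)^p <= p (1 + sigma)^(p-1), and the right side is that bound times (1 + sigma) / (2 sigma)
    >= 1. It compensates for the evaluation at t_(n+sigma) instead of t_(n+1) in the energy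
    inequality. *)
Lemma ccoef_first_pair n : sg * ccoef nu sg (S n) 1 <= (2 * sg - 1) * ccoef nu sg (S n) 0.
Proof.
  assert (Hs : 0 < sg < 1) by (unfold sg; lra).
  apply Rle_trans with (sg * interior_coef p (INR 0 + sg)).
  { apply Rmult_le_compat_l; [lra | ]. apply ccoef_le_interior; lia. }
  simpl INR. rewrite Rplus_0_l, interior_coef_first, ccoef_zero.
  assert (Hp : 0 < p < 1) by (unfold p; lra).
  assert (H := Rpower_incr_upper p Hp (1 + sg) ltac:(lra)). unfold incr in H.
  replace (1 + sg + 1) with (2 + sg) in H by ring.
  assert (E : Rpower (1 + sg) p = (1 + sg) * Rpower (1 + sg) (p - 1)).
  { rewrite <- Rpower_succ by lra. f_equal; ring. }
  replace (2 * sg - 1) with p by (unfold p, sg; field).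
  replace (sg * ((Rpower (2 + sg) p - Rpower (1 + sg) p) / sg))
    with (Rpower (2 + sg) p - Rpower (1 + sg) p) by (field; lra).
  apply Rle_trans with (1 := H). rewrite E.
  assert (H0 : 0 < p * Rpower (1 + sg) (p - 1)) by (apply Rmult_lt_0_compat; [lra | apply Rpower_pos]).
  replace (p * ((1 + sg) * Rpower (1 + sg) (p - 1) / (2 * sg)))
    with (p * Rpower (1 + sg) (p - 1) * ((1 + sg) / (2 * sg))) by (field; lra).
  rewrite <- (Rmult_1_r (p * Rpower (1 + sg) (p - 1))) at 1.
  apply Rmult_le_compat_l; [lra | ].
  apply Rmult_le_reg_r with (2 * sg); [lra | ].
  replace ((1 + sg) / (2 * sg) * (2 * sg)) with (1 + sg) by (field; lra). lra.
Qed.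

Lemma ccoef_last_lower n : p / 2 * Rpower (INR n + sg) (p - 1) <= ccoef nu sg n n.
Proof.
  destruct n as [|n].
  - simpl. rewrite Rplus_0_l. fold p. assert (Hs : 0 < sg < 1) by (unfold sg; lra).
    replace (Rpower sg p) with (sg * Rpower sg (p - 1)).
    + assert (H := Rpower_pos sg (p - 1)). apply Rmult_le_compat_r; [lra | unfold p, sg; lra].
    + rewrite <- Rpower_succ by lra. f_equal; ring.
  - rewrite ccoef_last, S_INR. replace (INR n + 1 + sg) with (INR n + sg + 1) by ring.
    apply incr_minus_trap_lower; [unfold p; lra | apply INR_plus_sigma_pos].
Qed.

Lemma ccoef_last_pos n : 0 < ccoef nu sg n n.
Proof.
  apply Rlt_le_trans with (2 := ccoef_last_lower n).
  apply Rmult_lt_0_compat; [unfold p; lra | apply Rpower_pos].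
Qed.

(** The step from c_0 to c_1 has a different shape and follows from [ccoef_first_pair], as 2 sigma -
    1 <= sigma; all later steps follow from [interior_coef_decr]. *)
Lemma ccoef_decr n s : (s < n)%nat -> ccoef nu sg n (S s) <= ccoef nu sg n s.
Proof.
  intros H. destruct s as [|s].
  - destruct n as [|n]; [lia | ].
    assert (H1 := ccoef_first_pair n).
    assert (0 <= ccoef nu sg (S n) 0).
    { rewrite ccoef_zero. assert (Hs : 0 < sg < 1) by (unfold sg; lra).
      apply Rdiv_le_0_compat; [left; apply Rpower_pos | lra]. }
    assert (Hs : / 2 < sg < 1) by (unfold sg; lra).
    apply Rmult_le_reg_l with sg; [lra | ]. apply Rle_trans with (1 := H1).
    apply Rmult_le_compat_r; lra.
  - rewrite (ccoef_interior n s) by lia.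
    apply Rle_trans with (1 := ccoef_le_interior n (S s) H).
    apply interior_coef_decr; [unfold p; lra | ]. rewrite S_INR. generalize (INR_plus_sigma_pos s); lra.
Qed.

Lemma ccoef_nonneg n s : (s <= n)%nat -> 0 <= ccoef nu sg n s.
Proof.
  intros H. apply Rle_trans with (ccoef nu sg n n); [left; apply ccoef_last_pos | ].
  assert (Hd : forall d, (d <= n - s)%nat -> ccoef nu sg n (s + d) <= ccoef nu sg n s).
  { induction d as [|d IH]; intros Hd; [rewrite Nat.add_0_r; lra | ].
    apply Rle_trans with (2 := IH ltac:(lia)). rewrite Nat.add_succ_r. apply ccoef_decr; lia. }
  replace n with (s + (n - s))%nat at 2 by lia. now apply Hd.
Qed.
End CaputoCoefficients.

(** * Discrete fractional energy and comparison *)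

Lemma weighted_increments_lower (g e : nat -> R) (K : R) (m : nat) :
  (forall s, (s < m)%nat -> g s <= g (S s)) ->
  (forall s, (s <= m)%nat -> e s <= K) ->
  g m * (e (S m) - K) + g 0%nat * (K - e 0%nat)
    <= sum_f_R0 (fun s => g s * (e (S s) - e s)) m.
Proof.
  induction m as [|m IH]; intros Hg He.
  - simpl; lra.
  - rewrite tech5.
    assert (H1 := IH (fun s H => Hg s (Nat.lt_lt_succ_r _ _ H)) (fun s H => He s (le_S _ _ H))).
    assert (H2 := Hg m (Nat.lt_succ_diag_r m)). assert (H3 := He (S m) (le_n _)).
    nra.
Qed.

(** The difference of the two sides is the weighted sum of increments of the quadratic [phi] below.
    All values up to [phi n] lie under its maximum, so the sum over the past is at least -g_(n-1)
    times the gap of [phi n]; the last increment of [phi] must pay for that gap. *)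
Lemma caputo_energy_inequality (sg : R) (g v : nat -> R) (n : nat) :
  / 2 <= sg <= 1 ->
  (forall s, (s <= n)%nat -> 0 <= g s) ->
  (forall s, (s < n)%nat -> g s <= g (S s)) ->
  (forall m, n = S m -> sg * g m <= (2 * sg - 1) * g n) ->
  / 2 * sum_f_R0 (fun s => g s * (v (S s) ^ 2 - v s ^ 2)) n
  <= (sg * v (S n) + (1 - sg) * v n) * sum_f_R0 (fun s => g s * (v (S s) - v s)) n.
Proof.
  intros Hs Hg0 Hg Hlast.
  set (c := sg * v (S n) + (1 - sg) * v n).
  (* [phi] is a concave quadratic with maximum [c^2/2], attained at [c] *)
  set (phi := fun s => c * v s - v s ^ 2 / 2).
  assert (Heq : forall k, c * sum_f_R0 (fun s => g s * (v (S s) - v s)) k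
      - / 2 * sum_f_R0 (fun s => g s * (v (S s) ^ 2 - v s ^ 2)) k
      = sum_f_R0 (fun s => g s * (phi (S s) - phi s)) k).
  { induction k as [|k IH]; [ | rewrite !tech5, <- IH]; unfold phi; simpl; field. }
  assert (0 <= sum_f_R0 (fun s => g s * (phi (S s) - phi s)) n).
  2: { rewrite <- Heq in H. lra. }
  assert (Hmax : forall s, phi s <= c ^ 2 / 2).
  { intros s; unfold phi. generalize (pow2_ge_0 (v s - c)). nra. }
  assert (Hd : phi (S n) - phi n = (2 * sg - 1) / 2 * (v (S n) - v n) ^ 2).
  { unfold phi, c. field. }
  assert (Hq : c ^ 2 / 2 - phi n = sg ^ 2 / 2 * (v (S n) - v n) ^ 2).
  { unfold phi, c. field. }
  set (w := (v (S n) - v n) ^ 2) in *.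
  assert (Hw : 0 <= w) by apply pow2_ge_0.
  destruct n as [|m].
  - simpl. rewrite Hd. apply Rmult_le_pos; [now apply Hg0 | ]. apply Rmult_le_pos; lra.
  - rewrite tech5.
    assert (H1 := weighted_increments_lower g phi (c ^ 2 / 2) m
       (fun s H => Hg s (Nat.lt_lt_succ_r _ _ H)) (fun s _ => Hmax s)).
    assert (H2 : 0 <= g 0%nat * (c ^ 2 / 2 - phi 0%nat)).
    { apply Rmult_le_pos; [apply Hg0; lia | ]. generalize (Hmax 0%nat); lra. }
    assert (H3 := Hlast m eq_refl). assert (H4 := Hg0 m (le_S _ _ (le_n m))).
    rewrite Hd.
    replace (g m * (phi (S m) - c ^ 2 / 2)) with (- (g m * sg ^ 2 / 2 * w)) in H1
      by (replace (phi (S m)) with (c ^ 2 / 2 - sg ^ 2 / 2 * w) by lra; field).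
    (* The gap is sigma^2 w / 2 and the last increment is (2 sigma - 1) w / 2, so this is the exact
       condition; [Hlast] implies it because sigma <= 1. *)
    assert (H5 : g m * sg ^ 2 <= (2 * sg - 1) * g (S m)).
    { apply Rle_trans with (2 := H3).
      assert (0 <= g m * (sg * (1 - sg))) by (apply Rmult_le_pos; [ | apply Rmult_le_pos]; lra).
      lra. }
    assert (H6 := Rmult_le_compat_r w _ _ Hw H5). lra.
Qed.

(** A discrete maximum principle with the constant K = q / kap as barrier. If earlier values are at
    most K, summation by parts gives c_0 (E_(n+1) - K) + c_n K <= q, while c_n K >= kap K = q; hence
    E_(n+1) <= K, since c_0 >= c_n > 0. *)
Lemma memory_comparison (c : nat -> nat -> R) (E : nat -> R) (NT : nat) (q kap : R) :
  0 < kap -> 0 <= q -> E 0%nat = 0 ->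
  (forall n, (n < NT)%nat -> kap <= c n n) ->
  (forall n s, (n < NT)%nat -> (s < n)%nat -> c n (S s) <= c n s) ->
  (forall n, (n < NT)%nat ->
     sum_f_R0 (fun s => c n (n - s)%nat * (E (S s) - E s)) n <= q) ->
  forall n, (n <= NT)%nat -> E n <= q / kap.
Proof.
  intros Hk Hq HE0 Hlow Hmon Hsum.
  assert (HK : 0 <= q / kap) by (apply Rdiv_le_0_compat; lra).
  induction n as [n IH] using (well_founded_induction Nat.lt_wf_0). intros Hn.
  destruct n as [|n]; [lra | ].
  assert (H1 := weighted_increments_lower (fun s => c n (n - s)%nat) E (q / kap) n).
  cbv beta in H1. rewrite Nat.sub_diag, Nat.sub_0_r, HE0 in H1.
  assert (H2 := Hsum n Hn). assert (H3 := Hlow n Hn).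
  assert (H4 : q <= c n n * (q / kap)).
  { replace q with (kap * (q / kap)) at 1 by (field; lra). now apply Rmult_le_compat_r. }
  assert (H5 : c n n <= c n 0%nat).
  { assert (H : forall j, (j <= n)%nat -> c n j <= c n 0%nat).
    { induction j as [|j IHj]; intros Hj; [lra | ].
      apply Rle_trans with (2 := IHj ltac:(lia)). apply Hmon; lia. }
    now apply H. }
  assert (H6 : c n 0%nat * (E (S n) - q / kap) <= 0).
  { assert (H7 : c n 0%nat * (E (S n) - q / kap) + c n n * (q / kap - 0) <= q); [ | lra].
    apply Rle_trans with (2 := H2). apply H1.
    - intros s Hs. replace (n - s)%nat with (S (n - S s)) by lia. apply Hmon; lia.
    - intros s Hs. apply IH; lia. }
  nra.
Qed.

(** * Euler's Gamma function *)

Lemma continuous_Rpower (p s : R) : 0 < s -> continuous (fun s => Rpower s p) s.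
Proof.
  intros Hs. apply (ex_derive_continuous (fun s => Rpower s p)).
  eexists. now apply is_derive_Rpower.
Qed.

Lemma continuous_gamma_kernel (p s : R) : 0 < s -> continuous (fun s => Rpower s p * exp (- s)) s.
Proof.
  intros Hs. apply (continuous_mult (fun s => Rpower s p) (fun s => exp (- s))).
  - now apply continuous_Rpower.
  - apply (ex_derive_continuous (fun s => exp (- s))). now auto_derive.
Qed.

Lemma ex_RInt_pos_domain (f : R -> R) (a b : R) :
  (forall s, 0 < s -> continuous f s) -> 0 < a -> 0 < b -> ex_RInt f a b.
Proof.
  intros Hf Ha Hb. apply (ex_RInt_continuous f). intros z [Hz _]. apply Hf.
  apply Rlt_le_trans with (2 := Hz). now apply Rmin_glb_lt.
Qed.

(* Monotone convergence: the value is the supremum of the proper integrals. *)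
Lemma improper_integral_pos (f : R -> R) (M : R) :
  (forall s, 0 < s -> continuous f s) -> (forall s, 0 < s -> 0 < f s) ->
  (forall a b, 0 < a <= b -> RInt f a b <= M) ->
  exists l, 0 < l /\ is_RInt_gen f (at_right 0) (Rbar_locally p_infty) l.
Proof.
  intros Hc Hpos HM.
  assert (Hex : forall a b, 0 < a -> 0 < b -> ex_RInt f a b) by (intros; now apply ex_RInt_pos_domain).
  destruct (completeness (fun v => exists a b, 0 < a <= b /\ v = RInt f a b)) as [l [Hub Hlub]].
  { exists M. intros v [a [b [Hab ->]]]. now apply HM. }
  { exists (RInt f 1 1), 1, 1. split; [lra | auto]. }
  assert (Hmono : forall a b a' b', 0 < a' <= a -> a <= b -> b <= b' -> RInt f a b <= RInt f a' b').
  { intros a b a' b' Ha Hab Hb.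
    rewrite <- (RInt_Chasles f a' a b') by (apply Hex; lra).
    rewrite <- (RInt_Chasles f a b b') by (apply Hex; lra).
    assert (H1 : 0 <= RInt f a' a).
    { apply RInt_ge_0; [lra | apply Hex; lra | ]. intros; left; apply Hpos; lra. }
    assert (H2 : 0 <= RInt f b b').
    { apply RInt_ge_0; [lra | apply Hex; lra | ]. intros; left; apply Hpos; lra. }
    change plus with Rplus. lra. }
  exists l. split.
  - apply Rlt_le_trans with (RInt f 1 2).
    + apply RInt_gt_0; [lra | intros; apply Hpos; lra | intros; apply Hc; lra].
    + apply Hub. exists 1, 2. split; [lra | auto].
  - intros P [eps HP].
    assert (H : exists a b, 0 < a <= b /\ l - eps < RInt f a b).
    { apply Classical_Prop.NNPP. intros Hn.
      assert (Hb := Hlub (l - eps)). destruct eps as [eps He]; simpl in *.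
      assert (l <= l - eps); [ | lra]. apply Hb.
      intros v [a [b [Hab ->]]]. apply Rnot_lt_le. intros Hlt. apply Hn. now exists a, b. }
    destruct H as [a [b [Hab Hlt]]].
    unfold filtermapi. apply Filter_prod with (fun x => 0 < x < a) (fun y => b < y).
    + assert (Ha : 0 < a) by lra. exists (mkposreal a Ha). intros y Hy H0. split; auto.
      apply Rabs_def2 in Hy. unfold minus, plus, opp in Hy; simpl in Hy. lra.
    + now exists b.
    + intros x y Hx Hy. simpl. exists (RInt f x y). split.
      * apply (RInt_correct f), Hex; lra.
      * apply HP. change (Rabs (RInt f x y - l) < eps).
        assert (RInt f x y <= l) by (apply Hub; exists x, y; split; [lra | auto]).
        assert (RInt f a b <= RInt f x y) by (apply Hmono; lra).
        destruct eps as [eps He]; simpl in *. apply Rabs_def1; lra.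
Qed.

Lemma Rpower_le_succ (p s : R) : 0 < p < 1 -> 0 < s -> Rpower s p <= 1 + s.
Proof.
  intros Hp Hs. destruct (Rle_dec s 1) as [H|H].
  - replace (1 + s) with (1 + s * 1) by ring. apply Rle_trans with (Rpower 1 p).
    + apply Rle_Rpower_l; lra.
    + unfold Rpower. rewrite ln_1, Rmult_0_r, exp_0. lra.
  - apply Rle_trans with (Rpower s 1); [apply Rle_Rpower; lra | ]. rewrite Rpower_1; lra.
Qed.

(** The majorant (1 + s) exp(-s) has the primitive -(2 + s) exp(-s), and (2 + a) exp(-a) <= 2. *)
Lemma gamma_integral_bound (p : R) : 0 < p < 1 -> forall a b, 0 < a <= b ->
  RInt (fun s => Rpower s p * exp (- s)) a b <= 2.
Proof.
  intros Hp a b Hab.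
  assert (Hd : is_RInt (fun s => (1 + s) * exp (- s)) a b (- (2 + b) * exp (- b) - - (2 + a) * exp (- a))).
  { apply (is_RInt_derive (fun s => - (2 + s) * exp (- s))).
    - intros x _. auto_derive; auto; ring.
    - intros x _. apply (ex_derive_continuous (fun s => (1 + s) * exp (- s))). now auto_derive. }
  apply Rle_trans with (RInt (fun s => (1 + s) * exp (- s)) a b).
  - apply RInt_le; [lra | | eexists; exact Hd | ].
    + apply ex_RInt_pos_domain; try lra. intros; now apply continuous_gamma_kernel.
    + intros s Hs. apply Rmult_le_compat_r; [left; apply exp_pos | ]. apply Rpower_le_succ; lra.
  - rewrite (is_RInt_unique _ _ _ _ Hd).
    assert (0 <= (2 + b) * exp (- b)) by (apply Rmult_le_pos; [lra | left; apply exp_pos]).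
    assert ((2 + a) * exp (- a) <= 2); [ | lra].
    assert (H1 := exp_ineq1_le a).
    apply Rmult_le_reg_r with (exp a); [apply exp_pos | ].
    rewrite Rmult_assoc, <- exp_plus, Rplus_opp_l, exp_0. lra.
Qed.

(* Integration by parts: [s^p exp(-s)] vanishes at both ends. *)
Lemma Gamma_recurrence (p : R) : 0 < p < 1 ->
  0 < Gamma p /\ Gamma (p + 1) = p * Gamma p.
Proof.
  intros Hp.
  destruct (improper_integral_pos (fun s => Rpower s p * exp (- s)) 2) as [l [Hl HG]].
  { intros; now apply continuous_gamma_kernel. }
  { intros; apply Rmult_lt_0_compat; apply exp_pos. }
  { now apply gamma_integral_bound. }
  assert (H1 : Gamma (p + 1) = l).
  { unfold Gamma. replace (p + 1 - 1) with p by ring. now apply is_RInt_gen_unique. }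
  set (F := fun s => Rpower s p * exp (- s)).
  set (F' := fun s => p * (Rpower s (p - 1) * exp (- s)) - Rpower s p * exp (- s)).
  assert (HF : forall s, 0 < s -> is_derive F s (F' s)).
  { intros s Hs. unfold F, F'.
    replace (p * (Rpower s (p - 1) * exp (- s)) - Rpower s p * exp (- s))
      with (p * Rpower s (p - 1) * exp (- s) + Rpower s p * (- exp (- s))) by ring.
    apply (is_derive_mult (fun s => Rpower s p) (fun s => exp (- s))).
    - now apply is_derive_Rpower.
    - auto_derive; auto; ring.
    - exact Rmult_comm. }
  assert (HF' : is_RInt_gen F' (at_right 0) (Rbar_locally p_infty) (0 - 0)).
  { assert (HD : forall s, 0 < s -> Derive F s = F' s) by (intros; now apply is_derive_unique, HF).
    assert (Hdom : filter_prod (at_right 0) (Rbar_locally p_infty)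
        (fun ab : R * R => forall x, Rmin (fst ab) (snd ab) <= x <= Rmax (fst ab) (snd ab) -> 0 < x)).
    { apply Filter_prod with (fun x => 0 < x) (fun y => 0 < y).
      - exists (mkposreal 1 Rlt_0_1). now intros y _ Hy.
      - now exists 0.
      - intros x y Hx Hy z [Hz _]. simpl in Hz. apply Rlt_le_trans with (2 := Hz). now apply Rmin_glb_lt. }
    apply is_RInt_gen_ext with (Derive F).
    { apply filter_imp with (2 := Hdom). intros ab H x Hx. apply HD, H. lra. }
    apply is_RInt_gen_Derive; try apply _.
    - apply filter_imp with (2 := Hdom). intros ab H x Hx. exists (F' x). apply HF, H, Hx.
    - apply filter_imp with (2 := Hdom). intros ab H x Hx.
      assert (Hx0 := H x Hx).
      apply continuous_ext_loc with F'.
      + exists (mkposreal x Hx0). intros y Hy. symmetry; apply HD.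
        apply Rabs_def2 in Hy. unfold minus, plus, opp in Hy; simpl in Hy. lra.
      + apply (continuous_minus (fun s => p * (Rpower s (p - 1) * exp (- s))) (fun s => Rpower s p * exp (- s))).
        * apply (continuous_scal_r p (fun s => Rpower s (p - 1) * exp (- s))). now apply continuous_gamma_kernel.
        * now apply continuous_gamma_kernel.
    - intros P [eps HP].
      destruct (Rpower_small p eps) as [d [Hd Hsmall]]; [lra | apply cond_pos | ].
      exists (mkposreal d Hd). intros s Hs Hs0. apply HP.
      apply Rabs_def2 in Hs. unfold minus, plus, opp in Hs; simpl in Hs.
      change (Rabs (F s - 0) < eps). rewrite Rminus_0_r, Rabs_pos_eq.
      + apply Rle_lt_trans with (Rpower s p); [ | apply Hsmall; lra].
        unfold F. rewrite <- (Rmult_1_r (Rpower s p)) at 2.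
        apply Rmult_le_compat_l; [left; apply Rpower_pos | ].
        left. rewrite <- exp_0. apply exp_increasing. lra.
      + left; apply Rmult_lt_0_compat; apply exp_pos.
    (* From exp(s) >= (1 + s/2)^2 one gets (1 + s) exp(-s) <= 2 / (1 + s/2) < 4 / s, whence the
       threshold. *)
    - intros P [eps HP]. exists (4 / eps). intros s Hs. apply HP.
      assert (He := cond_pos eps). assert (H4 : 0 < 4 / eps) by (apply Rdiv_lt_0_compat; lra).
      change (Rabs (F s - 0) < eps). rewrite Rminus_0_r, Rabs_pos_eq.
      + apply Rle_lt_trans with ((1 + s) * exp (- s)).
        { apply Rmult_le_compat_r; [left; apply exp_pos | ]. apply Rpower_le_succ; lra. }
        assert (H5 := exp_ineq1_le (s / 2)).
        assert (H6 : exp s = exp (s / 2) * exp (s / 2)) by (rewrite <- exp_plus; f_equal; field).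
        assert (H7 : 4 < s * eps).
        { apply Rmult_lt_compat_r with (r := eps) in Hs; [ | lra].
          replace (4 / eps * eps) with 4 in Hs by (field; lra). lra. }
        apply Rmult_lt_reg_r with (exp s); [apply exp_pos | ].
        rewrite Rmult_assoc, <- exp_plus, Rplus_opp_l, exp_0, H6.
        assert (H8 : (1 + s / 2) * (1 + s / 2) <= exp (s / 2) * exp (s / 2)) by (apply Rmult_le_compat; lra).
        apply Rlt_le_trans with (eps * ((1 + s / 2) * (1 + s / 2))).
        * assert (2 * (1 + s / 2) < eps * (1 + s / 2) * (1 + s / 2)) by (apply Rmult_lt_compat_r; lra). lra.
        * apply Rmult_le_compat_l; lra.
      + left; apply Rmult_lt_0_compat; apply exp_pos. }
  (* Convergence of the integral for Gamma(p), singular at 0, is deduced here from that for Gamma(p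
     + 1): the integrand is (F' + s^p exp(-s)) / p. *)
  assert (H2 : is_RInt_gen (fun s => Rpower s (p - 1) * exp (- s)) (at_right 0) (Rbar_locally p_infty) (/ p * (0 - 0 + l))).
  { apply is_RInt_gen_ext with (fun s => scal (/ p) (plus (F' s) (Rpower s p * exp (- s)))).
    - apply filter_forall. intros ab x _. unfold F', scal, plus; simpl; unfold mult; simpl. field; lra.
    - apply (is_RInt_gen_scal (fun s => plus (F' s) (Rpower s p * exp (- s))) (/ p) (0 - 0 + l)).
      now apply (is_RInt_gen_plus F' (fun s => Rpower s p * exp (- s))). }
  assert (H3 : Gamma p = / p * (0 - 0 + l)) by now apply is_RInt_gen_unique.
  rewrite H1, H3. split; [ | field; lra].
  apply Rmult_lt_0_compat; [apply Rinv_0_lt_compat | ]; lra.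
Qed.

(** * Energy estimate for the spatial operator *)

Lemma sum_switch (f : nat -> nat -> R) (m n : nat) :
  sum_f_R0 (fun i => sum_f_R0 (f i) n) m = sum_f_R0 (fun j => sum_f_R0 (fun i => f i j) m) n.
Proof.
  induction m as [|m IH]; [reflexivity | ].
  rewrite tech5, IH, <- plus_sum. apply sum_eq; intros j _. now rewrite tech5.
Qed.

Lemma sum_scal_l (c : R) (f : nat -> R) (m : nat) :
  sum_f_R0 (fun i => c * f i) m = c * sum_f_R0 f m.
Proof. rewrite scal_sum. apply sum_eq; intros; ring. Qed.

Lemma sum_sqr_le (d : nat -> R) (m : nat) :
  sum_f_R0 d m ^ 2 <= INR (S m) * sum_f_R0 (fun i => d i ^ 2) m.
Proof.
  induction m as [|m IH]; [simpl; lra | ].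
  rewrite !tech5. set (S1 := sum_f_R0 d m) in *. set (S2 := sum_f_R0 (fun i => d i ^ 2) m) in *.
  rewrite (S_INR (S m)). set (k := INR (S m)) in *.
  assert (Hk : 0 < k) by (apply lt_0_INR; lia).
  assert (H : 0 <= (S1 - k * d (S m)) ^ 2 / k) by (apply Rdiv_le_0_compat; [apply pow2_ge_0 | lra]).
  replace ((S1 - k * d (S m)) ^ 2 / k) with (S1 ^ 2 / k - 2 * S1 * d (S m) + k * d (S m) ^ 2) in H
    by (field; lra).
  assert (S1 ^ 2 / k <= S2).
  { apply Rmult_le_reg_l with k; [lra | ]. replace (k * (S1 ^ 2 / k)) with (S1 ^ 2) by (field; lra). lra. }
  lra.
Qed.

(** Telescoping and Cauchy-Schwarz: the discrete form of bounding oscillation by the L2 norm of the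
    derivative. *)
Lemma oscillation_sqr (v : nat -> R) (m i : nat) :
  (i <= S m)%nat ->
  (v (S m) - v i) ^ 2 <= INR (S m) * sum_f_R0 (fun k => (v (S k) - v k) ^ 2) m.
Proof.
  intros Hi.
  assert (H : forall n, (i <= S n)%nat ->
     Rabs (v (S n) - v i) <= sum_f_R0 (fun k => Rabs (v (S k) - v k)) n).
  { induction n as [|n IH]; intros Hn.
    - destruct i as [|[|i]]; [simpl; lra | simpl | lia].
      rewrite Rminus_diag, Rabs_R0. apply Rabs_pos.
    - rewrite tech5. destruct (Nat.eq_dec i (S (S n))) as [->|Hne].
      + rewrite Rminus_diag, Rabs_R0. apply Rplus_le_le_0_compat; [ | apply Rabs_pos].
        apply cond_pos_sum; intros; apply Rabs_pos.
      + replace (v (S (S n)) - v i) with ((v (S n) - v i) + (v (S (S n)) - v (S n))) by ring.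
        apply Rle_trans with (1 := Rabs_triang _ _). apply Rplus_le_compat_r, IH; lia. }
  apply Rle_trans with (sum_f_R0 (fun k => Rabs (v (S k) - v k)) m ^ 2).
  - rewrite <- (pow2_abs (v (S m) - v i)). apply pow_incr. split; [apply Rabs_pos | now apply H].
  - apply Rle_trans with (1 := sum_sqr_le _ m). right; f_equal.
    apply sum_eq; intros. apply pow2_abs.
Qed.

Lemma summation_by_parts (P th : nat -> R) (m : nat) :
  sum_f_R0 (fun i => (P (S i) - P i) * th i) (S m)
  = P (S (S m)) * th (S m) - P 0%nat * th 0%nat
    - sum_f_R0 (fun i => P (S i) * (th (S i) - th i)) m.
Proof.
  induction m as [|m IH]; [simpl; ring | ].
  rewrite tech5, IH, (tech5 (fun i => P (S i) * (th (S i) - th i))). ring.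
Qed.

(** The boundary equation times h/2 is a balance over the two half cells at the ends, so the energy
    carries half weights there, although [norm0] has full ones. *)
Definition trapezoid_weight (N i : nat) : R :=
  if orb (Nat.eqb i 0) (Nat.eqb i N) then / 2 else 1.

Lemma trapezoid_weight_bounds N i : / 2 <= trapezoid_weight N i <= 1.
Proof. unfold trapezoid_weight; destruct orb; lra. Qed.

Lemma trapezoid_weight_reflect N i : (i <= N)%nat -> trapezoid_weight N (N - i) = trapezoid_weight N i.
Proof.
  intros H. unfold trapezoid_weight. f_equal.
  destruct (Nat.eqb_spec (N - i) 0), (Nat.eqb_spec (N - i) N), (Nat.eqb_spec i 0), (Nat.eqb_spec i N);
    simpl; congruence || lia.
Qed.

(** A single time step with N = m + 1: [Z] stands for the error at level n + sigma, [L] for its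
    discrete Caputo derivative, [psi] for the interior residual and [chi] for h/2 times the boundary
    residual. [Hcu] says that cu + cv and cu - cv, which are s A and s B, are both positive. *)
Section FluxEnergy.
Variables (alpha beta gamma s c1 h delta chi : R) (m : nat) (a Z L psi : nat -> R).
Let cu := s * (1 - alpha * beta).
Let cv := s * (beta - alpha).
Let K1 := / Rabs (1 - alpha) + 1.
Let th i := cu * Z i + cv * Z (S m - i)%nat.
Hypothesis Hcu : Rabs cv < cu.
Hypothesis Hgam : s * (1 - alpha ^ 2) * gamma <= 0.
Hypothesis Halpha : alpha <> 1.
Hypothesis Hc1 : 0 < c1.
Hypothesis Hh : 0 < h.
Hypothesis HhN : h * INR (S m) = 1.
Hypothesis Ha : forall i, (i <= m)%nat -> c1 <= a (S i).
Hypothesis Hasym : forall i, (i <= m)%nat -> a (S (m - i)) = a (S i).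
Hypothesis HZ : Z 0%nat = alpha * Z (S m).
Hypothesis Heq : forall i, (1 <= i <= m)%nat ->
  L i - (a (S i) * ((Z (S i) - Z i) / h) - a i * ((Z i - Z (i - 1)%nat) / h)) / h = psi i.
Hypothesis Hflux :
  beta * L 0%nat + L (S m)
  + 2 / h * (a (S m) * ((Z (S m) - Z m) / h) - beta * (a 1%nat * ((Z 1%nat - Z 0%nat) / h))
             - gamma * Z (S m)) = 2 / h * chi.
Hypothesis Hpsi : forall i, (1 <= i <= m)%nat -> Rabs (psi i) <= delta.
Hypothesis Hchi : Rabs chi <= delta.

(* Fluxes at the half points, completed at both ends so that
   [h w_i L_i = P_(i+1) - P_i + h psi_i] for every node i. *)
Let P i := match i with
  | O => a 1%nat * ((Z 1%nat - Z 0%nat) / h) - h / 2 * L 0%nat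
  | S j => if Nat.eqb j (S m) then a (S m) * ((Z (S m) - Z m) / h) + h / 2 * L (S m)
           else a (S j) * ((Z (S j) - Z j) / h)
  end.
Let psi0 i := if orb (Nat.eqb i 0) (Nat.eqb i (S m)) then 0 else psi i.

Lemma flux_node i : (i <= S m)%nat ->
  h * trapezoid_weight (S m) i * L i = P (S i) - P i + h * psi0 i.
Proof.
  intros Hi. unfold trapezoid_weight, psi0, P. destruct i as [|j]; [simpl; field; lra | ].
  rewrite (proj2 (Nat.eqb_neq j (S m)) ltac:(lia)).
  replace (Nat.eqb (S j) 0) with false by reflexivity. rewrite Bool.orb_false_l.
  destruct (Nat.eqb_spec (S j) (S m)) as [[= ->]|Hne]; [field; lra | ].
  rewrite <- (Heq (S j)) by lia. replace (S j - 1)%nat with j by lia. field; lra.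
Qed.

Lemma flux_boundary : P (S (S m)) * th (S m) - P 0%nat * th 0%nat
  = s * (1 - alpha ^ 2) * Z (S m) * (gamma * Z (S m) + chi).
Proof.
  unfold th. rewrite Nat.sub_diag, Nat.sub_0_r, HZ.
  assert (H : P (S (S m)) - beta * P 0%nat = gamma * Z (S m) + chi).
  { unfold P. rewrite Nat.eqb_refl.
    apply Rmult_eq_reg_l with (2 / h); [ | apply Rgt_not_eq, Rdiv_lt_0_compat; lra].
    rewrite Rmult_plus_distr_l, <- Hflux. field. lra. }
  replace (P (S (S m))) with (beta * P 0%nat + (gamma * Z (S m) + chi)) by lra.
  unfold cu, cv. ring.
Qed.

Let S2 := sum_f_R0 (fun i => (Z (S i) - Z i) ^ 2) m.
(** As h N = 1, this is the L2 norm of the difference quotient of [Z], written in the form in which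
    [oscillation_sqr] delivers it. *)
Let G := sqrt (INR (S m) * S2).

Lemma increments_sqr_nonneg : 0 <= S2.
Proof. apply cond_pos_sum; intros; apply pow2_ge_0. Qed.

Lemma gradient_sqr : G ^ 2 = S2 / h.
Proof.
  unfold G. rewrite <- Rsqr_pow2, Rsqr_sqrt.
  - replace (INR (S m)) with (/ h); [field; lra | ].
    apply Rmult_eq_reg_l with h; [ | lra]. rewrite HhN. field; lra.
  - apply Rmult_le_pos; [apply pos_INR | apply increments_sqr_nonneg].
Qed.

(** Reflection reverses increments, so [th] grows over a cell by cu d - cv d', with d' the increment
    of [Z] over the mirror cell. By |d d'| <= (d^2 + d'^2) / 2 the mixed term is charged half to
    each of the two cells; they share the coefficient [a], so the mirrored sum equals the original
    one. *)
Lemma flux_coercive :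
  c1 * (cu - Rabs cv) * G ^ 2 <= sum_f_R0 (fun i => P (S i) * (th (S i) - th i)) m.
Proof.
  set (X := fun i => a (S i) / h * (Z (S i) - Z i) ^ 2).
  assert (Hcv : 0 <= Rabs cv) by apply Rabs_pos.
  apply Rle_trans with ((cu - Rabs cv / 2) * sum_f_R0 X m - Rabs cv / 2 * sum_f_R0 (fun i => X (m - i)%nat) m).
  - rewrite sum_f_R0_skip.
    replace ((cu - Rabs cv / 2) * sum_f_R0 X m - Rabs cv / 2 * sum_f_R0 X m)
      with ((cu - Rabs cv) * sum_f_R0 X m) by field.
    replace (c1 * (cu - Rabs cv) * G ^ 2) with ((cu - Rabs cv) * (c1 * G ^ 2)) by ring.
    apply Rmult_le_compat_l; [lra | ].
    rewrite gradient_sqr. unfold S2. replace (c1 * (sum_f_R0 (fun i => (Z (S i) - Z i) ^ 2) m / h))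
      with (c1 / h * sum_f_R0 (fun i => (Z (S i) - Z i) ^ 2) m) by (field; lra).
    rewrite <- sum_scal_l. apply sum_Rle. intros i Hi. unfold X.
    apply Rmult_le_compat_r; [apply pow2_ge_0 | ].
    apply Rmult_le_compat_r; [ | now apply Ha]. left; now apply Rinv_0_lt_compat.
  - rewrite <- !sum_scal_l, <- minus_sum. apply sum_Rle. intros i Hi.
    unfold P. rewrite (proj2 (Nat.eqb_neq i (S m)) ltac:(lia)).
    unfold th, X. replace (S m - S i)%nat with (m - i)%nat by lia.
    replace (S m - i)%nat with (S (m - i)) by lia. rewrite Hasym by lia.
    set (d := Z (S i) - Z i). set (d' := Z (S (m - i)) - Z (m - i)%nat).
    replace (cu * Z (S i) + cv * Z (m - i)%nat - (cu * Z i + cv * Z (S (m - i))))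
      with (cu * d - cv * d') by (unfold d, d'; ring).
    assert (Hw : 0 < a (S i) / h).
    { apply Rdiv_lt_0_compat; [ | lra]. specialize (Ha i Hi); lra. }
    fold d. replace (a (S i) * (d / h) * (cu * d - cv * d'))
      with (a (S i) / h * (cu * d ^ 2 - cv * (d * d'))) by (field; lra).
    replace ((cu - Rabs cv / 2) * (a (S i) / h * d ^ 2) - Rabs cv / 2 * (a (S i) / h * d' ^ 2))
      with (a (S i) / h * (cu * d ^ 2 - Rabs cv * ((d ^ 2 + d' ^ 2) / 2))) by (field; lra).
    apply Rmult_le_compat_l; [lra | ].
    assert (cv * (d * d') <= Rabs cv * ((d ^ 2 + d' ^ 2) / 2)); [ | lra].
    apply Rle_trans with (1 := Rle_abs _). rewrite Rabs_mult.
    apply Rmult_le_compat_l; [lra | ].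
    apply Rabs_le. generalize (pow2_ge_0 (d + d')) (pow2_ge_0 (d - d')). lra.
Qed.

(** The nonlocal condition replaces a zero boundary value: (1 - alpha) Z_N = Z_N - Z_0 is an
    oscillation, which bounds Z_N and then every other value. *)
Lemma grid_sup_bound i : (i <= S m)%nat -> Rabs (Z i) <= K1 * G.
Proof.
  assert (HG : 0 <= G) by apply sqrt_pos.
  assert (Hosc : forall i, (i <= S m)%nat -> Rabs (Z (S m) - Z i) <= G).
  { intros j Hj. rewrite <- sqrt_Rsqr_abs. apply sqrt_le_1_alt. 
    rewrite Rsqr_pow2. now apply oscillation_sqr. }
  assert (Hal : 0 < Rabs (1 - alpha)) by (apply Rabs_pos_lt; lra).
  assert (HN : Rabs (Z (S m)) <= / Rabs (1 - alpha) * G).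
  { apply Rmult_le_reg_l with (Rabs (1 - alpha)); [lra | ].
    rewrite <- Rmult_assoc, Rinv_r, Rmult_1_l by lra. rewrite <- Rabs_mult.
    replace ((1 - alpha) * Z (S m)) with (Z (S m) - Z 0%nat) by (rewrite HZ; ring).
    apply Hosc; lia. }
  intros Hi. replace (Z i) with (Z (S m) + - (Z (S m) - Z i)) by ring.
  apply Rle_trans with (1 := Rabs_triang _ _). rewrite Rabs_Ropp.
  specialize (Hosc i Hi). unfold K1. lra.
Qed.

(** The first term comes from [chi] at the boundary, the second from the interior residual; its 2
    bounds h (N + 1). *)
Let K := Rabs (s * (1 - alpha ^ 2)) * K1 + 2 * (cu + Rabs cv) * K1.

Lemma flux_energy_bound :
  sum_f_R0 (fun i => h * trapezoid_weight (S m) i * L i * th i) (S m)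
  <= (K * delta) ^ 2 / (4 * (c1 * (cu - Rabs cv))).
Proof.
  assert (HG : 0 <= G) by apply sqrt_pos.
  assert (Hd : 0 <= delta) by (apply Rle_trans with (2 := Hchi); apply Rabs_pos).
  assert (Hcv : 0 <= Rabs cv) by apply Rabs_pos.
  assert (HK1 : 0 <= K1 * G) by (apply Rle_trans with (2 := grid_sup_bound 0 ltac:(lia)); apply Rabs_pos).
  replace (sum_f_R0 (fun i => h * trapezoid_weight (S m) i * L i * th i) (S m))
    with (sum_f_R0 (fun i => (P (S i) - P i) * th i) (S m) + sum_f_R0 (fun i => h * psi0 i * th i) (S m)).
  2: { rewrite <- plus_sum. apply sum_eq. intros i Hi. rewrite flux_node by auto. ring. }
  rewrite summation_by_parts, flux_boundary.
  assert (H1 := flux_coercive).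
  assert (H2 : s * (1 - alpha ^ 2) * Z (S m) * (gamma * Z (S m) + chi)
               <= Rabs (s * (1 - alpha ^ 2)) * K1 * G * delta).
  { replace (s * (1 - alpha ^ 2) * Z (S m) * (gamma * Z (S m) + chi)) with
      (s * (1 - alpha ^ 2) * gamma * Z (S m) ^ 2 + s * (1 - alpha ^ 2) * Z (S m) * chi) by ring.
    assert (s * (1 - alpha ^ 2) * gamma * Z (S m) ^ 2 <= 0).
    { generalize (pow2_ge_0 (Z (S m))). intros Hz.
      assert (0 <= - (s * (1 - alpha ^ 2) * gamma) * Z (S m) ^ 2) by (apply Rmult_le_pos; lra). lra. }
    assert (s * (1 - alpha ^ 2) * Z (S m) * chi <= Rabs (s * (1 - alpha ^ 2)) * K1 * G * delta); [ | lra].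
    apply Rle_trans with (1 := Rle_abs _). rewrite !(Rabs_mult _ chi), (Rabs_mult (s * (1 - alpha ^ 2))).
    apply Rmult_le_compat; auto; try apply Rmult_le_pos; try apply Rabs_pos.
    rewrite Rmult_assoc. apply Rmult_le_compat_l; [apply Rabs_pos | ]. now apply grid_sup_bound. }
  assert (H3 : sum_f_R0 (fun i => h * psi0 i * th i) (S m) <= 2 * (cu + Rabs cv) * K1 * G * delta).
  { apply Rle_trans with (sum_f_R0 (fun _ => h * (delta * ((cu + Rabs cv) * (K1 * G)))) (S m)).
    - apply sum_Rle. intros i Hi. rewrite Rmult_assoc. apply Rmult_le_compat_l; [lra | ].
      apply Rle_trans with (1 := Rle_abs _). rewrite Rabs_mult.
      apply Rmult_le_compat; try apply Rabs_pos.
      + unfold psi0. destruct (Nat.eqb_spec i 0); simpl; [rewrite Rabs_R0; lra | ].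
        destruct (Nat.eqb_spec i (S m)); [rewrite Rabs_R0; lra | ]. apply Hpsi; lia.
      + unfold th. apply Rle_trans with (1 := Rabs_triang _ _). rewrite !Rabs_mult, (Rabs_pos_eq cu) by lra.
        rewrite Rmult_plus_distr_r.
        apply Rplus_le_compat; apply Rmult_le_compat_l; try lra; apply grid_sup_bound; lia.
    - rewrite sum_cte, (S_INR (S m)).
      replace (h * (delta * ((cu + Rabs cv) * (K1 * G))) * (INR (S m) + 1))
        with ((h * INR (S m) + h) * (delta * ((cu + Rabs cv) * (K1 * G)))) by ring.
      rewrite HhN.
      assert (h <= 1).
      { rewrite <- HhN. rewrite <- (Rmult_1_r h) at 1. apply Rmult_le_compat_l; [lra | ].
        change 1 with (INR 1). apply le_INR; lia. }
      replace (2 * (cu + Rabs cv) * K1 * G * delta) with (2 * (delta * ((cu + Rabs cv) * (K1 * G)))) by ring.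
      apply Rmult_le_compat_r; [ | lra].
      apply Rmult_le_pos; [lra | ]. apply Rmult_le_pos; lra. }
  set (e := c1 * (cu - Rabs cv)) in *.
  assert (He : 0 < e) by (apply Rmult_lt_0_compat; lra).
  (* Everything is now linear in [G] except the coercive term; the claimed bound is the maximum over
     [G]. *)
  apply Rle_trans with (K * delta * G - e * G ^ 2).
  { unfold K. lra. }
  apply Rmult_le_reg_r with (4 * e); [lra | ].
  replace ((K * delta) ^ 2 / (4 * e) * (4 * e)) with ((K * delta) ^ 2) by (field; lra).
  generalize (pow2_ge_0 (K * delta - 2 * e * G)). lra.
Qed.
End FluxEnergy.

(** * Stability of the scheme *)

(** The mean of [U theta] over a node with value [x] and its mirror node with value [y],
    diagonalised by even and odd parts. *)
Definition mirror_form (A B x y : R) : R := (A * (x + y) ^ 2 + B * (x - y) ^ 2) / 4.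

Lemma mirror_form_lower (A B mu x y : R) :
  mu <= A -> mu <= B -> mu / 2 * (x ^ 2 + y ^ 2) <= mirror_form A B x y.
Proof.
  intros HA HB. unfold mirror_form.
  assert (0 <= (A - mu) * (x + y) ^ 2) by (apply Rmult_le_pos; [lra | apply pow2_ge_0]).
  assert (0 <= (B - mu) * (x - y) ^ 2) by (apply Rmult_le_pos; [lra | apply pow2_ge_0]).
  lra.
Qed.

Lemma sum_weight_reflect (N : nat) (h : R) (F : nat -> R) :
  sum_f_R0 (fun i => h * trapezoid_weight N i * ((F i + F (N - i)%nat) / 2)) N
  = sum_f_R0 (fun i => h * trapezoid_weight N i * F i) N.
Proof.
  set (X := fun i => h * trapezoid_weight N i * F i).
  rewrite (sum_eq _ (fun i => / 2 * X i + / 2 * X (N - i)%nat)).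
  - rewrite plus_sum, !sum_scal_l, sum_f_R0_skip. field.
  - intros i Hi. unfold X. rewrite trapezoid_weight_reflect by auto. field.
Qed.

Section TimeEnergy.
Variables (A B sg kt h : R) (N n : nat) (g : nat -> R) (z : nat -> nat -> R).
Hypotheses (HA : 0 <= A) (HB : 0 <= B) (Hsg : / 2 <= sg <= 1) (Hh : 0 <= h) (Hkt : 0 <= kt).
Hypothesis Hg0 : forall s, (s <= n)%nat -> 0 <= g s.
Hypothesis Hg : forall s, (s < n)%nat -> g s <= g (S s).
Hypothesis Hlast : forall m, n = S m -> sg * g m <= (2 * sg - 1) * g n.

Let S1 (w : nat -> R) : R := sum_f_R0 (fun s => g s * (w (S s) - w s)) n.
Let E (s : nat) : R :=
  sum_f_R0 (fun i => h * trapezoid_weight N i * mirror_form A B (z s i) (z s (N - i)%nat)) N.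

Lemma memory_sum_linear (c d : R) (v w : nat -> R) : S1 (fun s => c * v s + d * w s) = c * S1 v + d * S1 w.
Proof.
  unfold S1. rewrite <- !sum_scal_l, <- plus_sum. apply sum_eq; intros; ring.
Qed.

(* The even and odd parts of [z] under [i -> N - i] are treated separately. *)
Lemma time_energy_inequality :
  / 2 * (kt * S1 E) <=
  sum_f_R0 (fun i => h * trapezoid_weight N i * (kt * S1 (fun s => z s i)) *
     ((A + B) / 2 * level sg z n i + (A - B) / 2 * level sg z n (N - i)%nat)) N.
Proof.
  set (F := fun i => kt * S1 (fun s => z s i) *
     ((A + B) / 2 * level sg z n i + (A - B) / 2 * level sg z n (N - i)%nat)).
  rewrite (sum_eq _ (fun i => h * trapezoid_weight N i * F i)) by (intros; unfold F; ring).
  rewrite <- sum_weight_reflect.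
  assert (HE : S1 E = sum_f_R0 (fun i => h * trapezoid_weight N i *
      S1 (fun s => mirror_form A B (z s i) (z s (N - i)%nat))) N).
  { unfold S1, E. rewrite (sum_eq _ (fun s => sum_f_R0 (fun i => h * trapezoid_weight N i *
      (g s * (mirror_form A B (z (S s) i) (z (S s) (N - i)%nat) - mirror_form A B (z s i) (z s (N - i)%nat)))) N)).
    - rewrite sum_switch. apply sum_eq; intros i _. apply sum_scal_l.
    - intros s _. rewrite <- minus_sum, <- sum_scal_l. apply sum_eq; intros; ring. }
  rewrite HE, <- !sum_scal_l. apply sum_Rle. intros i Hi.
  replace (/ 2 * (kt * (h * trapezoid_weight N i * S1 (fun s => mirror_form A B (z s i) (z s (N - i)%nat)))))
    with (h * trapezoid_weight N i * (kt * (/ 2 * S1 (fun s => mirror_form A B (z s i) (z s (N - i)%nat)))))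
    by ring.
  apply Rmult_le_compat_l.
  { apply Rmult_le_pos; [auto | ]. generalize (trapezoid_weight_bounds N i); lra. }
  unfold F. replace (N - (N - i))%nat with i by lia.
  set (e := fun s => z s i + z s (N - i)%nat). set (o := fun s => z s i - z s (N - i)%nat).
  assert (H1 := caputo_energy_inequality sg g e n Hsg Hg0 Hg Hlast).
  assert (H2 := caputo_energy_inequality sg g o n Hsg Hg0 Hg Hlast).
  fold (S1 e) in H1. fold (S1 o) in H2.
  assert (He : S1 e = S1 (fun s => z s i) + S1 (fun s => z s (N - i)%nat)).
  { rewrite <- (Rmult_1_l (S1 (fun s => z s i))), <- (Rmult_1_l (S1 (fun s => z s (N - i)%nat))).
    rewrite <- memory_sum_linear. apply sum_eq; intros; unfold e; ring. }
  assert (Ho : S1 o = S1 (fun s => z s i) - S1 (fun s => z s (N - i)%nat)).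
  { replace (S1 (fun s => z s i) - S1 (fun s => z s (N - i)%nat))
      with (1 * S1 (fun s => z s i) + -1 * S1 (fun s => z s (N - i)%nat)) by ring.
    rewrite <- memory_sum_linear. apply sum_eq; intros; unfold o; ring. }
  assert (Hm : S1 (fun s => mirror_form A B (z s i) (z s (N - i)%nat))
     = A / 4 * S1 (fun s => e s ^ 2) + B / 4 * S1 (fun s => o s ^ 2)).
  { rewrite <- memory_sum_linear. apply sum_eq; intros; unfold mirror_form, e, o; field. }
  rewrite Hm.
  fold (S1 (fun s => e s ^ 2)) in H1. fold (S1 (fun s => o s ^ 2)) in H2.
  rewrite He in H1. rewrite Ho in H2. unfold level.
  set (L := S1 (fun s => z s i)) in *. set (L' := S1 (fun s => z s (N - i)%nat)) in *.
  assert (H3 := Rmult_le_compat_l (A / 4) _ _ ltac:(lra) H1).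
  assert (H4 := Rmult_le_compat_l (B / 4) _ _ ltac:(lra) H2).
  (* Averaged over a node and its mirror, the product with the test function splits into an even and
     an odd product without cross terms. *)
  replace ((kt * L * ((A + B) / 2 * (sg * z (S n) i + (1 - sg) * z n i)
      + (A - B) / 2 * (sg * z (S n) (N - i)%nat + (1 - sg) * z n (N - i)%nat))
    + kt * L' * ((A + B) / 2 * (sg * z (S n) (N - i)%nat + (1 - sg) * z n (N - i)%nat)
      + (A - B) / 2 * (sg * z (S n) i + (1 - sg) * z n i))) / 2)
   with (kt * (A / 4 * ((sg * e (S n) + (1 - sg) * e n) * (L + L'))
      + B / 4 * ((sg * o (S n) + (1 - sg) * o n) * (L - L')))) by (unfold e, o; field).
  apply Rmult_le_compat_l; [auto | ]. lra.
Qed.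
End TimeEnergy.

(** In the second case s is opposite to the sign of alpha beta, since the sum of the two products is
    2 (1 - alpha beta) and |alpha beta| > 1. As 1 - alpha^2 < 0 there, the sign condition on alpha
    beta gamma is what makes the gamma term dissipative. *)
Lemma boundary_case_sign (alpha beta gamma : R) :
  (Rabs alpha < 1 /\ Rabs beta < 1 /\ gamma <= 0) \/
  (Rabs alpha > 1 /\ Rabs beta > 1 /\ alpha * beta * gamma <= 0) ->
  exists s, s * (1 - alpha ^ 2) * gamma <= 0 /\
    0 < s * ((1 - alpha) * (1 + beta)) /\ 0 < s * ((1 + alpha) * (1 - beta)) /\ alpha <> 1.
Proof.
  assert (Habs : forall x, 1 < Rabs x -> 1 < x \/ x < -1).
  { intros x. unfold Rabs; destruct Rcase_abs; lra. }
  intros [[Ha [Hb Hg]] | [Ha [Hb Hg]]].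
  - apply Rabs_def2 in Ha. apply Rabs_def2 in Hb. exists 1. rewrite !Rmult_1_l.
    repeat split; try (apply Rmult_lt_0_compat; lra); try lra.
    replace (1 - alpha ^ 2) with ((1 - alpha) * (1 + alpha)) by ring.
    assert (0 <= (1 - alpha) * (1 + alpha) * - gamma); [ | lra].
    apply Rmult_le_pos; [apply Rmult_le_pos | ]; lra.
  - apply Habs in Ha. apply Habs in Hb.
    assert (Hal : 0 < alpha ^ 2 - 1).
    { replace (alpha ^ 2 - 1) with ((alpha - 1) * (alpha + 1)) by ring. destruct Ha; nra. }
    assert (Hpos : 0 < alpha * beta -> gamma <= 0).
    { intros H. apply Rnot_lt_le; intros Hc.
      assert (0 < alpha * beta * gamma) by now apply Rmult_lt_0_compat. lra. }
    assert (Hneg : alpha * beta < 0 -> 0 <= gamma).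
    { intros H. apply Rnot_lt_le; intros Hc.
      assert (0 < - (alpha * beta) * - gamma) by (apply Rmult_lt_0_compat; lra). lra. }
    destruct Ha as [Ha|Ha], Hb as [Hb|Hb].
    + exists (-1). assert (gamma <= 0) by (apply Hpos; nra). repeat split; nra.
    + exists 1. assert (0 <= gamma) by (apply Hneg; nra). repeat split; nra.
    + exists 1. assert (0 <= gamma) by (apply Hneg; nra). repeat split; nra.
    + exists (-1). assert (gamma <= 0) by (apply Hpos; nra). repeat split; nra.
Qed.

Lemma caputo_h_increments (nu sg tau : R) (w : nat -> R) (n : nat) :
  0 < tau ->
  caputo_h nu sg tau w n = Rpower tau (- nu) / Gamma (2 - nu) *
    sum_f_R0 (fun s => ccoef nu sg n (n - s) * (w (S s) - w s)) n.
Proof.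
  intros Ht. unfold caputo_h.
  replace (1 - nu) with (- nu + 1) by ring. rewrite Rpower_succ by auto.
  rewrite (sum_eq _ (fun s => / tau * (ccoef nu sg n (n - s) * (w (S s) - w s))))
    by (intros; field; lra).
  rewrite sum_scal_l. unfold Rdiv. set (gi := / Gamma (2 - nu)). field. lra.
Qed.

(** The energy controls mu times the trapezoidal norm squared; the half weights at the ends cost the
    remaining factor 1/2 against [norm0]. *)
Lemma norm0_mirror (N : nat) (A B mu D : R) (v : nat -> R) :
  (1 <= N)%nat -> 0 < mu -> mu <= A -> mu <= B -> 0 <= D ->
  sum_f_R0 (fun i => 1 / INR N * trapezoid_weight N i * mirror_form A B (v i) (v (N - i)%nat)) N
    <= mu / 2 * D ^ 2 ->
  norm0 N v <= D.
Proof.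
  intros HN Hmu HA HB HD HE.
  assert (Hh : 0 < 1 / INR N) by (apply Rdiv_lt_0_compat; [lra | apply lt_0_INR; lia]).
  unfold norm0. rewrite <- (sqrt_pow2 D HD). apply sqrt_le_1_alt.
  apply Rmult_le_reg_l with (mu / 2); [lra | ]. apply Rle_trans with (2 := HE).
  rewrite <- sum_scal_l.
  apply Rle_trans with (sum_f_R0 (fun i => 1 / INR N * trapezoid_weight N i *
     ((mu * v i ^ 2 + mu * v (N - i)%nat ^ 2) / 2)) N).
  - rewrite (sum_weight_reflect N (1 / INR N) (fun i => mu * v i ^ 2)).
    apply sum_Rle; intros i _.
    replace (mu / 2 * (v i ^ 2 * (1 / INR N))) with (1 / INR N * / 2 * (mu * v i ^ 2))
      by (field; apply not_0_INR; lia).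
    apply Rmult_le_compat_r; [apply Rmult_le_pos; [lra | apply pow2_ge_0] | ].
    apply Rmult_le_compat_l; [lra | ]. apply trapezoid_weight_bounds.
  - apply sum_Rle; intros i _. apply Rmult_le_compat_l.
    + apply Rmult_le_pos; [lra | ]. generalize (trapezoid_weight_bounds N i); lra.
    + generalize (mirror_form_lower A B mu (v i) (v (N - i)%nat) HA HB). lra.
Qed.

(** The constant is fixed before the grid. The boundary residual enters multiplied by h/2, the
    scaling in which it is of second order. *)
Lemma scheme_stability (nu T alpha beta gamma c1 : R) :
  0 < nu < 1 -> 0 < T -> 0 < c1 ->
  (Rabs alpha < 1 /\ Rabs beta < 1 /\ gamma <= 0) \/
  (Rabs alpha > 1 /\ Rabs beta > 1 /\ alpha * beta * gamma <= 0) ->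
  exists C, 0 <= C /\ forall (N NT : nat) (z a : nat -> nat -> R) (delta : R),
    let sigma := 1 - nu / 2 in
    let h := 1 / INR N in
    let tau := T / INR NT in
    (2 <= N)%nat -> (1 <= NT)%nat ->
    (forall n i, (n < NT)%nat -> (1 <= i <= N)%nat -> c1 <= a n i) ->
    (forall n i, (n < NT)%nat -> (1 <= i <= N)%nat -> a n (S N - i)%nat = a n i) ->
    (forall i, (i <= N)%nat -> z 0%nat i = 0) ->
    (forall n, (n < NT)%nat -> z (S n) 0%nat = alpha * z (S n) N) ->
    (forall n i, (n < NT)%nat -> (1 <= i <= N - 1)%nat ->
      Rabs (caputo_h nu sigma tau (fun s => z s i) n
        - diff_fwd h (fun j => a n j * diff_back h (level sigma z n) j) i) <= delta) ->
    (forall n, (n < NT)%nat ->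
      Rabs (h / 2 * (beta * caputo_h nu sigma tau (fun s => z s 0%nat) n
            + caputo_h nu sigma tau (fun s => z s N) n)
        + (a n N * diff_back h (level sigma z n) N
           - beta * (a n 1%nat * diff_fwd h (level sigma z n) 0)
           - gamma * level sigma z n N)) <= delta) ->
    forall n, (n <= NT)%nat -> norm0 N (z n) <= C * delta.
Proof.
  intros Hnu HT Hc1 Hcase.
  destruct (boundary_case_sign _ _ _ Hcase) as [s [Hgam [HA [HB Hal]]]].
  set (A := s * ((1 - alpha) * (1 + beta))) in *.
  set (B := s * ((1 + alpha) * (1 - beta))) in *.
  set (cu := s * (1 - alpha * beta)). set (cv := s * (beta - alpha)).
  assert (Ecu : cu = (A + B) / 2) by (unfold cu, A, B; field).
  assert (Ecv : cv = (A - B) / 2) by (unfold cv, A, B; field).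
  assert (Hcu : Rabs cv < cu) by (rewrite Ecu, Ecv; apply Rabs_def1; lra).
  set (K := Rabs (s * (1 - alpha ^ 2)) * (/ Rabs (1 - alpha) + 1) +
     2 * (cu + Rabs cv) * (/ Rabs (1 - alpha) + 1)).
  set (K3 := K ^ 2 / (4 * (c1 * (cu - Rabs cv)))).
  assert (HK3 : 0 <= K3).
  { apply Rdiv_le_0_compat; [apply pow2_ge_0 | ].
    apply Rmult_lt_0_compat; [lra | apply Rmult_lt_0_compat; lra]. }
  assert (HG : 0 < Gamma (2 - nu)).
  { destruct (Gamma_recurrence (1 - nu)) as [H1 H2]; [lra | ].
    replace (2 - nu) with (1 - nu + 1) by ring. rewrite H2. apply Rmult_lt_0_compat; lra. }
  set (mu := Rmin A B). assert (Hmu : 0 < mu) by now apply Rmin_pos.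
  (* This is 2 K3 / (kt kap) with [kt] and [kap] as below, where the powers of tau and NT combine to
     T^(-nu). *)
  set (K4 := 4 * K3 * Gamma (2 - nu) * Rpower T nu / (1 - nu)).
  assert (HK4 : 0 <= K4).
  { apply Rdiv_le_0_compat; [ | lra].
    apply Rmult_le_pos; [apply Rmult_le_pos; lra | left; apply Rpower_pos]. }
  exists (sqrt (2 * K4 / mu)). split; [apply sqrt_pos | ].
  intros N NT z a delta sigma h tau HN HNT Ha Hasym Hz0 Hzb Hint Hbd n Hn.
  destruct N as [|m]; [lia | ].
  assert (Htau : 0 < tau) by (apply Rdiv_lt_0_compat; [lra | apply lt_0_INR; lia]).
  assert (Hh : 0 < h) by (apply Rdiv_lt_0_compat; [lra | apply lt_0_INR; lia]).
  assert (HhN : h * INR (S m) = 1) by (unfold h; field; apply not_0_INR; lia).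
  assert (Hd : 0 <= delta).
  { apply Rle_trans with (2 := Hbd 0%nat ltac:(lia)). apply Rabs_pos. }
  assert (Hsg : / 2 <= sigma <= 1) by (unfold sigma; lra).
  set (kt := Rpower tau (- nu) / Gamma (2 - nu)).
  assert (Hkt : 0 < kt) by (apply Rdiv_lt_0_compat; [apply Rpower_pos | auto]).
  set (E := fun j => sum_f_R0 (fun i => h * trapezoid_weight (S m) i *
              mirror_form A B (z j i) (z j (S m - i)%nat)) (S m)).
  assert (Hstep : forall j, (j < NT)%nat ->
     sum_f_R0 (fun r => ccoef nu sigma j (j - r)%nat * (E (S r) - E r)) j <= 2 * K3 * delta ^ 2 / kt).
  { intros j Hj.
    (* The weights are indexed by time rather than by lag, so the decreasing c becomes the
       increasing [g] of the energy inequality. *)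
    assert (Hen := time_energy_inequality A B sigma kt h (S m) j (fun r => ccoef nu sigma j (j - r)) z
      ltac:(lra) ltac:(lra) Hsg ltac:(lra) ltac:(lra)
      (fun r Hr => ccoef_nonneg nu Hnu j (j - r) ltac:(lia))).
    assert (H1 : forall r, (r < j)%nat -> ccoef nu sigma j (j - r) <= ccoef nu sigma j (j - S r)).
    { intros r Hr. replace (j - r)%nat with (S (j - S r)) by lia. apply ccoef_decr; [auto | lia]. }
    assert (H2 : forall q, j = S q -> sigma * ccoef nu sigma j (j - q) <= (2 * sigma - 1) * ccoef nu sigma j (j - j)).
    { intros q ->. replace (S q - q)%nat with 1%nat by lia. rewrite Nat.sub_diag. now apply ccoef_first_pair. }
    specialize (Hen H1 H2). cbv beta in Hen. fold E in Hen.
    assert (Hfl : sum_f_R0 (fun i => h * trapezoid_weight (S m) i *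
        (kt * sum_f_R0 (fun r => ccoef nu sigma j (j - r) * (z (S r) i - z r i)) j) *
        ((A + B) / 2 * level sigma z j i + (A - B) / 2 * level sigma z j (S m - i)%nat)) (S m)
        <= K3 * delta ^ 2).
    { rewrite <- Ecu, <- Ecv.
      replace (K3 * delta ^ 2) with ((K * delta) ^ 2 / (4 * (c1 * (cu - Rabs cv)))).
      2: { unfold K3. field. lra. }
      set (L := fun i => caputo_h nu sigma tau (fun s => z s i) j).
      rewrite (sum_eq _ (fun i => h * trapezoid_weight (S m) i * L i *
         (s * (1 - alpha * beta) * level sigma z j i + s * (beta - alpha) * level sigma z j (S m - i)%nat))).
      2: { intros i _. unfold L. now rewrite caputo_h_increments. }
      apply (flux_energy_bound alpha beta gamma s c1 h delta
        (h / 2 * (beta * L 0%nat + L (S m)) + (a j (S m) * diff_back h (level sigma z j) (S m)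
           - beta * (a j 1%nat * diff_fwd h (level sigma z j) 0)
           - gamma * level sigma z j (S m))) m (a j) (level sigma z j) L
        (fun i => L i - diff_fwd h (fun q => a j q * diff_back h (level sigma z j) q) i)); auto.
      - intros i Hi. apply Ha; lia.
      - intros i Hi. replace (S (m - i)) with (S (S m) - (S i))%nat by lia. apply Hasym; lia.
      (* The nonlocal condition is imposed from level 1 on; at level 0 it holds because the error
         vanishes there. *)
      - unfold level. rewrite Hzb by auto. destruct j as [|j].
        + rewrite !Hz0 by lia. ring.
        + rewrite Hzb by lia. ring.
      - intros i Hi. unfold diff_fwd, diff_back. now replace (S i - 1)%nat with i by lia.
      - unfold diff_fwd, diff_back. replace (S m - 1)%nat with m by lia. field. lra.
      - intros i Hi. apply Hint; [auto | lia].
      - now apply Hbd. }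
    apply Rmult_le_reg_l with (/ 2 * kt); [apply Rmult_lt_0_compat; lra | ].
    replace (/ 2 * kt * (2 * K3 * delta ^ 2 / kt)) with (K3 * delta ^ 2) by (field; lra).
    apply Rle_trans with (2 := Hfl). rewrite Rmult_assoc. exact Hen. }
  (* A lower bound for c_j valid on all levels j < NT at once, by j + sigma <= NT. *)
  set (kap := (1 - nu) / 2 * Rpower (INR NT) (- nu)).
  assert (Hkap : 0 < kap) by (apply Rmult_lt_0_compat; [lra | apply Rpower_pos]).
  assert (HEn : E n <= 2 * K3 * delta ^ 2 / kt / kap).
  { apply (memory_comparison (ccoef nu sigma) E NT); auto.
    - apply Rdiv_le_0_compat; [ | auto]. apply Rmult_le_pos; [lra | apply pow2_ge_0].
    - unfold E. rewrite (sum_eq _ (fun _ => 0)); [rewrite sum_cte; ring | ].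
      intros i Hi. rewrite !Hz0 by lia. unfold mirror_form. field.
    - intros j Hj. apply Rle_trans with (2 := ccoef_last_lower nu Hnu j). unfold kap.
      apply Rmult_le_compat_l; [lra | ]. replace (1 - nu - 1) with (- nu) by ring.
      apply Rpower_decr; [lra | ]. split; [apply INR_plus_sigma_pos; auto | ].
      apply Rle_trans with (INR j + 1); [fold sigma; lra | ]. rewrite <- S_INR. apply le_INR; lia.
    - intros j r Hj Hr. apply ccoef_decr; auto. }
  replace (2 * K3 * delta ^ 2 / kt / kap) with (K4 * delta ^ 2) in HEn.
  2: { assert (HT' : Rpower T nu * Rpower tau (- nu) * Rpower (INR NT) (- nu) = 1).
       { rewrite Rmult_assoc, Rpower_mult_distr by (auto; apply lt_0_INR; lia).
         replace (tau * INR NT) with T by (unfold tau; field; apply not_0_INR; lia).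
         rewrite <- Rpower_plus, Rplus_opp_r. now apply Rpower_O. }
       unfold K4, kt, kap.
       set (x := Rpower T nu) in *. set (y := Rpower tau (- nu)) in *. set (w := Rpower (INR NT) (- nu)) in *.
       assert (0 < y) by apply Rpower_pos. assert (0 < w) by apply Rpower_pos.
       replace x with (/ (y * w)); [field; repeat split; lra | ].
       apply Rmult_eq_reg_r with (y * w); [ | apply Rgt_not_eq; now apply Rmult_lt_0_compat].
       rewrite Rinv_l by (apply Rgt_not_eq; now apply Rmult_lt_0_compat). lra. }
  apply (norm0_mirror (S m) A B mu); auto.
  - lia.
  - apply Rmin_l.
  - apply Rmin_r.
  - apply Rmult_le_pos; [apply sqrt_pos | auto].
  - rewrite Rpow_mult_distr, pow2_sqrt.
    + apply Rle_trans with (1 := HEn). right. field. lra.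
    + apply Rdiv_le_0_compat; lra.
Qed.

(** * Truncation error of the discrete Caputo derivative *)

Section DifferenceQuotients.
Variables (T tau M : R) (w0 w1 w2 w3 : R -> R).
Hypotheses (D0 : deriv_inside 0 T w0 w1) (D1 : deriv_inside 0 T w1 w2) (D2 : deriv_inside 0 T w2 w3).
Hypothesis HM : forall z, seg 0 T z -> Rabs (w3 z) <= M.
Hypothesis Htau : 0 < tau.

Lemma taylor3_near (x y r : R) : seg 0 T x -> seg 0 T y -> Rabs (y - x) <= r ->
  Rabs (w0 y - w0 x - w1 x * (y - x) - w2 x * (y - x) ^ 2 / 2) <= M * r ^ 3.
Proof.
  intros Hx Hy Hr. apply Rle_trans with (1 := taylor3 0 T M w0 w1 w2 w3 D0 D1 D2 HM x y Hx Hy).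
  apply Rmult_le_compat_l; [now apply (sup_bound_nonneg 0 T M x w3) | ].
  apply pow_incr. split; [apply Rabs_pos | auto].
Qed.

(** The subtracted affine function is the derivative of the quadratic interpolant at t, t + tau, t +
    2 tau. It is exact for quadratics, so after expanding at [x] only the remainders survive: at
    most 2 M tau^2 from the quotient and 11/2 M tau^2 from the second difference. *)
Lemma quadratic_interpolation_derivative (t x : R) :
  0 <= t -> t + 2 * tau <= T -> t <= x <= t + tau ->
  Rabs (w1 x - ((w0 (t + tau) - w0 t) / tau
     + (w0 (t + 2 * tau) - 2 * w0 (t + tau) + w0 t) / tau ^ 2 * (x - (t + tau / 2)))) <= 8 * M * tau ^ 2.
Proof.
  intros Ht HT Hx.
  assert (Sx : seg 0 T x) by (unfold seg; lra).
  assert (HM0 := sup_bound_nonneg 0 T M x w3 Sx HM).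
  assert (H0 := taylor3_near x t tau Sx ltac:(unfold seg; lra) ltac:(apply Rabs_le; lra)).
  assert (H1 := taylor3_near x (t + tau) tau Sx ltac:(unfold seg; lra) ltac:(apply Rabs_le; lra)).
  assert (H2 := taylor3_near x (t + 2 * tau) (2 * tau) Sx ltac:(unfold seg; lra) ltac:(apply Rabs_le; lra)).
  set (R0 := w0 t - w0 x - w1 x * (t - x) - w2 x * (t - x) ^ 2 / 2) in *.
  set (R1 := w0 (t + tau) - w0 x - w1 x * (t + tau - x) - w2 x * (t + tau - x) ^ 2 / 2) in *.
  set (R2 := w0 (t + 2 * tau) - w0 x - w1 x * (t + 2 * tau - x) - w2 x * (t + 2 * tau - x) ^ 2 / 2) in *.
  replace (w1 x - ((w0 (t + tau) - w0 t) / tau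
     + (w0 (t + 2 * tau) - 2 * w0 (t + tau) + w0 t) / tau ^ 2 * (x - (t + tau / 2))))
    with ((R0 - R1) / tau + (- (R2 - 2 * R1 + R0) / tau ^ 2) * (x - (t + tau / 2)))
    by (unfold R0, R1, R2; field; lra).
  replace ((2 * tau) ^ 3) with (8 * tau ^ 3) in H2 by ring.
  apply Rabs_le_between in H0, H1, H2.
  apply Rle_trans with (1 := Rabs_triang _ _).
  assert (H3 : Rabs ((R0 - R1) / tau) <= 2 * M * tau ^ 2).
  { unfold Rdiv. rewrite Rabs_mult, (Rabs_pos_eq (/ tau)) by (left; now apply Rinv_0_lt_compat).
    apply Rmult_le_reg_r with tau; [lra | ]. rewrite Rmult_assoc, Rinv_l, Rmult_1_r by lra.
    apply Rabs_le. lra. }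
  assert (H4 : Rabs (- (R2 - 2 * R1 + R0) / tau ^ 2) <= 11 * M * tau).
  { assert (0 < tau ^ 2) by (apply pow_lt; lra).
    unfold Rdiv. rewrite Rabs_mult, (Rabs_pos_eq (/ tau ^ 2)) by (left; now apply Rinv_0_lt_compat).
    apply Rmult_le_reg_r with (tau ^ 2); [lra | ]. rewrite Rmult_assoc, Rinv_l, Rmult_1_r by lra.
    apply Rabs_le. lra. }
  assert (H5 : Rabs (- (R2 - 2 * R1 + R0) / tau ^ 2 * (x - (t + tau / 2))) <= 11 * M * tau * (tau / 2)).
  { rewrite Rabs_mult. apply Rmult_le_compat; auto; try apply Rabs_pos. apply Rabs_le; lra. }
  assert (0 <= M * tau ^ 2) by (apply Rmult_le_pos; [auto | apply pow2_ge_0]). lra.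
Qed.

(** On the last cell the formula uses the plain difference quotient. The linear term with [w2] is
    only of first order in tau, so it is kept explicitly until its moment against the kernel is seen
    to vanish. *)
Lemma central_quotient_derivative (t x : R) :
  0 <= t -> t + tau <= T -> t <= x <= t + tau ->
  Rabs (w1 x - ((w0 (t + tau) - w0 t) / tau + w2 (t + tau / 2) * (x - (t + tau / 2)))) <= 8 * M * tau ^ 2.
Proof.
  intros Ht HT Hx. set (m := t + tau / 2).
  assert (Sm : seg 0 T m) by (unfold seg, m; lra).
  assert (HM0 := sup_bound_nonneg 0 T M m w3 Sm HM).
  assert (H0 := taylor3_near m t tau Sm ltac:(unfold seg; lra) ltac:(apply Rabs_le; unfold m; lra)).
  assert (H1 := taylor3_near m (t + tau) tau Sm ltac:(unfold seg; lra) ltac:(apply Rabs_le; unfold m; lra)).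
  assert (H2 := taylor2 0 T M w1 w2 w3 D1 D2 HM m x Sm ltac:(unfold seg; lra)).
  set (R0 := w0 t - w0 m - w1 m * (t - m) - w2 m * (t - m) ^ 2 / 2) in *.
  set (R1 := w0 (t + tau) - w0 m - w1 m * (t + tau - m) - w2 m * (t + tau - m) ^ 2 / 2) in *.
  replace (w1 x - ((w0 (t + tau) - w0 t) / tau + w2 m * (x - m)))
    with ((w1 x - w1 m - w2 m * (x - m)) + (R0 - R1) / tau)
    by (unfold R0, R1, m; field; lra).
  assert (H3 : Rabs ((R0 - R1) / tau) <= 2 * M * tau ^ 2).
  { apply Rabs_le_between in H0, H1.
    unfold Rdiv. rewrite Rabs_mult, (Rabs_pos_eq (/ tau)) by (left; now apply Rinv_0_lt_compat).
    apply Rmult_le_reg_r with tau; [lra | ]. rewrite Rmult_assoc, Rinv_l, Rmult_1_r by lra.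
    apply Rabs_le. lra. }
  assert (H4 : Rabs (w1 x - w1 m - w2 m * (x - m)) <= M * tau ^ 2).
  { apply Rle_trans with (1 := H2). apply Rmult_le_compat_l; [auto | ].
    apply pow_incr. split; [apply Rabs_pos | ]. apply Rabs_le; unfold m; lra. }
  apply Rle_trans with (1 := Rabs_triang _ _).
  assert (0 <= M * tau ^ 2) by (apply Rmult_le_pos; [auto | apply pow2_ge_0]). lra.
Qed.
End DifferenceQuotients.

(** * Integrals against the weakly singular kernel (t - s)^(p-1) *)

Section SingularKernel.
Variables (p t : R).
Hypothesis Hp : 0 < p < 1.

Let ker (s : R) : R := Rpower (t - s) (p - 1).
Let prim (s : R) : R := - (/ p * Rpower (t - s) p).
(** Primitive of (s - m) ker(s), from integration by parts. Like [prim] it tends to 0 as s increases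
    to t; only this limit is usable, since [Rpower 0 p] is not 0. *)
Let prim1 (m s : R) : R :=
  - (/ p * ((s - m) * Rpower (t - s) p)) - / (p * (p + 1)) * Rpower (t - s) (p + 1).

Lemma is_derive_Rpower_rev (q s : R) : s < t ->
  is_derive (fun s => Rpower (t - s) q) s (- (q * Rpower (t - s) (q - 1))).
Proof.
  intros Hs. replace (- (q * Rpower (t - s) (q - 1))) with (-1 * (q * Rpower (t - s) (q - 1))) by ring.
  apply (is_derive_comp (fun y => Rpower y q) (fun s => t - s)).
  - apply is_derive_Rpower; lra.
  - auto_derive; auto; ring.
Qed.

Lemma is_derive_prim s : s < t -> is_derive prim s (ker s).
Proof.
  intros Hs. unfold prim, ker.
  replace (Rpower (t - s) (p - 1)) with (- (/ p * (- (p * Rpower (t - s) (p - 1))))) by (field; lra).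
  apply (is_derive_opp (fun s => / p * Rpower (t - s) p)).
  apply is_derive_scal. now apply is_derive_Rpower_rev.
Qed.

Lemma is_derive_prim1 m s : s < t -> is_derive (prim1 m) s ((s - m) * ker s).
Proof.
  intros Hs. unfold prim1, ker.
  replace ((s - m) * Rpower (t - s) (p - 1)) with
    (- (/ p * (1 * Rpower (t - s) p + (s - m) * (- (p * Rpower (t - s) (p - 1)))))
     - / (p * (p + 1)) * (- ((p + 1) * Rpower (t - s) (p + 1 - 1))))
    by (replace (p + 1 - 1) with p by ring; field; lra).
  apply (is_derive_minus (fun s => - (/ p * ((s - m) * Rpower (t - s) p)))
    (fun s => / (p * (p + 1)) * Rpower (t - s) (p + 1))).
  - apply (is_derive_opp (fun s => / p * ((s - m) * Rpower (t - s) p))).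
    apply is_derive_scal.
    apply (is_derive_mult (fun s => s - m) (fun s => Rpower (t - s) p)).
    + auto_derive; auto; ring.
    + now apply is_derive_Rpower_rev.
    + exact Rmult_comm.
  - apply is_derive_scal. now apply is_derive_Rpower_rev.
Qed.

Lemma continuous_ker s : s < t -> continuous ker s.
Proof.
  intros Hs. apply (ex_derive_continuous ker). eexists. now apply is_derive_Rpower_rev.
Qed.

Variable v : R -> R.
Hypothesis Hv : forall s, continuous v s.

Lemma ex_RInt_singular a b : a <= b < t -> ex_RInt (fun s => v s * ker s) a b.
Proof.
  intros Hab. apply (ex_RInt_continuous (fun s => v s * ker s)). intros z Hz.
  rewrite Rmax_right in Hz by lra.
  apply (continuous_mult v ker); [apply Hv | apply continuous_ker; lra].
Qed.

(** The kernel is positive, so a uniform error [e] of [v] contributes at most [e] times the mass of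
    the kernel on [a, b]. With c = d = 0 it is also the tail estimate of the convergence proof
    below. *)
Lemma cell_integral_bound a b c d m e : a <= b < t ->
  (forall s, a <= s <= b -> Rabs (v s - (c + d * (s - m))) <= e) ->
  Rabs (RInt (fun s => v s * ker s) a b - (c * (prim b - prim a) + d * (prim1 m b - prim1 m a)))
  <= e * (prim b - prim a).
Proof.
  intros Hab He.
  assert (H1 := RInt_correct _ _ _ (ex_RInt_singular a b Hab)).
  assert (Hk : is_RInt ker a b (prim b - prim a)).
  { apply (is_RInt_derive prim); intros s Hs; rewrite Rmax_right in Hs by lra.
    - apply is_derive_prim; lra.
    - apply continuous_ker; lra. }
  assert (Hk1 : is_RInt (fun s => (s - m) * ker s) a b (prim1 m b - prim1 m a)).
  { apply (is_RInt_derive (prim1 m)); intros s Hs; rewrite Rmax_right in Hs by lra.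
    - apply is_derive_prim1; lra.
    - apply (continuous_mult (fun s => s - m) ker); [ | apply continuous_ker; lra].
      apply (ex_derive_continuous (fun s => s - m)). now auto_derive. }
  assert (H2 := is_RInt_minus _ _ _ _ _ _ H1
     (is_RInt_plus _ _ _ _ _ _ (is_RInt_scal _ _ _ c _ Hk) (is_RInt_scal _ _ _ d _ Hk1))).
  apply (norm_RInt_le _ (fun s => scal e (ker s)) a b _ _ ltac:(lra)) with (2 := H2).
  - intros s Hs. unfold minus, plus, opp, scal; simpl; unfold mult; simpl.
    change norm with Rabs.
    replace (v s * ker s + - (c * ker s + d * ((s - m) * ker s)))
      with ((v s - (c + d * (s - m))) * ker s) by ring.
    rewrite Rabs_mult, (Rabs_pos_eq (ker s)) by (left; apply Rpower_pos).
    apply Rmult_le_compat_r; [left; apply Rpower_pos | now apply He].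
  - apply (is_RInt_scal ker a b e _ Hk).
Qed.

Lemma prim_nonpos s : prim s <= 0.
Proof.
  unfold prim. assert (0 < / p * Rpower (t - s) p); [ | lra].
  apply Rmult_lt_0_compat; [apply Rinv_0_lt_compat; lra | apply Rpower_pos].
Qed.

(** Cauchy criterion: the integral from q to r < t is at most B (t - q)^p / p. *)
Lemma singular_integral_converges (B : R) : 0 < t ->
  (forall s, 0 <= s <= t -> Rabs (v s) <= B) ->
  exists l, filterlim (fun q => RInt (fun s => v s * ker s) 0 q) (at_left t) (locally l).
Proof.
  intros Ht HB.
  assert (HB0 : 0 <= B) by (apply Rle_trans with (2 := HB 0 ltac:(lra)); apply Rabs_pos).
  apply (filterlim_locally_cauchy (fun q => RInt (fun s => v s * ker s) 0 q)).
  intros [eps He].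
  destruct (Rpower_small p (eps * p / (B + 1))) as [d [Hd Hs]]; [lra | | ].
  { apply Rdiv_lt_0_compat; [apply Rmult_lt_0_compat | ]; lra. }
  exists (fun q => 0 <= q < t /\ Rpower (t - q) p < eps * p / (B + 1)). split.
  { assert (H : 0 < Rmin t d) by now apply Rmin_pos.
    exists (mkposreal _ H). intros q Hq Hqt. apply Rabs_def2 in Hq.
    unfold minus, plus, opp in Hq; simpl in Hq. generalize (Rmin_l t d) (Rmin_r t d). intros Hl Hr.
    split; [lra | ]. apply Hs; lra. }
  assert (Hlt : forall q r, 0 <= q <= r -> r < t -> Rpower (t - q) p < eps * p / (B + 1) ->
     Rabs (RInt (fun s => v s * ker s) 0 r - RInt (fun s => v s * ker s) 0 q) < eps).
  { intros q r Hqr Hrt Hq.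
    replace (RInt (fun s => v s * ker s) 0 r - RInt (fun s => v s * ker s) 0 q)
      with (RInt (fun s => v s * ker s) q r - (0 * (prim r - prim q) + 0 * (prim1 0 r - prim1 0 q))).
    2: { rewrite <- (RInt_Chasles (fun s => v s * ker s) 0 q r) by (apply ex_RInt_singular; lra).
         change plus with Rplus. ring. }
    apply Rle_lt_trans with (B * (prim r - prim q)).
    - apply cell_integral_bound; [lra | ]. intros s Hsr.
      replace (v s - (0 + 0 * (s - 0))) with (v s) by ring. apply HB; lra.
    - apply Rle_lt_trans with ((B + 1) * (/ p * Rpower (t - q) p)).
      + assert (H := prim_nonpos r). assert (H' := prim_nonpos q). unfold prim in *.
        assert (0 <= B * (/ p * Rpower (t - r) p)) by (apply Rmult_le_pos; lra). lra.
      + apply Rmult_lt_reg_r with (p / (B + 1)); [apply Rdiv_lt_0_compat; lra | ].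
        replace ((B + 1) * (/ p * Rpower (t - q) p) * (p / (B + 1))) with (Rpower (t - q) p) by (field; lra).
        replace (eps * (p / (B + 1))) with (eps * p / (B + 1)) by (field; lra). exact Hq. }
  intros q r [Hq1 Hq2] [Hr1 Hr2].
  change (Rabs (RInt (fun s => v s * ker s) 0 r - RInt (fun s => v s * ker s) 0 q) < eps).
  destruct (Rle_dec q r) as [H|H].
  - apply Hlt; lra.
  - rewrite Rabs_minus_sym. apply Hlt; lra.
Qed.

End SingularKernel.

(** Undoes the assembly of the c_s: each cell before the last contributes its own a and b, the last
    one only a_0. *)
Lemma ccoef_regroup (nu sg : R) (m : nat) (D : nat -> R) :
  sum_f_R0 (fun s => ccoef nu sg (S m) (S m - s) * D s) (S m)
  = acoef nu sg 0 * D (S m) +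
    sum_f_R0 (fun s => acoef nu sg (S m - s) * D s + bcoef nu sg (S m - s) * (D (S s) - D s)) m.
Proof.
  (* [U s] collects what cell s - 1 contributes to [D s] through its slope, [V s] what cell s
     subtracts; the first cell has no predecessor and the last no slope. *)
  set (U := fun s => match s with O => 0 | S r => bcoef nu sg (S m - r) * D s end).
  set (V := fun s => if Nat.eqb s (S m) then 0 else bcoef nu sg (S m - s) * D s).
  rewrite (sum_eq _ (fun s => acoef nu sg (S m - s) * D s + U s - V s)).
  - rewrite minus_sum, plus_sum, (decomp_sum U) by lia. simpl pred.
    rewrite (tech5 (fun s => acoef nu sg (S m - s) * D s)), (tech5 V).
    replace (V (S m)) with 0 by (unfold V; now rewrite Nat.eqb_refl).
    rewrite Nat.sub_diag.
    rewrite (sum_eq (fun s => acoef nu sg (S m - s) * D s + bcoef nu sg (S m - s) * (D (S s) - D s))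
      (fun s => acoef nu sg (S m - s) * D s + U (S s) - V s)).
    + rewrite minus_sum, plus_sum. simpl (U 0%nat). ring.
    + intros s Hs. unfold U, V. rewrite (proj2 (Nat.eqb_neq s (S m)) ltac:(lia)). ring.
  - intros s Hs. unfold U, V. destruct (Nat.eqb_spec s (S m)) as [->|Hne].
    + rewrite Nat.sub_diag. replace (S m - m)%nat with 1%nat by lia. unfold ccoef. ring.
    + replace (S m - s)%nat with (S (m - s)) by lia. unfold ccoef.
      destruct s as [|r].
      * rewrite Nat.sub_0_r, Nat.ltb_irrefl. ring.
      * rewrite (proj2 (Nat.ltb_lt _ _)) by lia.
        replace (S m - r)%nat with (S (S (m - S r))) by lia. ring.
Qed.

Section Truncation.
Variables (nu T M : R) (w0 w1 w2 w3 : R -> R) (NT n : nat).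
Hypotheses (Hnu : 0 < nu < 1) (HT : 0 < T).
Hypotheses (D0 : deriv_inside 0 T w0 w1) (D1 : deriv_inside 0 T w1 w2) (D2 : deriv_inside 0 T w2 w3).
Hypothesis HM : forall z, seg 0 T z -> Rabs (w3 z) <= M.
Hypothesis Hn : (n < NT)%nat.

Let p := 1 - nu.
Let sg := 1 - nu / 2.
Let tau := T / INR NT.
Let t := tsig sg tau n.
Let tg := tgrid tau.
(** A continuous stand-in for the time derivative on the whole line, avoiding the end s = 0, where
    the two-sided derivative is not controlled. *)
Let v s := w1 (Rmax 0 (Rmin T s)).
Let ker (s : R) : R := Rpower (t - s) (p - 1).
Let prim (s : R) : R := - (/ p * Rpower (t - s) p).
Let prim1 (m s : R) : R :=
  - (/ p * ((s - m) * Rpower (t - s) p)) - / (p * (p + 1)) * Rpower (t - s) (p + 1).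
Let D s := (w0 (tg (S s)) - w0 (tg s)) / tau.
Let e := 8 * M * tau ^ 2.

Lemma exponent_range : 0 < p < 1.
Proof. unfold p; lra. Qed.
Lemma sigma_range : / 2 < sg < 1.
Proof. unfold sg; lra. Qed.
Lemma time_step_pos : 0 < tau.
Proof. apply Rdiv_lt_0_compat; [auto | apply lt_0_INR; lia]. Qed.
Lemma time_step_mul : tau * INR NT = T.
Proof. unfold tau; field. apply not_0_INR; lia. Qed.
Lemma tgrid_succ s : tg (S s) = tg s + tau.
Proof. unfold tg, tgrid. rewrite S_INR. ring. Qed.
Lemma tgrid_nonneg s : 0 <= tg s.
Proof. apply Rmult_le_pos; [apply pos_INR | left; apply time_step_pos]. Qed.
Lemma tgrid_le_T s : (s <= NT)%nat -> tg s <= T.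
Proof.
  intros H. rewrite <- time_step_mul, Rmult_comm. apply Rmult_le_compat_r; [left; apply time_step_pos | now apply le_INR].
Qed.
Lemma tgrid_mono s r : (s <= r)%nat -> tg s <= tg r.
Proof. intros H. apply Rmult_le_compat_r; [left; apply time_step_pos | now apply le_INR]. Qed.
Lemma tsig_eq : t = tg n + sg * tau. Proof. reflexivity. Qed.
Lemma tsig_bounds : tg n < t < tg (S n).
Proof. assert (H := time_step_pos). assert (H' := sigma_range). rewrite tgrid_succ, tsig_eq.
  assert (0 < sg * tau) by (apply Rmult_lt_0_compat; lra).
  assert (0 < (1 - sg) * tau) by (apply Rmult_lt_0_compat; lra). lra.
Qed.
Lemma clamped_derivative_eq s : 0 <= s <= T -> v s = w1 s.
Proof. intros H. unfold v. now rewrite clamp_id. Qed.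
Lemma clamped_derivative_continuous s : continuous v s.
Proof. apply (continuous_on_clamp 0 T w1); [lra | apply D1]. Qed.
Lemma third_derivative_bound_nonneg : 0 <= M.
Proof. apply (sup_bound_nonneg 0 T M 0 w3); auto. unfold seg; lra. Qed.

(** The origin of the coefficients: in units of tau^p / p, a_(n-s) is the mass of the kernel on the
    cell, and b_(n-s) its first moment about the midpoint divided by tau. *)
Lemma cell_value s : (s < n)%nat ->
  D s * (prim (tg (S s)) - prim (tg s))
  + (D (S s) - D s) / tau * (prim1 (tg s + tau / 2) (tg (S s)) - prim1 (tg s + tau / 2) (tg s))
  = Rpower tau p / p * (acoef nu sg (n - s) * D s + bcoef nu sg (n - s) * (D (S s) - D s)).
Proof.
  intros Hs. assert (Htau := time_step_pos). assert (HpH := exponent_range).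
  replace (n - s)%nat with (S (n - S s)) by lia.
  unfold sg. rewrite acoef_incr, bcoef_trap. fold p sg.
  set (x := INR (n - S s) + sg).
  assert (Hx : 0 < x) by (apply INR_plus_sigma_pos; auto).
  assert (E1 : t - tg (S s) = tau * x).
  { unfold x. rewrite minus_INR by lia. rewrite tsig_eq. unfold tg, tgrid. ring. }
  assert (E0 : t - tg s = tau * (x + 1)) by (rewrite Rmult_plus_distr_l, <- E1, tgrid_succ; ring).
  unfold prim, prim1. rewrite E1, E0, tgrid_succ.
  rewrite <- !Rpower_mult_distr by lra. rewrite (Rpower_succ tau) by lra.
  unfold incr, trap. field. lra.
Qed.

Lemma memory_cells m : (m < n)%nat ->
  Rabs (RInt (fun s => v s * ker s) 0 (tg (S m))
    - Rpower tau p / p * sum_f_R0 (fun s => acoef nu sg (n - s) * D s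
         + bcoef nu sg (n - s) * (D (S s) - D s)) m)
  <= e * (prim (tg (S m)) - prim 0).
Proof.
  assert (Htb := tsig_bounds). assert (Htau := time_step_pos). assert (HpH := exponent_range).
  assert (Hcell : forall s, (s < n)%nat ->
    Rabs (RInt (fun s => v s * ker s) (tg s) (tg (S s))
      - Rpower tau p / p * (acoef nu sg (n - s) * D s + bcoef nu sg (n - s) * (D (S s) - D s)))
    <= e * (prim (tg (S s)) - prim (tg s))).
  { intros s Hs. rewrite <- cell_value by auto.
    apply (cell_integral_bound p t exponent_range v clamped_derivative_continuous (tg s) (tg (S s))).
    - split; [apply tgrid_mono; lia | ]. apply Rle_lt_trans with (tg n); [apply tgrid_mono; lia | lra].
    (* The interpolation looks one cell ahead; t_(s+2) is still a grid time because s + 2 <= n + 1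
       <= NT. *)
    - intros x Hx. assert (H0 := tgrid_nonneg s). assert (H1 := tgrid_le_T (S (S s)) ltac:(lia)).
      rewrite (tgrid_succ (S s)), (tgrid_succ s) in H1. rewrite tgrid_succ in Hx.
      rewrite clamped_derivative_eq by lra.
      replace ((D (S s) - D s) / tau) with
        ((w0 (tg s + 2 * tau) - 2 * w0 (tg s + tau) + w0 (tg s)) / tau ^ 2).
      2: { unfold D. rewrite (tgrid_succ (S s)), (tgrid_succ s). replace (tg s + tau + tau) with (tg s + 2 * tau) by ring. field; lra. }
      unfold D. rewrite tgrid_succ.
      apply (quadratic_interpolation_derivative T tau M w0 w1 w2 w3); auto; lra. }
  induction m as [|m IH]; intros Hm.
  - simpl sum_f_R0. rewrite Nat.sub_0_r. specialize (Hcell 0%nat Hm). rewrite Nat.sub_0_r in Hcell.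
    replace (tg 0) with 0 in Hcell by (unfold tg, tgrid; simpl; ring). exact Hcell.
  - rewrite tech5. specialize (IH ltac:(lia)). specialize (Hcell (S m) Hm).
    rewrite <- (RInt_Chasles (fun s => v s * ker s) 0 (tg (S m)) (tg (S (S m)))).
    + change plus with Rplus. rewrite Rmult_plus_distr_l.
      apply Rabs_le_between in IH, Hcell. apply Rabs_le. lra.
    + apply (ex_RInt_singular p t v clamped_derivative_continuous). split; [apply tgrid_nonneg | ].
      apply Rle_lt_trans with (tg n); [apply tgrid_mono; lia | lra].
    + apply (ex_RInt_singular p t v clamped_derivative_continuous). split; [apply tgrid_mono; lia | ].
      apply Rle_lt_trans with (tg n); [apply tgrid_mono; lia | lra].
Qed.

Lemma memory_cells_all :
  Rabs (RInt (fun s => v s * ker s) 0 (tg n)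
    - Rpower tau p / p * (sum_f_R0 (fun s => ccoef nu sg n (n - s) * D s) n - acoef nu sg 0 * D n))
  <= e * (prim (tg n) - prim 0).
Proof.
  destruct (Nat.eq_dec n 0) as [E|E].
  - rewrite E. replace (tg 0) with 0 by (unfold tg, tgrid; simpl; ring).
    rewrite RInt_point. simpl. unfold zero; simpl.
    match goal with |- Rabs ?x <= _ => replace x with 0 by ring end. rewrite Rabs_R0. right; ring.
  - assert (H := memory_cells (pred n) ltac:(lia)). rewrite Nat.succ_pred in H by auto.
    assert (H' := ccoef_regroup nu sg (pred n) D). rewrite Nat.succ_pred in H' by auto. rewrite H'.
    match goal with |- context [acoef nu sg 0 * D n + ?x - acoef nu sg 0 * D n] =>
      replace (acoef nu sg 0 * D n + x - acoef nu sg 0 * D n) with x by ring end.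
    exact H.
Qed.

(* The choice sigma = 1 - nu/2 makes the first moment about the midpoint of
   the last cell vanish. *)
Lemma last_cell_moment : prim1 (tg n + tau / 2) (tg n) = 0.
Proof.
  assert (Htau := time_step_pos). assert (HpH := exponent_range). assert (Hs := sigma_range).
  unfold prim1. replace (t - tg n) with (sg * tau) by (rewrite tsig_eq; ring).
  rewrite Rpower_succ by (apply Rmult_lt_0_compat; lra).
  replace sg with ((p + 1) / 2) by (unfold p, sg; field). field. lra.
Qed.

(** The integral is stopped before the singularity. The second term is what the primitives leave at
    [q]; its factor is not uniform in tau, but it disappears as q tends to t. *)
Lemma truncated_integral_bound q : tg n <= q < t ->
  Rabs (RInt (fun s => v s * ker s) 0 q
        - Rpower tau p / p * sum_f_R0 (fun s => ccoef nu sg n (n - s) * D s) n)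
  <= e * (/ p * Rpower t p)
     + (Rabs (D n) / p + Rabs (w2 (tg n + tau / 2)) * (tau / p + t / (p * (p + 1)))) * Rpower (t - q) p.
Proof.
  intros Hq. assert (Htb := tsig_bounds). assert (Htau := time_step_pos). assert (HpH := exponent_range). assert (Hs := sigma_range).
  assert (H0 := tgrid_nonneg n). assert (He : 0 <= e).
  { unfold e. apply Rmult_le_pos; [ | apply pow2_ge_0]. generalize third_derivative_bound_nonneg; lra. }
  set (la := w2 (tg n + tau / 2)).
  assert (HT' := tgrid_le_T (S n) Hn). rewrite tgrid_succ in HT', Htb.
  assert (H1 : Rabs (RInt (fun s => v s * ker s) (tg n) q - (D n * (prim q - prim (tg n))
      + la * (prim1 (tg n + tau / 2) q - prim1 (tg n + tau / 2) (tg n)))) <= e * (prim q - prim (tg n))).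
  { apply (cell_integral_bound p t exponent_range v clamped_derivative_continuous (tg n) q); [lra | ].
    intros x Hx. rewrite clamped_derivative_eq by lra. unfold D. rewrite tgrid_succ.
    apply (central_quotient_derivative T tau M w0 w1 w2 w3); auto; lra. }
  rewrite last_cell_moment in H1.
  assert (H2 := memory_cells_all).
  rewrite <- (RInt_Chasles (fun s => v s * ker s) 0 (tg n) q)
    by (apply (ex_RInt_singular p t v clamped_derivative_continuous); lra).
  change plus with Rplus.
  assert (E1 : prim (tg n) = - (Rpower tau p / p * acoef nu sg 0)).
  { unfold prim, acoef. replace (t - tg n) with (tau * sg) by (rewrite tsig_eq; ring).
    rewrite <- Rpower_mult_distr by lra. fold p. field. lra. }
  assert (Hq0 := Rpower_pos (t - q) p).
  assert (E2 : Rabs (prim1 (tg n + tau / 2) q) <= (tau / p + t / (p * (p + 1))) * Rpower (t - q) p).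
  { unfold prim1. rewrite Rpower_succ by lra.
    replace (- (/ p * ((q - (tg n + tau / 2)) * Rpower (t - q) p))
             - / (p * (p + 1)) * ((t - q) * Rpower (t - q) p))
      with (- ((q - (tg n + tau / 2)) / p + (t - q) / (p * (p + 1))) * Rpower (t - q) p) by (field; lra).
    rewrite Rabs_mult, (Rabs_pos_eq (Rpower (t - q) p)) by lra.
    apply Rmult_le_compat_r; [lra | ]. rewrite Rabs_Ropp.
    apply Rle_trans with (1 := Rabs_triang _ _).
    assert (0 < / p) by (apply Rinv_0_lt_compat; lra).
    assert (0 < / (p * (p + 1))) by (apply Rinv_0_lt_compat, Rmult_lt_0_compat; lra).
    unfold Rdiv. rewrite !Rabs_mult, (Rabs_pos_eq (/ p)), (Rabs_pos_eq (/ (p * (p + 1)))) by lra.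
    apply Rplus_le_compat; apply Rmult_le_compat_r; try lra; apply Rabs_le; lra. }
  assert (E3 : Rabs (prim q) = / p * Rpower (t - q) p).
  { unfold prim. rewrite Rabs_Ropp, Rabs_pos_eq; [auto | ].
    apply Rmult_le_pos; [left; apply Rinv_0_lt_compat | ]; lra. }
  assert (E4 : Rabs (D n * prim q + la * prim1 (tg n + tau / 2) q)
     <= (Rabs (D n) / p + Rabs la * (tau / p + t / (p * (p + 1)))) * Rpower (t - q) p).
  { apply Rle_trans with (1 := Rabs_triang _ _). rewrite !Rabs_mult, E3.
    apply (Rmult_le_compat_l (Rabs la)) in E2; [ | apply Rabs_pos].
    unfold Rdiv at 1. lra. }
  assert (E5 : e * (prim q - prim 0) <= e * (/ p * Rpower t p)).
  { apply Rmult_le_compat_l; auto. assert (H : prim q <= 0) by exact (prim_nonpos p t exponent_range q).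
    assert (H' : prim 0 = - (/ p * Rpower t p)) by (unfold prim; now rewrite Rminus_0_r). lra. }
  apply Rabs_le_between in H1, H2, E4. apply Rabs_le.
  rewrite E1 in H1. rewrite E1 in H2. lra.
Qed.

Lemma clamped_derivative_bounded : exists B, forall s, 0 <= s <= T -> Rabs (v s) <= B.
Proof.
  exists (Rabs (w1 0) + Rabs (w2 0) * T + M * T ^ 2). intros s Hs. rewrite clamped_derivative_eq by auto.
  assert (H := taylor2 0 T M w1 w2 w3 D1 D2 HM 0 s ltac:(unfold seg; lra) Hs).
  rewrite Rminus_0_r, (Rabs_pos_eq s) in H by lra.
  replace (w1 s) with (w1 0 + w2 0 * s + (w1 s - w1 0 - w2 0 * s)) by ring.
  apply Rle_trans with (1 := Rabs_triang _ _). apply Rplus_le_compat.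
  - apply Rle_trans with (1 := Rabs_triang _ _). apply Rplus_le_compat_l.
    rewrite Rabs_mult, (Rabs_pos_eq s) by lra. apply Rmult_le_compat_l; [apply Rabs_pos | lra].
  - apply Rle_trans with (1 := H). apply Rmult_le_compat_l; [apply third_derivative_bound_nonneg | ]. apply pow_incr; lra.
Qed.

(** On the open interval (0, q) the two-sided derivative agrees with [v], and end point values do
    not change the integral. *)
Lemma caputo_integral_limit l :
  filterlim (fun q => RInt (fun s => v s * ker s) 0 q) (at_left t) (locally l) ->
  caputo nu w0 t = / Gamma p * l.
Proof.
  intros Hl. unfold caputo. fold p. f_equal. apply is_RInt_gen_unique.
  assert (Htb := tsig_bounds). assert (HT' := tgrid_le_T (S n) Hn). assert (H0 := tgrid_nonneg n).
  intros P HP. unfold filtermapi.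
  apply Filter_prod with (fun x => x = 0)
    (fun q => 0 < q < t /\ P (RInt (fun s => v s * ker s) 0 q)); [reflexivity | | ].
  - apply filter_and; [ | exact (Hl P HP)].
    assert (Ht : 0 < t) by lra. exists (mkposreal t Ht). intros q Hq Hqt.
    apply Rabs_def2 in Hq. unfold minus, plus, opp in Hq; simpl in Hq. lra.
  - intros x q -> [Hq HPq]. simpl. exists (RInt (fun s => v s * ker s) 0 q). split; auto.
    apply is_RInt_ext with (fun s => v s * ker s).
    + intros s. rewrite Rmin_left, Rmax_right by lra. intros Hs.
      rewrite clamped_derivative_eq by lra. unfold ker, Rdiv. f_equal.
      * symmetry. apply is_derive_unique. apply D0; lra.
      * replace (p - 1) with (- nu) by (unfold p; ring). apply Rpower_Ropp.
    + apply (RInt_correct (fun s => v s * ker s)). apply (ex_RInt_singular p t v clamped_derivative_continuous). lra.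
Qed.

Lemma caputo_truncation :
  Rabs (caputo_h nu sg tau (fun s => w0 (tg s)) n - caputo nu w0 t)
  <= 8 * Rpower T p / (p * Gamma p) * M * tau ^ 2.
Proof.
  assert (HpH := exponent_range). assert (Htb := tsig_bounds). assert (H0 := tgrid_nonneg n).
  assert (HT' := tgrid_le_T (S n) Hn).
  destruct (Gamma_recurrence p exponent_range) as [HG1 HG2].
  destruct clamped_derivative_bounded as [B HB].
  destruct (singular_integral_converges p t exponent_range v clamped_derivative_continuous B ltac:(lra)) as [l Hl].
  { intros s Hs. apply HB. lra. }
  rewrite (caputo_integral_limit l Hl). unfold caputo_h.
  replace (2 - nu) with (p + 1) by (unfold p; ring). rewrite HG2. fold p. fold D.
  change (fun s => ccoef nu sg n (n - s) * ((w0 (tg (S s)) - w0 (tg s)) / tau))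
    with (fun s => ccoef nu sg n (n - s) * D s).
  set (A := Rpower tau p / p * sum_f_R0 (fun s => ccoef nu sg n (n - s) * D s) n).
  replace (Rpower tau p / (p * Gamma p) * sum_f_R0 (fun s => ccoef nu sg n (n - s) * D s) n)
    with (/ Gamma p * A) by (unfold A; field; lra).
  rewrite <- Rmult_minus_distr_l, Rabs_mult, Rabs_pos_eq by (left; now apply Rinv_0_lt_compat).
  assert (Hmain : Rabs (A - l) <= e * (/ p * Rpower t p)).
  { apply le_epsilon. intros eps He.
    set (c := Rabs (D n) / p + Rabs (w2 (tg n + tau / 2)) * (tau / p + t / (p * (p + 1)))).
    assert (Hc : 0 <= c).
    { assert (Htau := time_step_pos). unfold c. apply Rplus_le_le_0_compat.
      - apply Rdiv_le_0_compat; [apply Rabs_pos | lra].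
      - apply Rmult_le_pos; [apply Rabs_pos | ]. apply Rplus_le_le_0_compat; apply Rdiv_le_0_compat; try lra.
        apply Rmult_lt_0_compat; lra. }
    destruct (Rpower_small p (eps / 2 / (c + 1))) as [d [Hd Hs]]; [lra | | ].
    { apply Rdiv_lt_0_compat; lra. }
    assert (Heps : 0 < eps / 2) by lra.
    destruct (Hl _ (locally_ball l (mkposreal _ Heps))) as [d' Hd'].
    (* The stopping point t - r/2 lies in the last cell and is so close to t that the leftover term
       and the missing tail are each at most eps/2. *)
    set (r := Rmin (Rmin d d') (t - tg n)).
    assert (Hr : 0 < r) by (repeat apply Rmin_pos; try lra; apply cond_pos).
    assert (Hr1 : r <= d) by (unfold r; eapply Rle_trans; [apply Rmin_l | apply Rmin_l]).
    assert (Hr2 : r <= d') by (unfold r; eapply Rle_trans; [apply Rmin_l | apply Rmin_r]).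
    assert (Hr3 : r <= t - tg n) by (unfold r; apply Rmin_r).
    assert (B1 := truncated_integral_bound (t - r / 2) ltac:(lra)). fold c A in B1.
    assert (B2 : Rabs (RInt (fun s => v s * ker s) 0 (t - r / 2) - l) < eps / 2).
    { apply (Hd' (t - r / 2)); [ | lra].
      change (Rabs (t - r / 2 - t) < d'). apply Rabs_def1; lra. }
    assert (B3 := Hs (t - (t - r / 2)) ltac:(lra)).
    assert (B4 : c * Rpower (t - (t - r / 2)) p <= eps / 2).
    { apply Rle_trans with ((c + 1) * Rpower (t - (t - r / 2)) p).
      - apply Rmult_le_compat_r; [left; apply Rpower_pos | lra].
      - apply Rmult_le_reg_r with (/ (c + 1)); [apply Rinv_0_lt_compat; lra | ].
        replace ((c + 1) * Rpower (t - (t - r / 2)) p * / (c + 1)) with (Rpower (t - (t - r / 2)) p)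
          by (field; lra).
        left; exact B3. }
    apply Rabs_def2 in B2. apply Rabs_le_between in B1. apply Rabs_le. lra. }
  apply Rle_trans with (/ Gamma p * (e * (/ p * Rpower T p))).
  - apply Rmult_le_compat_l; [left; now apply Rinv_0_lt_compat | ].
    apply Rle_trans with (1 := Hmain). apply Rmult_le_compat_l.
    + unfold e. apply Rmult_le_pos; [ | apply pow2_ge_0]. generalize third_derivative_bound_nonneg; lra.
    + apply Rmult_le_compat_l; [left; apply Rinv_0_lt_compat; lra | ]. apply Rle_Rpower_l; lra.
  - right. unfold e. field. lra.
Qed.
End Truncation.

(** * Truncation error in space *)

Lemma locally_seg (a b x : R) : a < x < b -> locally x (fun y => a <= y <= b).
Proof.
  intros Hx. assert (H : 0 < Rmin (x - a) (b - x)) by (apply Rmin_pos; lra).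
  exists (mkposreal _ H). intros y Hy. apply Rabs_def2 in Hy.
  unfold minus, plus, opp in Hy; simpl in Hy.
  generalize (Rmin_l (x - a) (b - x)) (Rmin_r (x - a) (b - x)). lra.
Qed.

Lemma is_filter_lim_within (D : R -> Prop) (x : R) :
  is_filter_lim (within D (locally x)) x.
Proof. intros P HP. unfold within. apply filter_imp with (2 := HP). auto. Qed.

Lemma is_derive_on_inside (a b x l : R) (g : R -> R) :
  a < x < b -> is_derive_on a b g x l <-> is_derive g x l.
Proof.
  intros Hx. assert (Hloc := locally_seg a b x Hx). split; intros [Hlin Hd]; split; auto; intros y Hy.
  (* [filterdiff] quantifies over all limits of its filter; at an interior point [x] is the only one
     for either filter. *)
  - assert (E : y = x) by (symmetry; now apply is_filter_lim_locally_unique).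
    subst y. intros eps.
    assert (H := Hd x (is_filter_lim_within _ x) eps).
    unfold within in H. generalize (filter_and _ _ H Hloc). apply filter_imp. tauto.
  - assert (E : y = x).
    { symmetry. apply (is_filter_lim_locally_unique x y). intros P HP.
      assert (H := Hy P HP). unfold within in H.
      generalize (filter_and _ _ H Hloc). apply filter_imp. tauto. }
    subst y. intros eps. assert (H := Hd x (fun P HP => HP) eps).
    unfold within. revert H. apply filter_imp. auto.
Qed.

Lemma Derive_on_inside (a b x l : R) (g : R -> R) :
  a < x < b -> is_derive g x l -> Derive_on a b g x = l.
Proof.
  intros Hx Hl. unfold Derive_on. apply (iota_unique (V := R_CompleteNormedModule)).
  - intros y Hy. apply (is_derive_on_inside a b x y g Hx) in Hy.
    rewrite <- (is_derive_unique _ _ _ Hl). symmetry; now apply is_derive_unique.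
  - now apply is_derive_on_inside.
Qed.

Lemma ex_derive_on_inside (a b x : R) (g : R -> R) :
  a < x < b -> ex_derive_on a b g x -> is_derive g x (Derive_on a b g x).
Proof.
  intros Hx [l Hl]. apply (is_derive_on_inside a b x l g Hx) in Hl.
  now rewrite (Derive_on_inside a b x l g Hx Hl).
Qed.

Definition continuous_on_rect (T : R) (F : R -> R -> R) : Prop :=
  continuous_on (fun P : R * R => rect T (fst P) (snd P)) (fun P : R * R => F (fst P) (snd P)).

Lemma continuous_on_rect_x (T t : R) (F : R -> R -> R) :
  continuous_on_rect T F -> 0 <= t <= T -> continuous_on (seg 0 1) (fun x => F x t).
Proof.
  intros HF Ht x Hx P HP. destruct (HF (x, t) (conj Hx Ht) P HP) as [d Hd].
  exists d. intros y Hy Hy'. apply (Hd (y, t)); [ | now split].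
  split; [exact Hy | apply ball_center].
Qed.

Lemma continuous_on_rect_t (T x : R) (F : R -> R -> R) :
  continuous_on_rect T F -> 0 <= x <= 1 -> continuous_on (seg 0 T) (F x).
Proof.
  intros HF Hx t Ht P HP. destruct (HF (x, t) (conj Hx Ht) P HP) as [d Hd].
  exists d. intros s Hs Hs'. apply (Hd (x, s)); [ | now split].
  split; [apply ball_center | exact Hs].
Qed.

(** By uniform continuity [G] changes by less than 1 over distance [d]. The segment from (0, 0) to
    (x, t) is walked in [S n0] equal steps shorter than [d], a number that does not depend on the
    target. *)
Lemma rect_bounded (T : R) (F : R -> R -> R) : 0 <= T -> continuous_on_rect T F ->
  exists M, forall x t, rect T x t -> Rabs (F x t) <= M.
Proof.
  intros HT HF.
  set (G := fun x t => F (Rmax 0 (Rmin 1 x)) (Rmax 0 (Rmin T t))).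
  assert (HG : forall x t, continuity_2d_pt G x t).
  { intros x t eps.
    assert (Hr : rect T (Rmax 0 (Rmin 1 x)) (Rmax 0 (Rmin T t))) by (split; apply clamp_seg; lra).
    destruct (HF (Rmax 0 (Rmin 1 x), Rmax 0 (Rmin T t)) Hr _ (locally_ball _ eps)) as [d Hd].
    exists d. intros y s Hy Hs.
    apply (Hd (Rmax 0 (Rmin 1 y), Rmax 0 (Rmin T s))); [ | split; apply clamp_seg; lra].
    split; simpl; (eapply Rle_lt_trans; [apply clamp_contract | eassumption]). }
  destruct (uniform_continuity_2d G 0 1 0 T (fun x y _ _ => HG x y) (mkposreal 1 Rlt_0_1)) as [d Hd].
  simpl in Hd. assert (Hdp := cond_pos d).
  destruct (nfloor_ex ((1 + T) / d)) as [n0 [_ Hn0]]; [apply Rdiv_le_0_compat; lra | ].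
  set (n := INR n0 + 1) in *. assert (Hn : 0 < n) by (unfold n; generalize (pos_INR n0); lra).
  assert (Hnd : 1 + T < n * d).
  { apply Rmult_lt_compat_r with (r := d) in Hn0; [ | lra].
    replace ((1 + T) / d * d) with (1 + T) in Hn0 by (field; lra). exact Hn0. }
  exists (Rabs (G 0 0) + INR (S n0)). intros x t [Hx Ht].
  assert (Hk : forall k, (k <= S n0)%nat ->
    Rabs (G (x * INR k / n) (t * INR k / n)) <= Rabs (G 0 0) + INR k).
  { assert (Hrange : forall c r k, 0 <= r <= c -> (k <= S n0)%nat -> 0 <= r * INR k / n <= c).
    { intros c r k Hr Hk. assert (H0 := pos_INR k).
      assert (H1 : INR k <= n) by (unfold n; rewrite <- S_INR; now apply le_INR).
      split; [apply Rdiv_le_0_compat; [apply Rmult_le_pos; lra | lra] | ].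
      apply Rmult_le_reg_r with n; [lra | ]. replace (r * INR k / n * n) with (r * INR k) by (field; lra).
      apply Rmult_le_compat; lra. }
    assert (Hstep : forall r k, 0 <= r <= 1 + T -> Rabs (r * INR (S k) / n - r * INR k / n) < d).
    { intros r k Hr. rewrite S_INR. replace (r * (INR k + 1) / n - r * INR k / n) with (r / n) by (field; lra).
      rewrite Rabs_pos_eq by (apply Rdiv_le_0_compat; lra).
      apply Rmult_lt_reg_r with n; [lra | ]. replace (r / n * n) with r by (field; lra). lra. }
    induction k as [|k IH]; intros Hk.
    - simpl INR. unfold Rdiv. rewrite !Rmult_0_r, !Rmult_0_l. lra.
    - rewrite S_INR at 3.
      assert (H := Hd (x * INR k / n) (t * INR k / n) (x * INR (S k) / n) (t * INR (S k) / n)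
        (Hrange 1 x k Hx ltac:(lia)) (Hrange T t k Ht ltac:(lia)) (Hrange 1 x (S k) Hx Hk)
        (Hrange T t (S k) Ht Hk) (Hstep x k ltac:(lra)) (Hstep t k ltac:(lra))).
      specialize (IH ltac:(lia)).
      set (P := G (x * INR (S k) / n) (t * INR (S k) / n)) in *.
      set (Q := G (x * INR k / n) (t * INR k / n)) in *.
      replace P with (Q + (P - Q)) by ring. apply Rle_trans with (1 := Rabs_triang _ _). lra. }
  specialize (Hk (S n0) (le_n _)).
  replace (x * INR (S n0) / n) with x in Hk by (rewrite S_INR; unfold n; field; unfold n in Hn; lra).
  replace (t * INR (S n0) / n) with t in Hk by (rewrite S_INR; unfold n; field; unfold n in Hn; lra).
  unfold G at 1 in Hk. rewrite !clamp_id in Hk by assumption. exact Hk.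
Qed.

Section Smooth.
Variables (p q : nat) (T : R) (v : R -> R -> R).
Hypothesis HT : 0 <= T.
Hypothesis Hv : smooth p q T v.

Lemma smooth_continuous i j : (i <= p)%nat -> (j <= q)%nat -> continuous_on_rect T (partial T i j v).
Proof. apply Hv. Qed.

Lemma smooth_x i j t : (i < p)%nat -> (j <= q)%nat -> 0 <= t <= T ->
  deriv_inside 0 1 (fun x => partial T i j v x t) (fun x => partial T (S i) j v x t).
Proof.
  intros Hi Hj Ht. split.
  - intros x Hx. change (partial T (S i) j v x t) with (Derive_on 0 1 (fun z => partial T i j v z t) x).
    apply ex_derive_on_inside; auto. apply Hv; auto. split; lra.
  - apply (continuous_on_rect_x T t (partial T i j v)); auto. apply smooth_continuous; lia.
Qed.

Lemma smooth_t j x : (j < q)%nat -> 0 <= x <= 1 ->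
  deriv_inside 0 T (fun t => partial T 0 j v x t) (fun t => partial T 0 (S j) v x t).
Proof.
  intros Hj Hx. split.
  - intros t Ht. change (partial T 0 (S j) v x t) with (Derive_on 0 T (partial T 0 j v x) t).
    apply ex_derive_on_inside; auto. apply Hv; auto. split; lra.
  - apply (continuous_on_rect_t T x (partial T 0 j v)); auto. apply smooth_continuous; lia.
Qed.

Lemma common_bound (n : nat) (F : nat -> R -> R -> R) :
  (forall i, (i <= n)%nat -> exists M, forall x t, rect T x t -> Rabs (F i x t) <= M) ->
  exists M, forall i x t, (i <= n)%nat -> rect T x t -> Rabs (F i x t) <= M.
Proof.
  induction n as [|n IH]; intros H.
  - destruct (H 0%nat (le_n _)) as [M HM]. exists M. intros i x t Hi. replace i with 0%nat by lia. apply HM.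
  - destruct IH as [M1 H1]; [intros; apply H; lia | ].
    destruct (H (S n) (le_n _)) as [M2 H2]. exists (Rmax M1 M2). intros i x t Hi Hr.
    destruct (Nat.eq_dec i (S n)) as [->|Hne].
    + apply Rle_trans with (2 := Rmax_r _ _). now apply H2.
    + apply Rle_trans with (2 := Rmax_l _ _). apply H1; [lia | auto].
Qed.

Lemma smooth_bounded :
  exists M, forall i j x t, (i <= p)%nat -> (j <= q)%nat -> rect T x t -> Rabs (partial T i j v x t) <= M.
Proof.
  assert (H : forall j, (j <= q)%nat ->
    exists M, forall i x t, (i <= p)%nat -> rect T x t -> Rabs (partial T i j v x t) <= M).
  { intros j Hj. apply (common_bound p (fun i => partial T i j v)). intros i Hi.
    apply rect_bounded; auto. now apply smooth_continuous. }
  assert (H' : forall n, (n <= q)%nat -> exists M, forall i j x t, (i <= p)%nat -> (j <= n)%nat ->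
     rect T x t -> Rabs (partial T i j v x t) <= M).
  { induction n as [|n IH]; intros Hn.
    - destruct (H 0%nat Hn) as [M HM]. exists M. intros i j x t Hi Hj. replace j with 0%nat by lia. now apply HM.
    - destruct IH as [M1 H1]; [lia | ]. destruct (H (S n) Hn) as [M2 H2].
      exists (Rmax M1 M2). intros i j x t Hi Hj Hr. destruct (Nat.eq_dec j (S n)) as [->|Hne].
      + apply Rle_trans with (2 := Rmax_r _ _). now apply H2.
      + apply Rle_trans with (2 := Rmax_l _ _). apply H1; auto; lia. }
  now apply H'.
Qed.
End Smooth.

(** t + sg tau is the mean of the two nodes with the same weights, so the first-order terms
    cancel. *)
Lemma level_interpolation (T sg tau G t : R) (g0 g1 g2 : R -> R) :
  deriv_inside 0 T g0 g1 -> deriv_inside 0 T g1 g2 -> (forall s, seg 0 T s -> Rabs (g2 s) <= G) ->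
  0 <= sg <= 1 -> 0 < tau -> 0 <= t -> t + tau <= T ->
  Rabs (sg * g0 (t + tau) + (1 - sg) * g0 t - g0 (t + sg * tau)) <= G * tau ^ 2.
Proof.
  intros D0 D1 HG Hs Htau Ht HT. set (m := t + sg * tau).
  assert (Hb : 0 <= sg * tau <= tau) by (split; [apply Rmult_le_pos; lra | ]; assert (0 <= (1 - sg) * tau) by (apply Rmult_le_pos; lra); lra).
  assert (Sm : seg 0 T m) by (unfold seg, m; lra).
  assert (HG0 := sup_bound_nonneg 0 T G m g2 Sm HG).
  assert (H : forall y, seg 0 T y -> Rabs (y - m) <= tau -> Rabs (g0 y - g0 m - g1 m * (y - m)) <= G * tau ^ 2).
  { intros y Hy Hr. apply Rle_trans with (1 := taylor2 0 T G g0 g1 g2 D0 D1 HG m y Sm Hy).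
    apply Rmult_le_compat_l; [auto | ]. apply pow_incr. split; [apply Rabs_pos | auto]. }
  assert (H1 := H (t + tau) ltac:(unfold seg; lra) ltac:(apply Rabs_le; unfold m; lra)).
  assert (H2 := H t ltac:(unfold seg; lra) ltac:(apply Rabs_le; unfold m; lra)).
  replace (sg * g0 (t + tau) + (1 - sg) * g0 t - g0 m) with
    (sg * (g0 (t + tau) - g0 m - g1 m * (t + tau - m)) + (1 - sg) * (g0 t - g0 m - g1 m * (t - m)))
    by (unfold m; ring).
  apply Rle_trans with (1 := Rabs_triang _ _). rewrite !Rabs_mult, (Rabs_pos_eq sg), (Rabs_pos_eq (1 - sg)) by lra.
  apply (Rmult_le_compat_l sg) in H1; [ | lra]. apply (Rmult_le_compat_l (1 - sg)) in H2; [ | lra]. lra.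
Qed.

Lemma deriv_inside_comb3 (a b A B C : R) (f f' g g' h h' : R -> R) :
  deriv_inside a b f f' -> deriv_inside a b g g' -> deriv_inside a b h h' ->
  deriv_inside a b (fun s => A * f s + B * g s + C * h s) (fun s => A * f' s + B * g' s + C * h' s).
Proof.
  intros Hf Hg Hh.
  apply (deriv_inside_plus a b (fun s => A * f s + B * g s) (fun s => A * f' s + B * g' s)
    (fun s => C * h s) (fun s => C * h' s)); [ | now apply deriv_inside_scal].
  apply (deriv_inside_plus a b (fun s => A * f s) (fun s => A * f' s)
    (fun s => B * g s) (fun s => B * g' s)); now apply deriv_inside_scal.
Qed.

(** * Truncation of the flux-form difference operator at a fixed time *)

Section SpaceTruncation.
Variables (M h : R) (K0 K1 K2 K3 U0 U1 U2 U3 U4 : R -> R).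
Hypotheses (DK0 : deriv_inside 0 1 K0 K1) (DK1 : deriv_inside 0 1 K1 K2) (DK2 : deriv_inside 0 1 K2 K3).
Hypotheses (DU0 : deriv_inside 0 1 U0 U1) (DU1 : deriv_inside 0 1 U1 U2)
  (DU2 : deriv_inside 0 1 U2 U3) (DU3 : deriv_inside 0 1 U3 U4).
Hypothesis HK : forall x, seg 0 1 x ->
  Rabs (K0 x) <= M /\ Rabs (K1 x) <= M /\ Rabs (K2 x) <= M /\ Rabs (K3 x) <= M.
Hypothesis HU : forall x, seg 0 1 x ->
  Rabs (U1 x) <= M /\ Rabs (U2 x) <= M /\ Rabs (U3 x) <= M /\ Rabs (U4 x) <= M.
Hypothesis Hh : 0 < h.

Let W x := K0 x * U1 x.
Let W1 x := K1 x * U1 x + K0 x * U2 x.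
(** Here and in [W3] the Leibniz expansion stays unsimplified, in the shape produced by
    [deriv_inside_mult] and [deriv_inside_plus]. *)
Let W2 x := (K2 x * U1 x + K1 x * U2 x) + (K1 x * U2 x + K0 x * U3 x).
Let W3 x := ((K3 x * U1 x + K2 x * U2 x) + (K2 x * U2 x + K1 x * U3 x))
          + ((K2 x * U2 x + K1 x * U3 x) + (K1 x * U3 x + K0 x * U4 x)).
Let quot x := K0 x * ((U0 (x + h / 2) - U0 (x - h / 2)) / h).

Lemma coefficient_bound_nonneg : 0 <= M.
Proof. apply Rle_trans with (Rabs (K0 0)); [apply Rabs_pos | ]. apply HK; unfold seg; lra. Qed.

Lemma Rabs_prod_le a b : Rabs a <= M -> Rabs b <= M -> Rabs (a * b) <= M ^ 2.
Proof.
  intros Ha Hb. rewrite Rabs_mult. simpl; rewrite Rmult_1_r.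
  apply Rmult_le_compat; auto; apply Rabs_pos.
Qed.

Lemma flux_deriv : deriv_inside 0 1 W W1.
Proof. now apply deriv_inside_mult. Qed.
Lemma flux_deriv2 : deriv_inside 0 1 W1 W2.
Proof.
  apply (deriv_inside_plus 0 1 (fun x => K1 x * U1 x) _ (fun x => K0 x * U2 x));
    now apply deriv_inside_mult.
Qed.
Lemma flux_deriv3 : deriv_inside 0 1 W2 W3.
Proof.
  apply (deriv_inside_plus 0 1 (fun x => K2 x * U1 x + K1 x * U2 x) _ (fun x => K1 x * U2 x + K0 x * U3 x)).
  - apply (deriv_inside_plus 0 1 (fun x => K2 x * U1 x) _ (fun x => K1 x * U2 x)); now apply deriv_inside_mult.
  - apply (deriv_inside_plus 0 1 (fun x => K1 x * U2 x) _ (fun x => K0 x * U3 x)); now apply deriv_inside_mult.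
Qed.

Lemma flux_deriv_bound x : seg 0 1 x -> Rabs (W1 x) <= 2 * M ^ 2.
Proof.
  intros Hx. destruct (HK x Hx) as [k0 [k1 [k2 k3]]]; destruct (HU x Hx) as [u1 [u2 [u3 u4]]]. unfold W1.
  assert (H1 := Rabs_prod_le _ _ k1 u1). assert (H2 := Rabs_prod_le _ _ k0 u2).
  apply Rabs_le_between in H1, H2. apply Rabs_le. lra.
Qed.

Lemma flux_deriv2_bound x : seg 0 1 x -> Rabs (W2 x) <= 4 * M ^ 2.
Proof.
  intros Hx. destruct (HK x Hx) as [k0 [k1 [k2 k3]]]; destruct (HU x Hx) as [u1 [u2 [u3 u4]]]. unfold W2.
  assert (H1 := Rabs_prod_le _ _ k2 u1). assert (H2 := Rabs_prod_le _ _ k1 u2).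
  assert (H3 := Rabs_prod_le _ _ k0 u3).
  apply Rabs_le_between in H1, H2, H3. apply Rabs_le. lra.
Qed.

Lemma flux_deriv3_bound x : seg 0 1 x -> Rabs (W3 x) <= 8 * M ^ 2.
Proof.
  intros Hx. destruct (HK x Hx) as [k0 [k1 [k2 k3]]]; destruct (HU x Hx) as [u1 [u2 [u3 u4]]]. unfold W3.
  assert (H1 := Rabs_prod_le _ _ k3 u1). assert (H2 := Rabs_prod_le _ _ k2 u2).
  assert (H3 := Rabs_prod_le _ _ k1 u3). assert (H4 := Rabs_prod_le _ _ k0 u4).
  apply Rabs_le_between in H1, H2, H3, H4. apply Rabs_le. lra.
Qed.

Lemma central_difference (B : R) (g0 g1 g2 g3 : R -> R) (x : R) :
  deriv_inside 0 1 g0 g1 -> deriv_inside 0 1 g1 g2 -> deriv_inside 0 1 g2 g3 ->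
  (forall z, seg 0 1 z -> Rabs (g3 z) <= B) ->
  h / 2 <= x <= 1 - h / 2 ->
  Rabs (g0 (x + h / 2) - g0 (x - h / 2) - h * g1 x) <= B * h ^ 3 / 4.
Proof.
  intros D0 D1 D2 HB Hx. assert (Sx : seg 0 1 x) by (unfold seg; lra).
  assert (H1 := taylor3 0 1 B g0 g1 g2 g3 D0 D1 D2 HB x (x + h / 2) Sx ltac:(unfold seg; lra)).
  assert (H2 := taylor3 0 1 B g0 g1 g2 g3 D0 D1 D2 HB x (x - h / 2) Sx ltac:(unfold seg; lra)).
  replace (Rabs (x + h / 2 - x)) with (h / 2) in H1 by (rewrite Rabs_pos_eq; lra).
  replace (Rabs (x - h / 2 - x)) with (h / 2) in H2
    by (replace (x - h / 2 - x) with (- (h / 2)) by ring; rewrite Rabs_Ropp, Rabs_pos_eq; lra).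
  apply Rabs_le_between in H1, H2. apply Rabs_le.
  replace (B * h ^ 3 / 4) with (2 * (B * (h / 2) ^ 3)) by field.
  replace ((x + h / 2 - x) ^ 2) with (h ^ 2 / 4) in H1 by field.
  replace ((x - h / 2 - x) ^ 2) with (h ^ 2 / 4) in H2 by field.
  lra.
Qed.

Lemma half_point_defect x : h / 2 <= x <= 1 - h / 2 ->
  Rabs ((U0 (x + h / 2) - U0 (x - h / 2)) / h - U1 x) <= M * h ^ 2 / 4.
Proof.
  intros Hx.
  assert (H := central_difference M U0 U1 U2 U3 x DU0 DU1 DU2 (fun z Hz => proj1 (proj2 (proj2 (HU z Hz)))) Hx).
  replace ((U0 (x + h / 2) - U0 (x - h / 2)) / h - U1 x)
    with ((U0 (x + h / 2) - U0 (x - h / 2) - h * U1 x) / h) by (field; lra).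
  unfold Rdiv at 1. rewrite Rabs_mult, (Rabs_pos_eq (/ h)) by (left; now apply Rinv_0_lt_compat).
  apply Rmult_le_reg_r with h; [lra | ]. rewrite Rmult_assoc, Rinv_l, Rmult_1_r by lra. lra.
Qed.

Lemma half_point_flux x : h / 2 <= x <= 1 - h / 2 -> Rabs (quot x - W x) <= M ^ 2 * h ^ 2.
Proof.
  intros Hx. unfold quot, W. rewrite <- Rmult_minus_distr_l, Rabs_mult.
  assert (H1 := half_point_defect x Hx). assert (H2 := proj1 (HK x ltac:(unfold seg; lra))).
  apply Rle_trans with (M * (M * h ^ 2 / 4)).
  - apply Rmult_le_compat; auto; apply Rabs_pos.
  - assert (0 <= M ^ 2 * h ^ 2) by (apply Rmult_le_pos; apply pow2_ge_0). lra.
Qed.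

Lemma half_point_quotient_bound x : h / 2 <= x <= 1 - h / 2 -> Rabs (quot x) <= M ^ 2.
Proof.
  intros Hx. unfold quot. apply Rabs_prod_le; [apply HK; unfold seg; lra | ].
  assert (H := mean_value_bound 0 1 M U0 U1 DU0 (fun z Hz => proj1 (HU z Hz)) (x - h / 2) (x + h / 2)
    ltac:(unfold seg; lra) ltac:(unfold seg; lra)).
  replace (x + h / 2 - (x - h / 2)) with h in H by field. rewrite (Rabs_pos_eq h) in H by lra.
  unfold Rdiv at 1. rewrite Rabs_mult, (Rabs_pos_eq (/ h)) by (left; now apply Rinv_0_lt_compat).
  apply Rmult_le_reg_r with h; [lra | ]. rewrite Rmult_assoc, Rinv_l, Rmult_1_r by lra. lra.
Qed.

(** The flux defect at a half point is of order h^2, so dividing a difference of two such defects by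
    h would leave only first order. The defects nearly agree, however: their difference is of order
    h^3, which costs a fourth derivative of [U0]. *)
Lemma flux_divergence_truncation x : h <= x <= 1 - h ->
  Rabs ((quot (x + h / 2) - quot (x - h / 2)) / h - W1 x) <= 6 * M ^ 2 * h ^ 2.
Proof.
  intros Hx. assert (Sx : seg 0 1 x) by (unfold seg; lra). assert (HM := coefficient_bound_nonneg).
  set (r := fun y => (U0 (y + h / 2) - U0 (y - h / 2)) / h - U1 y).
  assert (HW := central_difference (8 * M ^ 2) W W1 W2 W3 x flux_deriv flux_deriv2 flux_deriv3 flux_deriv3_bound ltac:(lra)).
  assert (Hr := half_point_defect (x + h / 2) ltac:(lra)). fold (r (x + h / 2)) in Hr.
  assert (HdU := central_difference M U1 U2 U3 U4 x DU1 DU2 DU3 (fun z Hz => proj2 (proj2 (proj2 (HU z Hz)))) ltac:(lra)).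
  assert (H1 := taylor4 0 1 M U0 U1 U2 U3 U4 DU0 DU1 DU2 DU3 (fun z Hz => proj2 (proj2 (proj2 (HU z Hz))))
    x (x + h) Sx ltac:(unfold seg; lra)).
  assert (H2 := taylor4 0 1 M U0 U1 U2 U3 U4 DU0 DU1 DU2 DU3 (fun z Hz => proj2 (proj2 (proj2 (HU z Hz))))
    x (x - h) Sx ltac:(unfold seg; lra)).
  assert (HdK := mean_value_bound 0 1 M K0 K1 DK0 (fun z Hz => proj1 (proj2 (HK z Hz))) (x - h / 2) (x + h / 2)
    ltac:(unfold seg; lra) ltac:(unfold seg; lra)).
  replace (x + h / 2 - (x - h / 2)) with h in HdK by field. rewrite (Rabs_pos_eq h) in HdK by lra.
  replace (x + h - x) with h in H1 by ring. replace (x - h - x) with (- h) in H2 by ring.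
  rewrite Rabs_Ropp in H2. rewrite (Rabs_pos_eq h) in H1, H2 by lra.
  assert (HrD : Rabs (r (x + h / 2) - r (x - h / 2)) <= 3 * M * h ^ 3).
  (* Both parts of the right side have the leading term h^2 U2(x), with errors of order h^4. *)
  { assert (E : h * (r (x + h / 2) - r (x - h / 2)) =
      (U0 (x + h) - 2 * U0 x + U0 (x - h)) - h * (U1 (x + h / 2) - U1 (x - h / 2))).
    { unfold r. replace (x + h / 2 + h / 2) with (x + h) by field.
      replace (x + h / 2 - h / 2) with x by ring. replace (x - h / 2 + h / 2) with x by ring.
      replace (x - h / 2 - h / 2) with (x - h) by field. field; lra. }
    assert (HhU := Rmult_le_compat_l h _ _ ltac:(lra) HdU).
    rewrite <- (Rabs_pos_eq h) in HhU at 1 by lra. rewrite <- Rabs_mult in HhU.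
    apply Rmult_le_reg_l with h; [lra | ]. rewrite <- (Rabs_pos_eq h) at 1 by lra.
    rewrite <- Rabs_mult, E.
    assert (0 <= M * h ^ 4) by (apply Rmult_le_pos; [auto | apply pow_le; lra]).
    apply Rabs_le_between in H1, H2, HhU. apply Rabs_le.
    replace (h * (3 * M * h ^ 3)) with (3 * (M * h ^ 4)) by ring.
    replace (h * (M * h ^ 3 / 4)) with (M * h ^ 4 / 4) in HhU by field.
    lra. }
  assert (HK0 := proj1 (HK (x - h / 2) ltac:(unfold seg; lra))).
  assert (P1 : Rabs ((K0 (x + h / 2) - K0 (x - h / 2)) * r (x + h / 2)) <= M * h * (M * h ^ 2 / 4)).
  { rewrite Rabs_mult. apply Rmult_le_compat; auto; apply Rabs_pos. }
  assert (P2 : Rabs (K0 (x - h / 2) * (r (x + h / 2) - r (x - h / 2))) <= M * (3 * M * h ^ 3)).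
  { rewrite Rabs_mult. apply Rmult_le_compat; auto; apply Rabs_pos. }
  replace ((quot (x + h / 2) - quot (x - h / 2)) / h - W1 x) with
    ((W (x + h / 2) - W (x - h / 2) - h * W1 x + (K0 (x + h / 2) - K0 (x - h / 2)) * r (x + h / 2)
      + K0 (x - h / 2) * (r (x + h / 2) - r (x - h / 2))) / h)
    by (unfold quot, W, r; field; lra).
  unfold Rdiv at 1. rewrite Rabs_mult, (Rabs_pos_eq (/ h)) by (left; now apply Rinv_0_lt_compat).
  apply Rmult_le_reg_r with h; [lra | ]. rewrite Rmult_assoc, Rinv_l, Rmult_1_r by lra.
  assert (0 <= M ^ 2 * h ^ 3) by (apply Rmult_le_pos; [apply pow2_ge_0 | apply pow_le; lra]).
  apply Rabs_le_between in HW, P1, P2. apply Rabs_le.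
  replace (6 * M ^ 2 * h ^ 2 * h) with (6 * (M ^ 2 * h ^ 3)) by ring.
  replace (8 * M ^ 2 * h ^ 3 / 4) with (2 * (M ^ 2 * h ^ 3)) in HW by field.
  replace (M * h * (M * h ^ 2 / 4)) with (M ^ 2 * h ^ 3 / 4) in P1 by field.
  replace (M * (3 * M * h ^ 3)) with (3 * (M ^ 2 * h ^ 3)) in P2 by ring.
  lra.
Qed.
End SpaceTruncation.

(** * Consistency and convergence *)

Lemma deriv_inside_ext (a b : R) (f f' g g' : R -> R) :
  (forall z, f z = g z) -> (forall z, f' z = g' z) ->
  deriv_inside a b f f' -> deriv_inside a b g g'.
Proof.
  intros H H' [Hd Hc]. split.
  - intros z Hz. rewrite <- H'. apply is_derive_ext with f; auto.
  - apply continuous_on_ext with (2 := Hc). auto.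
Qed.

(** Carries the consistency of the time discretisation to x = 0 and x = 1. *)
Lemma continuous_on_bound_ends (a b c : R) (g : R -> R) :
  a < b -> continuous_on (seg a b) g -> (forall x, a < x < b -> Rabs (g x) <= c) ->
  forall x, seg a b x -> Rabs (g x) <= c.
Proof.
  intros Hab Hg Hin x Hx. apply le_epsilon. intros eps He.
  destruct (Hg x Hx _ (locally_ball _ (mkposreal eps He))) as [d Hd].
  assert (Hdp := cond_pos d).
  assert (H : exists y, a < y < b /\ Rabs (y - x) < d).
  { unfold seg in Hx. destruct (Rle_dec x ((a + b) / 2)).
    - assert (0 < Rmin (d / 2) ((b - a) / 4)) by (apply Rmin_pos; lra).
      exists (x + Rmin (d / 2) ((b - a) / 4)).
      generalize (Rmin_l (d / 2) ((b - a) / 4)) (Rmin_r (d / 2) ((b - a) / 4)). intros H1 H2.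
      split; [lra | ]. apply Rabs_def1; lra.
    - assert (0 < Rmin (d / 2) ((b - a) / 4)) by (apply Rmin_pos; lra).
      exists (x - Rmin (d / 2) ((b - a) / 4)).
      generalize (Rmin_l (d / 2) ((b - a) / 4)) (Rmin_r (d / 2) ((b - a) / 4)). intros H1 H2.
      split; [lra | ]. apply Rabs_def1; lra. }
  destruct H as [y [Hy1 Hy2]].
  assert (H1 : Rabs (g y - g x) < eps) by (apply (Hd y Hy2); split; lra).
  specialize (Hin y Hy1). replace (g x) with (g y - (g y - g x)) by ring.
  apply Rle_trans with (1 := Rabs_triang _ _). rewrite Rabs_Ropp. lra.
Qed.

Lemma continuous_on_sum (D : R -> Prop) (F : nat -> R -> R) (n : nat) :
  (forall i, (i <= n)%nat -> continuous_on D (F i)) ->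
  continuous_on D (fun x => sum_f_R0 (fun i => F i x) n).
Proof.
  induction n as [|n IH]; intros H; simpl.
  - now apply H.
  - apply (continuous_on_add D (fun x => sum_f_R0 (fun i => F i x) n) (F (S n))); auto.
Qed.

Lemma continuous_on_minus (D : R -> Prop) (g f : R -> R) :
  continuous_on D g -> continuous_on D f -> continuous_on D (fun z => g z - f z).
Proof.
  intros Hg Hf. apply (continuous_on_ext D (fun z => g z + -1 * f z)).
  - intros x _. change (g x + -1 * f x = g x - f x). ring.
  - apply continuous_on_add; [auto | now apply continuous_on_scal_l].
Qed.

Lemma caputo_h_minus (nu sg tau : R) (v w : nat -> R) (n : nat) :
  caputo_h nu sg tau (fun s => v s - w s) n = caputo_h nu sg tau v n - caputo_h nu sg tau w n.
Proof.
  unfold caputo_h. rewrite <- Rmult_minus_distr_l, <- minus_sum. f_equal.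
  apply sum_eq. intros; unfold Rdiv; ring.
Qed.

Section Consistency.
Variables (nu T alpha beta gamma M : R) (k f u : R -> R -> R) (mu u0 : R -> R) (N NT n : nat).
Hypotheses (Hnu : 0 < nu < 1) (HT : 0 < T).
Hypotheses (Hk : smooth 3 0 T k) (Hf : smooth 0 0 T f) (Hu : smooth 4 3 T u).
Hypothesis Hsol : solves_problem nu T alpha beta gamma k f mu u0 u.
Hypothesis HkM : forall i j x t, (i <= 3)%nat -> (j <= 0)%nat -> rect T x t -> Rabs (partial T i j k x t) <= M.
Hypothesis HuM : forall i j x t, (i <= 4)%nat -> (j <= 3)%nat -> rect T x t -> Rabs (partial T i j u x t) <= M.
Hypotheses (HN : (2 <= N)%nat) (Hn : (n < NT)%nat).

Let sg := 1 - nu / 2.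
Let h := 1 / INR N.
Let tau := T / INR NT.
Let t := tsig sg tau n.
Let tn := tgrid tau n.
Let ug (s i : nat) : R := u (xgrid h i) (tgrid tau s).
Let a (i : nat) : R := k (xgrid h i - / 2 * h) t.
Let K i x := partial T i 0 k x t.
Let U i x := partial T i 0 u x t.
Let W x := K 0%nat x * U 1%nat x.
Let W1 x := K 1%nat x * U 1%nat x + K 0%nat x * U 2%nat x.
(** The coefficient is frozen at t_(n+sigma), as in the scheme, and only u moves with s. Hence the
    time derivative of [Fl j] is [Fl (S j)], and likewise for [Div]. *)
Let Fl j x s := K 0%nat x * ((partial T 0 j u (x + h / 2) s - partial T 0 j u (x - h / 2) s) / h).
Let Div j x s := (Fl j (x + h / 2) s - Fl j (x - h / 2) s) / h.
Let Cc := 8 * Rpower T (1 - nu) / ((1 - nu) * Gamma (1 - nu)) * M.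

Lemma space_step_bounds : 0 < h <= / 2.
Proof.
  assert (H : 2 <= INR N) by (change 2 with (INR 2); now apply le_INR).
  unfold h. split; [apply Rdiv_lt_0_compat; lra | ].
  unfold Rdiv. rewrite Rmult_1_l. apply Rinv_le_contravar; lra.
Qed.

Lemma time_step_facts : 0 < tau /\ 0 <= tn /\ tn + tau <= T /\ tn < t < tn + tau.
Proof.
  assert (H1 := tsig_bounds nu T NT n Hnu HT Hn). assert (H2 := tgrid_nonneg T NT n HT Hn n).
  assert (H3 := tgrid_le_T T NT n HT Hn (S n) Hn).
  rewrite tgrid_succ in H1, H3. fold sg tau t tn in H1. fold tau tn in H2, H3.
  assert (H4 := time_step_pos T NT n HT Hn). fold tau in H4. auto.
Qed.

Lemma tsig_range : 0 <= t <= T.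
Proof. generalize time_step_facts. lra. Qed.

Lemma K_deriv i : (i < 3)%nat -> deriv_inside 0 1 (K i) (K (S i)).
Proof. intros Hi. apply (smooth_x 3 0 T k Hk i 0 t Hi (le_n _) tsig_range). Qed.

Lemma U_deriv i j s : (i < 4)%nat -> (j <= 3)%nat -> 0 <= s <= T ->
  deriv_inside 0 1 (fun x => partial T i j u x s) (fun x => partial T (S i) j u x s).
Proof. intros Hi Hj Hs. apply (smooth_x 4 3 T u Hu i j s Hi Hj Hs). Qed.

Lemma K_bounds x : seg 0 1 x ->
  Rabs (K 0 x) <= M /\ Rabs (K 1 x) <= M /\ Rabs (K 2 x) <= M /\ Rabs (K 3 x) <= M.
Proof. intros Hx. repeat split; apply HkM; auto; split; auto; apply tsig_range. Qed.

Lemma U_bounds j s x : (j <= 3)%nat -> 0 <= s <= T -> seg 0 1 x ->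
  Rabs (partial T 1 j u x s) <= M /\ Rabs (partial T 2 j u x s) <= M /\
  Rabs (partial T 3 j u x s) <= M /\ Rabs (partial T 4 j u x s) <= M.
Proof. intros Hj Hs Hx. repeat split; apply HuM; auto; try lia; split; auto. Qed.

Lemma half_flux_bound j x s : (j <= 3)%nat -> 0 <= s <= T -> h / 2 <= x <= 1 - h / 2 -> Rabs (Fl j x s) <= M ^ 2.
Proof.
  intros Hj Hs Hx.
  apply (half_point_quotient_bound M h (K 0) (K 1) (K 2) (K 3)
    (fun x => partial T 0 j u x s) (fun x => partial T 1 j u x s) (fun x => partial T 2 j u x s)
    (fun x => partial T 3 j u x s) (fun x => partial T 4 j u x s)
    (U_deriv 0 j s ltac:(lia) Hj Hs)
    K_bounds (fun x Hx => U_bounds j s x Hj Hs Hx) (proj1 space_step_bounds) x Hx).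
Qed.

Lemma half_flux_truncation x : h / 2 <= x <= 1 - h / 2 -> Rabs (Fl 0 x t - W x) <= M ^ 2 * h ^ 2.
Proof.
  intros Hx. assert (Ht := tsig_range).
  apply (half_point_flux M h (K 0) (K 1) (K 2) (K 3) (U 0) (U 1) (U 2) (U 3) (U 4)
    (U_deriv 0 0 t ltac:(lia) ltac:(lia) Ht) (U_deriv 1 0 t ltac:(lia) ltac:(lia) Ht)
    (U_deriv 2 0 t ltac:(lia) ltac:(lia) Ht)
    K_bounds (fun x Hx => U_bounds 0 t x ltac:(lia) Ht Hx) (proj1 space_step_bounds) x Hx).
Qed.

Lemma divergence_truncation j s x : (j <= 3)%nat -> 0 <= s <= T -> h <= x <= 1 - h ->
  Rabs (Div j x s - (K 1 x * partial T 1 j u x s + K 0 x * partial T 2 j u x s)) <= 6 * M ^ 2 * h ^ 2.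
Proof.
  intros Hj Hs Hx.
  apply (flux_divergence_truncation M h (K 0) (K 1) (K 2) (K 3)
    (fun x => partial T 0 j u x s) (fun x => partial T 1 j u x s) (fun x => partial T 2 j u x s)
    (fun x => partial T 3 j u x s) (fun x => partial T 4 j u x s)
    (K_deriv 0 ltac:(lia)) (K_deriv 1 ltac:(lia)) (K_deriv 2 ltac:(lia))
    (U_deriv 0 j s ltac:(lia) Hj Hs) (U_deriv 1 j s ltac:(lia) Hj Hs)
    (U_deriv 2 j s ltac:(lia) Hj Hs) (U_deriv 3 j s ltac:(lia) Hj Hs)
    K_bounds (fun x Hx => U_bounds j s x Hj Hs Hx) (proj1 space_step_bounds) x Hx).
Qed.

(** Uniform in h despite the two divisions by h, by comparison with the exact divergence. For j = 2
    it bounds the second time derivative of [Div 0], which makes averaging the two time levels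
    second order in tau. *)
Lemma divergence_bound j s x : (j <= 3)%nat -> 0 <= s <= T -> h <= x <= 1 - h -> Rabs (Div j x s) <= 8 * M ^ 2.
Proof.
  intros Hj Hs Hx. assert (H := divergence_truncation j s x Hj Hs Hx). assert (Hh := space_step_bounds).
  assert (Sx : seg 0 1 x) by (unfold seg; lra).
  assert (H' := flux_deriv_bound M (K 0) (K 1) (K 2) (K 3) (fun x => partial T 1 j u x s)
    (fun x => partial T 2 j u x s) (fun x => partial T 3 j u x s) (fun x => partial T 4 j u x s)
    K_bounds (fun x Hx => U_bounds j s x Hj Hs Hx) x Sx). cbv beta in H'.
  assert (Hh2 : h ^ 2 <= 1) by (simpl; nra).
  assert (6 * M ^ 2 * h ^ 2 <= 6 * M ^ 2 * 1).
  { apply Rmult_le_compat_l; [ | auto]. generalize (pow2_ge_0 M); lra. }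
  apply Rabs_le_between in H, H'. apply Rabs_le. lra.
Qed.

Lemma half_flux_deriv_t j x : (j < 3)%nat -> h / 2 <= x <= 1 - h / 2 -> deriv_inside 0 T (Fl j x) (Fl (S j) x).
Proof.
  intros Hj Hx. assert (Hh := space_step_bounds).
  apply deriv_inside_ext with
    (fun s => K 0 x / h * partial T 0 j u (x + h / 2) s + - (K 0 x / h) * partial T 0 j u (x - h / 2) s
              + 0 * partial T 0 j u (x - h / 2) s)
    (fun s => K 0 x / h * partial T 0 (S j) u (x + h / 2) s + - (K 0 x / h) * partial T 0 (S j) u (x - h / 2) s
              + 0 * partial T 0 (S j) u (x - h / 2) s).
  - intros; unfold Fl; field; lra.
  - intros; unfold Fl; field; lra.
  - apply (deriv_inside_comb3 0 T (K 0 x / h) (- (K 0 x / h)) 0 (partial T 0 j u (x + h / 2)) _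
      (partial T 0 j u (x - h / 2)) _ (partial T 0 j u (x - h / 2)) _);
      apply (smooth_t 4 3 T u Hu); auto; lra.
Qed.

Lemma divergence_deriv_t j x : (j < 3)%nat -> h <= x <= 1 - h -> deriv_inside 0 T (Div j x) (Div (S j) x).
Proof.
  intros Hj Hx. assert (Hh := space_step_bounds).
  apply deriv_inside_ext with
    (fun s => / h * Fl j (x + h / 2) s + - / h * Fl j (x - h / 2) s + 0 * Fl j (x - h / 2) s)
    (fun s => / h * Fl (S j) (x + h / 2) s + - / h * Fl (S j) (x - h / 2) s + 0 * Fl (S j) (x - h / 2) s).
  - intros; unfold Div; field; lra.
  - intros; unfold Div; field; lra.
  - apply (deriv_inside_comb3 0 T (/ h) (- / h) 0 (Fl j (x + h / 2)) _ (Fl j (x - h / 2)) _ (Fl j (x - h / 2)) _);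
      apply half_flux_deriv_t; auto; lra.
Qed.

Lemma half_flux_level x : h / 2 <= x <= 1 - h / 2 ->
  Rabs (sg * Fl 0 x (tn + tau) + (1 - sg) * Fl 0 x tn - Fl 0 x t) <= M ^ 2 * tau ^ 2.
Proof.
  intros Hx. destruct time_step_facts as [H1 [H2 [H3 H4]]].
  apply (level_interpolation T sg tau (M ^ 2) tn (Fl 0 x) (Fl 1 x) (Fl 2 x)); auto.
  - apply half_flux_deriv_t; auto; lia.
  - apply half_flux_deriv_t; auto; lia.
  - intros s Hs. apply half_flux_bound; auto; lia.
  - unfold sg; lra.
Qed.

Lemma divergence_level x : h <= x <= 1 - h ->
  Rabs (sg * Div 0 x (tn + tau) + (1 - sg) * Div 0 x tn - Div 0 x t) <= 8 * M ^ 2 * tau ^ 2.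
Proof.
  intros Hx. destruct time_step_facts as [H1 [H2 [H3 H4]]].
  apply (level_interpolation T sg tau (8 * M ^ 2) tn (Div 0 x) (Div 1 x) (Div 2 x)); auto.
  - apply divergence_deriv_t; auto; lia.
  - apply divergence_deriv_t; auto; lia.
  - intros s Hs. apply divergence_bound; auto; lia.
  - unfold sg; lra.
Qed.

Lemma u_level x : 0 <= x <= 1 ->
  Rabs (sg * u x (tn + tau) + (1 - sg) * u x tn - u x t) <= M * tau ^ 2.
Proof.
  intros Hx. destruct time_step_facts as [H1 [H2 [H3 H4]]].
  apply (level_interpolation T sg tau M tn (partial T 0 0 u x) (partial T 0 1 u x) (partial T 0 2 u x)); auto.
  - apply (smooth_t 4 3 T u Hu); auto; lia.
  - apply (smooth_t 4 3 T u Hu); auto; lia.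
  - intros s Hs. apply HuM; try lia. now split.
  - unfold sg; lra.
Qed.

(** Inside, the truncation estimate is combined with the differential equation. Both sides of the
    comparison are continuous in x, so the bound persists at the two ends. *)
Lemma caputo_h_pde x : 0 <= x <= 1 ->
  Rabs (caputo_h nu sg tau (fun s => u x (tgrid tau s)) n - (W1 x + f x t)) <= Cc * tau ^ 2.
Proof.
  destruct time_step_facts as [H1 [H2 [H3 H4]]].
  apply (continuous_on_bound_ends 0 1 (Cc * tau ^ 2)
    (fun x => caputo_h nu sg tau (fun s => u x (tgrid tau s)) n - (W1 x + f x t)) Rlt_0_1).
  - apply continuous_on_minus.
    + unfold caputo_h. apply continuous_on_scal_l.
      apply (continuous_on_sum (seg 0 1) (fun s x => ccoef nu sg n (n - s) * ((u x (tgrid tau (S s)) - u x (tgrid tau s)) / tau))).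
      intros s Hs. apply continuous_on_scal_l.
      assert (Hc : forall r, (r <= NT)%nat -> continuous_on (seg 0 1) (fun x => u x (tgrid tau r))).
      { intros r Hr. apply (continuous_on_rect_x T (tgrid tau r) u).
        - apply (smooth_continuous 4 3 T u Hu 0 0); lia.
        - split; [apply (tgrid_nonneg T NT n HT Hn) | apply (tgrid_le_T T NT n HT Hn); auto]. }
      apply (continuous_on_ext (seg 0 1) (fun x => / tau * (u x (tgrid tau (S s)) - u x (tgrid tau s)))).
      { intros z _. apply Rmult_comm. }
      apply continuous_on_scal_l, continuous_on_minus; apply Hc; lia.
    + apply continuous_on_add.
      * apply (flux_deriv2 (K 0) (K 1) (K 2) (U 1) (U 2) (U 3)
          (K_deriv 0 ltac:(lia)) (K_deriv 1 ltac:(lia))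
          (U_deriv 1 0 t ltac:(lia) ltac:(lia) tsig_range) (U_deriv 2 0 t ltac:(lia) ltac:(lia) tsig_range)).
      * apply (continuous_on_rect_x T t f); [ | apply tsig_range].
        apply (smooth_continuous 0 0 T f Hf 0 0); lia.
  - intros z Hz.
    replace (W1 z + f z t) with (caputo nu (u z) t).
    + apply (caputo_truncation nu T M (partial T 0 0 u z) (partial T 0 1 u z) (partial T 0 2 u z)
        (partial T 0 3 u z) NT n); auto; try (apply (smooth_t 4 3 T u Hu); [lia | lra]).
      intros s Hs. apply HuM; try lia. split; [lra | auto].
    + rewrite (problem_eq _ _ _ _ _ _ _ _ _ _ Hsol z t Hz) by lra. f_equal.
      apply Derive_on_inside; auto.
      apply (flux_deriv (K 0) (K 1) (U 1) (U 2) (K_deriv 0 ltac:(lia))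
          (U_deriv 1 0 t ltac:(lia) ltac:(lia) tsig_range)); auto.
Qed.

Lemma xgrid_last : xgrid h N = 1.
Proof. clear - HN. unfold xgrid, h. field. apply not_0_INR; lia. Qed.

Lemma half_flux_eq i : (1 <= i)%nat ->
  a i * diff_back h (level sg ug n) i
  = sg * Fl 0 (xgrid h i - / 2 * h) (tn + tau) + (1 - sg) * Fl 0 (xgrid h i - / 2 * h) tn.
Proof.
  intros Hi. assert (Hh := space_step_bounds). unfold diff_back, level, ug, Fl, a, K.
  replace (tgrid tau (S n)) with (tn + tau) by (unfold tn, tgrid; rewrite S_INR; ring).
  fold tn. replace (xgrid h (i - 1)) with (xgrid h i - h)
    by (unfold xgrid; rewrite minus_INR by auto; simpl; ring).
  replace (xgrid h i - / 2 * h + h / 2) with (xgrid h i) by field.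
  replace (xgrid h i - / 2 * h - h / 2) with (xgrid h i - h) by field.
  simpl partial. field. lra.
Qed.

Lemma interior_truncation i : (1 <= i <= N - 1)%nat ->
  Rabs (caputo_h nu sg tau (fun s => ug s i) n
        - diff_fwd h (fun j => a j * diff_back h (level sg ug n) j) i - f (xgrid h i) t)
  <= Cc * tau ^ 2 + 8 * M ^ 2 * tau ^ 2 + 6 * M ^ 2 * h ^ 2.
Proof.
  intros Hi. assert (Hh := space_step_bounds). set (x := xgrid h i).
  assert (Hx : h <= x <= 1 - h).
  { unfold x. rewrite <- xgrid_last. unfold xgrid.
    assert (1 <= INR i) by (change 1 with (INR 1); apply le_INR; lia).
    assert (INR i + 1 <= INR N) by (rewrite <- S_INR; apply le_INR; lia). nra. }
  assert (E : diff_fwd h (fun j => a j * diff_back h (level sg ug n) j) i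
     = sg * Div 0 x (tn + tau) + (1 - sg) * Div 0 x tn).
  { unfold diff_fwd. rewrite !half_flux_eq by lia. unfold Div.
    replace (xgrid h (S i) - / 2 * h) with (x + h / 2) by (unfold x, xgrid; rewrite S_INR; field).
    replace (xgrid h i - / 2 * h) with (x - h / 2) by (unfold x; field). field. lra. }
  rewrite E.
  assert (H1 := caputo_h_pde x ltac:(lra)). assert (H2 := divergence_level x Hx).
  assert (H3 := divergence_truncation 0 t x ltac:(lia) tsig_range Hx).
  change (K 1 x * partial T 1 0 u x t + K 0 x * partial T 2 0 u x t) with (W1 x) in H3.
  change (fun s => ug s i) with (fun s => u x (tgrid tau s)).
  apply Rabs_le_between in H1, H2, H3. apply Rabs_le. lra.
Qed.

(** Expansion of the half-point flux about the end point [x]. The first-order term is retained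
    because the boundary equation cancels it. *)
Lemma flux_end_truncation x y : seg 0 1 x -> h / 2 <= y <= 1 - h / 2 -> Rabs (y - x) = h / 2 ->
  Rabs (sg * Fl 0 y (tn + tau) + (1 - sg) * Fl 0 y tn - (W x + W1 x * (y - x)))
  <= M ^ 2 * tau ^ 2 + 2 * M ^ 2 * h ^ 2.
Proof.
  intros Hx Hy Hxy. assert (Hh := space_step_bounds).
  assert (H1 := half_flux_level y Hy). assert (H2 := half_flux_truncation y Hy).
  assert (Ht := tsig_range).
  assert (HU : forall x, seg 0 1 x -> Rabs (U 1 x) <= M /\ Rabs (U 2 x) <= M /\ Rabs (U 3 x) <= M /\ Rabs (U 4 x) <= M)
    by (intros; apply U_bounds; auto; lia).
  assert (H3 := taylor2 0 1 (4 * M ^ 2) _ _ _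
    (flux_deriv (K 0) (K 1) (U 1) (U 2) (K_deriv 0 ltac:(lia)) (U_deriv 1 0 t ltac:(lia) ltac:(lia) Ht))
    (flux_deriv2 (K 0) (K 1) (K 2) (U 1) (U 2) (U 3) (K_deriv 0 ltac:(lia)) (K_deriv 1 ltac:(lia))
      (U_deriv 1 0 t ltac:(lia) ltac:(lia) Ht) (U_deriv 2 0 t ltac:(lia) ltac:(lia) Ht))
    (flux_deriv2_bound M (K 0) (K 1) (K 2) (K 3) (U 1) (U 2) (U 3) (U 4) K_bounds HU) x y Hx
    ltac:(unfold seg; lra)).
  cbv beta in H3. rewrite Hxy in H3. fold (W x) (W y) (W1 x) in H3.
  apply Rabs_le_between in H1, H2, H3. apply Rabs_le. lra.
Qed.

Lemma boundary_truncation :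
  Rabs (h / 2 * (beta * caputo_h nu sg tau (fun s => ug s 0%nat) n + caputo_h nu sg tau (fun s => ug s N) n)
    + (a N * diff_back h (level sg ug n) N - beta * (a 1%nat * diff_fwd h (level sg ug n) 0)
       - gamma * level sg ug n N)
    - (mu t + h / 2 * (f (xgrid h N) t + beta * f (xgrid h 0) t)))
  <= (1 + Rabs beta) * (Cc * tau ^ 2 + M ^ 2 * tau ^ 2 + 2 * M ^ 2 * h ^ 2) + Rabs gamma * M * tau ^ 2.
Proof.
  assert (Hh := space_step_bounds). assert (Ht := tsig_range).
  assert (X0 : xgrid h 0 = 0) by (unfold xgrid; simpl; ring).
  assert (L0 := caputo_h_pde 0 ltac:(lra)). assert (L1 := caputo_h_pde 1 ltac:(lra)).
  assert (F0 := flux_end_truncation 0 (h / 2) ltac:(unfold seg; lra) ltac:(lra)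
    ltac:(rewrite Rminus_0_r, Rabs_pos_eq; lra)).
  assert (F1 := flux_end_truncation 1 (1 - h / 2) ltac:(unfold seg; lra) ltac:(lra)
    ltac:(replace (1 - h / 2 - 1) with (- (h / 2)) by ring; rewrite Rabs_Ropp, Rabs_pos_eq; lra)).
  assert (V := u_level 1 ltac:(lra)).
  assert (Hbc : W 1 = beta * W 0 + gamma * u 1 t + mu t) by exact (problem_bc_flux _ _ _ _ _ _ _ _ _ _ Hsol t Ht).
  change (diff_fwd h (level sg ug n) 0) with (diff_back h (level sg ug n) 1).
  rewrite !half_flux_eq by lia.
  replace (xgrid h 1 - / 2 * h) with (h / 2) by (unfold xgrid; simpl; field).
  rewrite xgrid_last. replace (1 - / 2 * h) with (1 - h / 2) by field.
  replace (level sg ug n N) with (sg * u 1 (tn + tau) + (1 - sg) * u 1 tn).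
  2: { unfold level, ug. rewrite xgrid_last.
       replace (tgrid tau (S n)) with (tn + tau) by (unfold tn, tgrid; rewrite S_INR; ring). reflexivity. }
  replace (caputo_h nu sg tau (fun s => ug s 0%nat) n) with (caputo_h nu sg tau (fun s => u 0 (tgrid tau s)) n)
    by (unfold ug; now rewrite X0).
  replace (caputo_h nu sg tau (fun s => ug s N) n) with (caputo_h nu sg tau (fun s => u 1 (tgrid tau s)) n)
    by (unfold ug; now rewrite xgrid_last).
  rewrite X0.
  set (l0 := caputo_h nu sg tau (fun s => u 0 (tgrid tau s)) n) in *.
  set (l1 := caputo_h nu sg tau (fun s => u 1 (tgrid tau s)) n) in *.
  set (A0 := sg * Fl 0 (h / 2) (tn + tau) + (1 - sg) * Fl 0 (h / 2) tn) in *.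
  set (A1 := sg * Fl 0 (1 - h / 2) (tn + tau) + (1 - sg) * Fl 0 (1 - h / 2) tn) in *.
  set (v := sg * u 1 (tn + tau) + (1 - sg) * u 1 tn) in *.
  (* The zeroth-order fluxes cancel by the exact flux condition. The terms h/2 [W1] cancel because
     the scheme adds h/2 times the discrete Caputo derivative minus f at each end, which
     approximates h/2 [W1]. *)
  replace (h / 2 * (beta * l0 + l1) + (A1 - beta * A0 - gamma * v) - (mu t + h / 2 * (f 1 t + beta * f 0 t)))
    with ((h / 2 * (l1 - (W1 1 + f 1 t)) + (A1 - (W 1 + W1 1 * (1 - h / 2 - 1))))
      + beta * (h / 2 * (l0 - (W1 0 + f 0 t)) - (A0 - (W 0 + W1 0 * (h / 2 - 0))))
      - gamma * (v - u 1 t)) by (rewrite Hbc; field).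
  set (B := Cc * tau ^ 2 + M ^ 2 * tau ^ 2 + 2 * M ^ 2 * h ^ 2).
  assert (HL : forall e, Rabs e <= Cc * tau ^ 2 -> Rabs (h / 2 * e) <= Cc * tau ^ 2).
  { intros e He. rewrite Rabs_mult, (Rabs_pos_eq (h / 2)) by lra.
    apply Rle_trans with (2 := He). assert (H := Rabs_pos e). nra. }
  assert (G1 : Rabs (h / 2 * (l1 - (W1 1 + f 1 t)) + (A1 - (W 1 + W1 1 * (1 - h / 2 - 1)))) <= B).
  { apply Rle_trans with (1 := Rabs_triang _ _). apply HL in L1. unfold B; lra. }
  assert (G0 : Rabs (beta * (h / 2 * (l0 - (W1 0 + f 0 t)) - (A0 - (W 0 + W1 0 * (h / 2 - 0))))) <= Rabs beta * B).
  { rewrite Rabs_mult. apply Rmult_le_compat_l; [apply Rabs_pos | ].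
    apply Rle_trans with (1 := Rabs_triang _ _). rewrite Rabs_Ropp. apply HL in L0. unfold B; lra. }
  assert (GV : Rabs (gamma * (v - u 1 t)) <= Rabs gamma * M * tau ^ 2).
  { rewrite Rabs_mult, Rmult_assoc. apply Rmult_le_compat_l; [apply Rabs_pos | auto]. }
  apply Rabs_le_between in G1, G0, GV. apply Rabs_le. lra.
Qed.
End Consistency.

Theorem theorem5 (nu T c1 c2 alpha beta gamma : R)
    (k f u : R -> R -> R) (mu u0 : R -> R)
    (Hnu : 0 < nu < 1) (HT : 0 < T)
    (Hk : smooth 3 0 T k) (Hf : smooth 0 0 T f)
    (Hc1 : 0 < c1)
    (Hkbound : forall x t, rect T x t -> c1 <= k x t <= c2)
    (Hksym : forall x t, rect T x t -> k x t = k (1 - x) t)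
    (Hmu : continuous_on (fun t => 0 <= t <= T) mu)
    (Hcase : (Rabs alpha < 1 /\ Rabs beta < 1 /\ gamma <= 0) \/
             (Rabs alpha > 1 /\ Rabs beta > 1 /\ alpha * beta * gamma <= 0))
    (Hu : smooth 4 3 T u)
    (Hsol : solves_problem nu T alpha beta gamma k f mu u0 u) :
  exists C : R, 0 < C /\
    forall (N NT : nat) (y : nat -> nat -> R),
      (2 <= N)%nat -> (1 <= NT)%nat ->
      solves_scheme nu T alpha beta gamma k f mu u0 N NT y ->
      forall n : nat, (n <= NT)%nat ->
        norm0 N (fun i => y n i - u (xgrid (1 / INR N) i) (tgrid (T / INR NT) n))
        <= C * ((T / INR NT) ^ 2 + (1 / INR N) ^ 2).
Proof.
  destruct (smooth_bounded 3 0 T k ltac:(lra) Hk) as [Mk HMk].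
  destruct (smooth_bounded 4 3 T u ltac:(lra) Hu) as [Mu HMu].
  set (M := Rmax Mk Mu).
  assert (HkM : forall i j x t, (i <= 3)%nat -> (j <= 0)%nat -> rect T x t -> Rabs (partial T i j k x t) <= M).
  { intros. apply Rle_trans with (2 := Rmax_l _ _). now apply HMk. }
  assert (HuM : forall i j x t, (i <= 4)%nat -> (j <= 3)%nat -> rect T x t -> Rabs (partial T i j u x t) <= M).
  { intros. apply Rle_trans with (2 := Rmax_r _ _). now apply HMu. }
  clear HMk HMu.
  assert (HM0 : 0 <= M).
  { apply Rle_trans with (2 := HuM 0%nat 0%nat 0 0 ltac:(lia) ltac:(lia) ltac:(split; lra)). apply Rabs_pos. }
  destruct (scheme_stability nu T alpha beta gamma c1 Hnu HT Hc1 Hcase) as [C0 [HC0 Hstab]].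
  set (Cc := 8 * Rpower T (1 - nu) / ((1 - nu) * Gamma (1 - nu)) * M).
  assert (HCc : 0 <= Cc).
  { destruct (Gamma_recurrence (1 - nu)) as [HG _]; [lra | ].
    apply Rmult_le_pos; [apply Rdiv_le_0_compat | auto].
    - apply Rmult_le_pos; [lra | left; apply Rpower_pos].
    - apply Rmult_lt_0_compat; lra. }
  (* Chosen to dominate both the interior and the boundary truncation bound. *)
  set (C1 := (1 + Rabs beta) * (Cc + 8 * M ^ 2) + Rabs gamma * M).
  assert (HC1 : 0 <= C1).
  { unfold C1. apply Rplus_le_le_0_compat; apply Rmult_le_pos; auto using Rabs_pos.
    - generalize (Rabs_pos beta); lra.
    - generalize (pow2_ge_0 M); lra. }
  (* The added 1 only secures strict positivity. *)
  exists (C0 * C1 + 1). assert (HC01 : 0 <= C0 * C1) by now apply Rmult_le_pos.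
  split; [lra | ].
  intros N NT y HN HNT [Heq Hval Hflux Hinit] n Hn.
  cbv zeta beta in Heq, Hflux.
  set (h := 1 / INR N) in *. set (tau := T / INR NT) in *. set (sg := 1 - nu / 2) in *.
  set (ug := fun s i => u (xgrid h i) (tgrid tau s)).
  set (z := fun s i => y s i - ug s i).
  set (a := fun m i => k (xgrid h i - / 2 * h) (tsig sg tau m)).
  assert (Hh : 0 < h <= / 2) by exact (space_step_bounds N HN).
  assert (Htn : forall m, (m < NT)%nat -> 0 <= tsig sg tau m <= T) by (intros m Hm; now apply tsig_range).
  assert (HxN : xgrid h N = 1) by exact (xgrid_last N HN).
  assert (Hlev : forall m i, level sg z m i = level sg y m i - level sg ug m i)
    by (intros; unfold level, z; ring).
  assert (Hcap : forall m i, caputo_h nu sg tau (fun s => z s i) m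
     = caputo_h nu sg tau (fun s => y s i) m - caputo_h nu sg tau (fun s => ug s i) m)
    by (intros; apply caputo_h_minus).
  assert (Hhalf : forall i, (1 <= i <= N)%nat -> 0 <= xgrid h i - / 2 * h <= 1).
  { intros i Hi. assert (H1 : 1 <= INR i) by (change 1 with (INR 1); apply le_INR; lia).
    assert (H2 : INR i <= INR N) by (apply le_INR; lia).
    rewrite <- HxN. unfold xgrid. nra. }
  assert (Hb1 : 0 <= Cc * tau ^ 2) by (apply Rmult_le_pos; [auto | apply pow2_ge_0]).
  assert (Hb2 : 0 <= M ^ 2 * tau ^ 2) by (apply Rmult_le_pos; apply pow2_ge_0).
  assert (Hb3 : 0 <= M ^ 2 * h ^ 2) by (apply Rmult_le_pos; apply pow2_ge_0).
  assert (Hb4 : 0 <= Cc * h ^ 2) by (apply Rmult_le_pos; [auto | apply pow2_ge_0]).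
  assert (Hb5 : 0 <= Rabs gamma * M * h ^ 2)
    by (apply Rmult_le_pos; [apply Rmult_le_pos; auto using Rabs_pos | apply pow2_ge_0]).
  assert (Hb6 : 0 <= Rabs gamma * M * tau ^ 2)
    by (apply Rmult_le_pos; [apply Rmult_le_pos; auto using Rabs_pos | apply pow2_ge_0]).
  assert (Hbeta := Rabs_pos beta).
  set (X := Cc * tau ^ 2 + 8 * M ^ 2 * tau ^ 2 + (Cc * h ^ 2 + 8 * M ^ 2 * h ^ 2)).
  assert (HX : C1 * (tau ^ 2 + h ^ 2) = (1 + Rabs beta) * X + Rabs gamma * M * tau ^ 2 + Rabs gamma * M * h ^ 2)
    by (unfold C1, X; ring).
  assert (HX0 : 0 <= X) by (unfold X; lra).
  assert (HbX : 0 <= Rabs beta * X) by (apply Rmult_le_pos; lra).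
  apply Rle_trans with (C0 * (C1 * (tau ^ 2 + h ^ 2))).
  2: { assert (0 <= tau ^ 2 + h ^ 2) by (generalize (pow2_ge_0 tau) (pow2_ge_0 h); lra). nra. }
  apply (Hstab N NT z a (C1 * (tau ^ 2 + h ^ 2)) HN HNT); auto.
  - intros m i Hm Hi. apply Hkbound. split; auto.
  (* The half point x_i - h/2 reflects to x_(N+1-i) - h/2, hence the index [S N - i]. *)
  - intros m i Hm Hi. unfold a. rewrite (Hksym (xgrid h i - / 2 * h)) by (split; auto).
    f_equal. rewrite <- HxN. unfold xgrid. rewrite minus_INR, S_INR by lia. field.
  - intros i Hi. unfold z, ug. rewrite Hinit by auto. fold h.
    replace (tgrid tau 0) with 0 by (unfold tgrid; simpl; ring).
    rewrite (problem_init _ _ _ _ _ _ _ _ _ _ Hsol); [ring | ].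
    rewrite <- HxN. unfold xgrid. assert (INR i <= INR N) by now apply le_INR.
    generalize (pos_INR i). nra.
  - intros m Hm. unfold z, ug. rewrite HxN. replace (xgrid h 0) with 0 by (unfold xgrid; simpl; ring).
    rewrite (problem_bc_value _ _ _ _ _ _ _ _ _ _ Hsol).
    + specialize (Hval m Hm). lra.
    + split; [apply (tgrid_nonneg T NT m HT Hm) | now apply (tgrid_le_T T NT m HT Hm)].
  - intros m i Hm Hi. fold h tau. rewrite Hcap.
    assert (H : Rabs (caputo_h nu sg tau (fun s => ug s i) m
        - diff_fwd h (fun j => a m j * diff_back h (level sg ug m) j) i - f (xgrid h i) (tsig sg tau m))
        <= Cc * tau ^ 2 + 8 * M ^ 2 * tau ^ 2 + 6 * M ^ 2 * h ^ 2)
      by exact (interior_truncation nu T alpha beta gamma M k f u mu u0 N NT m Hnu HT Hk Hf Hu Hsol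
        HkM HuM HN Hm i Hi).
    specialize (Heq m i Hm Hi).
    replace (diff_fwd h (fun j => a m j * diff_back h (level sg z m) j) i)
      with (diff_fwd h (fun j => a m j * diff_back h (level sg y m) j) i
            - diff_fwd h (fun j => a m j * diff_back h (level sg ug m) j) i)
      by (unfold diff_fwd, diff_back; rewrite !Hlev; field; lra).
    assert (H' : Cc * tau ^ 2 + 8 * M ^ 2 * tau ^ 2 + 6 * M ^ 2 * h ^ 2 <= X) by (unfold X; lra).
    change (fun j => k (xgrid h j - / 2 * h) (tsig sg tau m) * diff_back h (level sg y m) j)
      with (fun j => a m j * diff_back h (level sg y m) j) in Heq.
    apply Rabs_le_between in H. apply Rabs_le. rewrite HX. lra.
  - intros m Hm. fold h tau. rewrite !Hcap.
    assert (H : Rabs (h / 2 * (beta * caputo_h nu sg tau (fun s => ug s 0%nat) m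
          + caputo_h nu sg tau (fun s => ug s N) m)
        + (a m N * diff_back h (level sg ug m) N - beta * (a m 1%nat * diff_fwd h (level sg ug m) 0)
           - gamma * level sg ug m N)
        - (mu (tsig sg tau m) + h / 2 * (f (xgrid h N) (tsig sg tau m) + beta * f (xgrid h 0) (tsig sg tau m))))
        <= (1 + Rabs beta) * (Cc * tau ^ 2 + M ^ 2 * tau ^ 2 + 2 * M ^ 2 * h ^ 2) + Rabs gamma * M * tau ^ 2)
      by exact (boundary_truncation nu T alpha beta gamma M k f u mu u0 N NT m Hnu HT Hk Hf Hu Hsol
        HkM HuM HN Hm).
    specialize (Hflux m Hm).
    change (k (xgrid h N - / 2 * h) (tsig sg tau m)) with (a m N) in Hflux.
    change (k (xgrid h 1 - / 2 * h) (tsig sg tau m)) with (a m 1%nat) in Hflux.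
    (* Brings the boundary equation to the scaling in which stability and consistency are stated. *)
    apply (Rmult_eq_compat_l (h / 2)) in Hflux.
    replace (diff_back h (level sg z m) N) with (diff_back h (level sg y m) N - diff_back h (level sg ug m) N)
      by (unfold diff_back; rewrite !Hlev; field; lra).
    replace (diff_fwd h (level sg z m) 0) with (diff_fwd h (level sg y m) 0 - diff_fwd h (level sg ug m) 0)
      by (unfold diff_fwd; rewrite !Hlev; field; lra).
    rewrite Hlev.
    rewrite <- Rabs_Ropp in H.
    match type of H with Rabs ?e <= _ =>
      match goal with |- Rabs ?g <= _ => replace g with e end end.
    2: { match type of Hflux with ?l = ?r =>
           match goal with |- ?e = ?g => apply Rminus_diag_uniq; replace (e - g) with (r - l) by (field; lra) end end.
         rewrite Hflux. ring. }
    apply Rle_trans with (1 := H). rewrite HX.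
    assert (Cc * tau ^ 2 + M ^ 2 * tau ^ 2 + 2 * M ^ 2 * h ^ 2 <= X) by (unfold X; lra).
    assert ((1 + Rabs beta) * (Cc * tau ^ 2 + M ^ 2 * tau ^ 2 + 2 * M ^ 2 * h ^ 2) <= (1 + Rabs beta) * X)
      by (apply Rmult_le_compat_l; lra).
    lra.
Qed.
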